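(* Let $1<p<\infty$, let $a\in GL^\infty(\mathbb T)$, and let $A$ denote any of the operators $$T(a)-H_\alpha(a\chi^{-1}),\quad T(a)+H_\alpha(a\chi),\quad T(a)+H_\alpha(a),\quad T(a)-H_\alpha(a)$$ on $H^p$. Then $\min\{\dim\ker A,\dim\operatorname{coker}A\}=0$.
   Context: $\mathbb T$ is the unit circle; $H^p=\{f\in L^p(\mathbb T):\hat f_n=0\ \forall n<0\}$; $P$ is the Riesz projection onto $H^p$, $Q=I-P$; $T(a)f=P(af)$ on $H^p$. Fix $\beta\in\mathbb C$ with $|\beta|>1$ and let $\alpha(z)=\frac{z-\beta}{\bar\beta z-1}$; $\alpha$ maps $\mathbb T$ onto itself, reverses orientation and satisfies $\alpha(\alpha(t))=t$. Put $\lambda=i\sqrt{|\beta|^2-1}$, $\alpha_-(t)=\frac{\lambda t}{\bar\beta t-1}$, $\chi(t)=t/\alpha_-(t)$, and define $J_\alpha\varphi(t)=t^{-1}\alpha_-(t)\varphi(\alpha(t))=\chi^{-1}(t)\varphi(\alpha(t))$ on $L^p(\mathbb T)$. For $a\in L^\infty$, $a_\alpha:=a\circ\alpha$, and the generalized Hankel operator on $H^p$ is $H_\alpha(a)f=P(a\,QJ_\alpha f)$. $\operatorname{coker}A$ is $H^p/\overline{\operatorname{im}A}$. *)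

(* Defs.v *)
From HB Require Import structures.
From mathcomp Require Import all_boot all_order all_algebra.
From mathcomp Require Import all_classical all_reals all_analysis.
From mathcomp Require Import complex.
From Stdlib Require Import ClassicalEpsilon.
Set Implicit Arguments. Unset Strict Implicit. Unset Printing Implicit Defensive.
Import Order.TTheory GRing.Theory Num.Theory.
Local Open Scope ring_scope.
Local Open Scope classical_set_scope.

Section HardyToeplitzHankel.
Variable R : realType.
Local Notation C := (R[i]).
Local Notation mu := (@lebesgue_measure R).

Definition eit (th : R) : C := Complex (cos th) (sin th).
Definition cmod (z : C) : R := Normc.normc z.
Definition circ : set R := `[0, 2 * pi]%classic.

(* A function on T is represented by any f : C -> C (only its values on T matter). *)
Definition meas_on_T (f : C -> C) : Prop :=
  measurable_fun circ (fun th => complex.Re (f (eit th))) /\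
  measurable_fun circ (fun th => complex.Im (f (eit th))).

Definition Lp (p : R) (f : C -> C) : Prop :=
  meas_on_T f /\
  (\int[mu]_(th in circ) ((cmod (f (eit th))) `^ p)%:E < +oo)%E.

Definition lpnorm (p : R) (f : C -> C) : R :=
  (fine (\int[mu]_(th in circ) ((cmod (f (eit th))) `^ p)%:E)) `^ p^-1.

Definition aeT_eq (f g : C -> C) : Prop :=
  {ae mu, forall th, circ th -> f (eit th) = g (eit th)}.

Definition Linf (a : C -> C) : Prop :=
  meas_on_T a /\ exists M : R, {ae mu, forall th, circ th -> cmod (a (eit th)) <= M}.
Definition GLinf (a : C -> C) : Prop :=
  Linf a /\ exists b : C -> C, Linf b /\ aeT_eq (fun t => a t * b t) (fun _ => 1).

Definition fourier (f : C -> C) (n : int) : C :=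
  Complex
    ((2 * pi)^-1 * Rintegral mu circ
        (fun th => complex.Re (f (eit th) * eit (- (n%:~R) * th))))
    ((2 * pi)^-1 * Rintegral mu circ
        (fun th => complex.Im (f (eit th) * eit (- (n%:~R) * th)))).

Definition Hp (p : R) (f : C -> C) : Prop :=
  Lp p f /\ forall n : int, (n < 0)%R -> fourier f n = 0.

(* Riesz projection P onto H^p: P f is (a representative of) the element of H^p
   whose nonnegative Fourier coefficients are those of f (it exists for
   f in L^p, 1 < p < oo, by M. Riesz's theorem, and is unique a.e.). *)
Definition RieszP (p : R) (f : C -> C) : C -> C :=
  epsilon (inhabits (fun _ : C => 0 : C))
    (fun g => Hp p g /\ forall n : int, (0 <= n)%R -> fourier g n = fourier f n).
Definition RieszQ (p : R) (f : C -> C) : C -> C :=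
  fun t => f t - RieszP p f t.

Definition alpha (beta : C) (z : C) : C := (z - beta) / (conjc beta * z - 1).
Definition lam (beta : C) : C := 'i%C * (Num.sqrt (cmod beta ^+ 2 - 1))%:C%C.
Definition alpha_minus (beta : C) (t : C) : C := lam beta * t / (conjc beta * t - 1).
Definition chi (beta : C) (t : C) : C := t / alpha_minus beta t.
Definition Jalpha (beta : C) (phi : C -> C) : C -> C :=
  fun t => (chi beta t)^-1 * phi (alpha beta t).

Definition Toeplitz (p : R) (a : C -> C) (f : C -> C) : C -> C :=
  RieszP p (fun t => a t * f t).
Definition Hankel (p : R) (beta : C) (a : C -> C) (f : C -> C) : C -> C :=
  RieszP p (fun t => a t * RieszQ p (Jalpha beta f) t).

End HardyToeplitzHankel.

(* Main.v *)
Require Import Defs.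
From HB Require Import structures.
From mathcomp Require Import all_boot all_order all_algebra.
From mathcomp Require Import all_classical all_reals all_analysis.
From mathcomp Require Import measurable_realfun complex.
From mathcomp Require Import ring lra.
From Stdlib Require ClassicalEpsilon.
Set Implicit Arguments. Unset Strict Implicit. Unset Printing Implicit Defensive.
Import Order.TTheory GRing.Theory Num.Theory.
Import numFieldNormedType.Exports.
Local Open Scope ring_scope.
Local Open Scope classical_set_scope.

(* Since J maps H^p into the kernel of P and back, A f = P (a (f + s c J f)) with
   b = a c.  If f is in ker A, then phi = f + s c J f has a phi antianalytic.  If the
   range is not dense, some g <> 0 in the conjugate of H^q annihilates a (f + s c J f)
   for all f in H^p; a change of variable turns this into w = psi + s J (c psi) in H^q
   with psi = a g / t, and w satisfies J w = s c w, whence w = 0.  Then F = phi psi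
   satisfies F o alpha = - chi^2 F.  As a product of antianalytic functions F has
   coefficients only at n <= -2, while J (a phi) J (g / t) = - F is analytic; so F = 0,
   one of its factors vanishes, and f = 0.

   The M. Riesz theorem for 1 < p < 2 comes from integrating, for F analytic with
   Re F = S >= 0, a pointwise bound of |Im F|^p by S^p minus a dyadic sum of
   s^(p-1) Re (F^2 / (F + s)), whose mean F(0)^2 / (F(0) + s) is nonnegative. *)

(** * The circle, means over it, and membership in L^p *)

Section CircleBasics.
Variable R : realType.
Local Notation C := (R[i]).
Local Notation mu := (@lebesgue_measure R).
Local Notation Re := (@complex.Re R).
Local Notation Im := (@complex.Im R).
Implicit Types (f g h : C -> C) (z w t : C) (p q : R).

(** The pairing of weights with signs is forced. [J] sends a constant to its multiple by [1 / chi],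
    so [J w = w / chi] has constant solutions, while [J w = - w / chi] has only 0. In all four cases
    [c (alpha t) * c t = 1] and [s * s = 1], which is why [phi] and [w] reproduce themselves under
    [alpha] up to a factor.

    The annihilating [g] is constructed explicitly: the duality map, which sends z to |z|^(p-2) conj
    z, is applied to the shortest vector of a coset, found by uniform convexity. The same
    construction gives the density of trigonometric polynomials.

    The dyadic sum discretises a formula for F^p: for 1 < p < 2 it is a constant times the integral
    over s > 0 of s^(p-2) F^2 / (F + s). In that range Re F^p is negative near the imaginary axis,
    which is where |Im F|^p has to be controlled, and the rational terms have means that can be
    computed from those of polynomials. The case p = 2 is orthogonality, and p > 2 follows from the
    conjugate exponent because the projection is its own adjoint. *)

Lemma cmodE z : cmod z = Num.sqrt (Re z ^+ 2 + Im z ^+ 2).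
Proof. by case: z. Qed.

Lemma cmod_ge0 z : 0 <= cmod z.
Proof. by rewrite cmodE sqrtr_ge0. Qed.

Lemma cmodM z w : cmod (z * w) = cmod z * cmod w.
Proof. exact: Normc.normcM. Qed.

Lemma cmodD z w : cmod (z + w) <= cmod z + cmod w.
Proof. exact: le_normcD. Qed.

Lemma cmodN z : cmod (- z) = cmod z.
Proof. exact: normcN. Qed.

Lemma cmodB z w : cmod (z - w) <= cmod z + cmod w.
Proof. by rewrite (le_trans (cmodD _ _))// cmodN. Qed.

Lemma cmod0 : cmod (0 : C) = 0. Proof. exact: Normc.normc0. Qed.
Lemma cmod1 : cmod (1 : C) = 1. Proof. exact: Normc.normc1. Qed.

Lemma cmodV z : cmod z^-1 = (cmod z)^-1.
Proof. exact: Normc.normcV. Qed.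

Lemma cmodX z n : cmod (z ^+ n) = cmod z ^+ n.
Proof. by elim: n => [|n ih]; rewrite ?expr0 ?cmod1// !exprS cmodM ih. Qed.

Lemma cmod_eq0 z : (cmod z == 0) = (z == 0).
Proof.
by apply/eqP/eqP => [/Normc.eq0_normc//|->]; rewrite cmod0.
Qed.

Lemma cmod_conj z : cmod (conjc z) = cmod z.
Proof. by case: z => a b; rewrite !cmodE/= sqrrN. Qed.

Lemma cmod_real (x : R) : cmod (x%:C%C) = `|x|.
Proof. by rewrite cmodE/= expr0n/= addr0 sqrtr_sqr. Qed.

Lemma cmod_sqr z : cmod z ^+ 2 = Re z ^+ 2 + Im z ^+ 2.
Proof. by rewrite cmodE sqr_sqrtr// addr_ge0// sqr_ge0. Qed.

Lemma ler_Re_cmod z : `|Re z| <= cmod z.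
Proof.
rewrite -sqrtr_sqr cmodE ler_sqrt ?addr_ge0 ?sqr_ge0//.
by rewrite lerDl sqr_ge0.
Qed.

Lemma ler_Im_cmod z : `|Im z| <= cmod z.
Proof.
rewrite -sqrtr_sqr cmodE ler_sqrt ?addr_ge0 ?sqr_ge0//.
by rewrite lerDr sqr_ge0.
Qed.

Lemma ler_cmod_ReIm z : cmod z <= `|Re z| + `|Im z|.
Proof.
rewrite -(ler_pXn2r (n := 2))// ?nnegrE ?addr_ge0 ?cmod_ge0//.
rewrite cmod_sqr sqrrD !real_normK ?num_real// addrAC lerDl.
by rewrite mulrn_wge0// mulr_ge0.
Qed.

Lemma mulc_conj z : z * conjc z = (cmod z ^+ 2)%:C%C.
Proof.
rewrite cmod_sqr; case: z => a b /=; apply/eqP; rewrite eq_complex /=.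
by apply/andP; split; apply/eqP; ring.
Qed.

Lemma cReM z w : Re (z * w) = Re z * Re w - Im z * Im w.
Proof. by case: z; case: w. Qed.

Lemma cImM z w : Im (z * w) = Re z * Im w + Im z * Re w.
Proof. by case: z => a b; case: w. Qed.

Lemma cReD z w : Re (z + w) = Re z + Re w. Proof. by case: z; case: w. Qed.
Lemma cImD z w : Im (z + w) = Im z + Im w. Proof. by case: z; case: w. Qed.
Lemma cReN z : Re (- z) = - Re z. Proof. by case: z. Qed.
Lemma cImN z : Im (- z) = - Im z. Proof. by case: z. Qed.
Lemma cReJ z : Re (conjc z) = Re z. Proof. by case: z. Qed.
Lemma cImJ z : Im (conjc z) = - Im z. Proof. by case: z. Qed.

Lemma complex_ext z w : Re z = Re w -> Im z = Im w -> z = w.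
Proof. by case: z => a b; case: w => c d /= -> ->. Qed.

Lemma cmod_eit (x : R) : cmod (eit x) = 1.
Proof. by rewrite cmodE/= cos2Dsin2 sqrtr1. Qed.

Lemma eitD (x y : R) : eit (x + y) = eit x * eit y.
Proof. by apply: complex_ext; rewrite /= ?cosD ?sinD//; ring. Qed.

Lemma eit0 : eit (0 : R) = 1.
Proof. by rewrite /eit cos0 sin0. Qed.

Lemma eitN (x : R) : eit (- x) = conjc (eit x).
Proof. by rewrite /eit cosN sinN. Qed.

Lemma eit_neq0 (x : R) : eit x != 0.
Proof. by rewrite -cmod_eq0 cmod_eit oner_eq0. Qed.

Lemma eitNV (x : R) : eit (- x) = (eit x)^-1.
Proof.
by apply: (mulfI (eit_neq0 x)); rewrite -eitD subrr eit0 divff ?eit_neq0.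
Qed.

Lemma eitX (x : R) n : eit (n%:R * x) = eit x ^+ n.
Proof.
elim: n => [|n ih]; first by rewrite mul0r eit0 expr0.
by rewrite -[in LHS]addn1 natrD mulrDl mul1r eitD ih exprSr.
Qed.

Lemma eitXz (x : R) (n : int) : eit (n%:~R * x) = eit x ^ n.
Proof.
case: n => n; first by rewrite -exprnP -eitX.
by rewrite NegzE mulrNz mulNr eitNV -exprnN -eitX pmulrn.
Qed.

Lemma circleP z : cmod z = 1 -> exists2 x : R, z = eit x & 0 <= x <= 2 * pi.
Proof.
move=> z1; have h : Re z ^+ 2 + Im z ^+ 2 = 1 by rewrite -cmod_sqr z1 expr1n.
have hRe : -1 <= Re z <= 1 by rewrite -ler_norml -z1 ler_Re_cmod.
have hs : Num.sqrt (1 - Re z ^+ 2) = `|Im z|.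
  by rewrite -h addrAC subrr add0r sqrtr_sqr.
have := acos_ge0 hRe; have := acos_lepi hRe; have p0 := pi_ge0 R => a1 a0.
have [i0|i0] := leP 0 (Im z).
  exists (acos (Re z)); last by apply/andP; split => //; lra.
  apply: complex_ext => /=; first by rewrite acosK.
  by rewrite sin_acos// hs ger0_norm.
exists (2 * pi - acos (Re z)); last by apply/andP; split; lra.
have e : 2 * pi - acos (Re z) = - acos (Re z) + pi *+ 2 by rewrite mulr2n; ring.
apply: complex_ext => /=; rewrite e.
  by rewrite cosD2pi cosN acosK.
by rewrite sinD2pi sinN sin_acos// hs ltr0_norm// opprK.
Qed.

Lemma conj_circ z : cmod z = 1 -> conjc z = z^-1.
Proof. by move=> /circleP[x -> _]; rewrite -eitN eitNV. Qed.

Definition cmean f : C :=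
  Complex ((2 * pi)^-1 * Rintegral mu (@circ R) (fun x => Re (f (eit x))))
          ((2 * pi)^-1 * Rintegral mu (@circ R) (fun x => Im (f (eit x)))).

Lemma measurable_circ : measurable (@circ R).
Proof. exact: measurable_itv. Qed.
#[local] Hint Resolve measurable_circ : core.

Lemma mu_circ : mu (@circ R) = (2 * pi)%:E.
Proof.
rewrite /circ lebesgue_measure_itv/= lte_fin.
by rewrite mulr_gt0 ?pi_gt0// oppr0 adde0.
Qed.

Definition tcont f := continuous (fun x => Re (f (eit x))) /\
                      continuous (fun x => Im (f (eit x))).

Lemma tcont_meas f : tcont f -> meas_on_T f.
Proof.
by move=> [cr ci]; split; apply: measurable_funTS;
  exact: continuous_measurable_fun.
Qed.

Lemma meas_cst (z : C) : meas_on_T (fun _ => z).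
Proof. by split; exact: measurable_cst. Qed.

Lemma meas_eq f g : (forall x, f (eit x) = g (eit x)) -> meas_on_T f -> meas_on_T g.
Proof.
by move=> fg [mr mi]; split; [move: mr|move: mi];
  congr measurable_fun; apply/funext => x /=; rewrite fg.
Qed.

Lemma meas_id : meas_on_T (fun t : C => t).
Proof.
by apply: tcont_meas; split => /=; [exact: continuous_cos|exact: continuous_sin].
Qed.

Lemma measD f g : meas_on_T f -> meas_on_T g -> meas_on_T (fun t => f t + g t).
Proof.
move=> [fr fi] [gr gi]; split.
  by under eq_fun do rewrite cReD; exact: measurable_funD.
by under eq_fun do rewrite cImD; exact: measurable_funD.
Qed.

Lemma measN f : meas_on_T f -> meas_on_T (fun t => - f t).
Proof.
move=> [fr fi]; split.
  by under eq_fun do rewrite cReN; exact: measurableT_comp.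
by under eq_fun do rewrite cImN; exact: measurableT_comp.
Qed.

Lemma measB f g : meas_on_T f -> meas_on_T g -> meas_on_T (fun t => f t - g t).
Proof. by move=> mf mg; apply: measD => //; exact: measN. Qed.

Lemma measM f g : meas_on_T f -> meas_on_T g -> meas_on_T (fun t => f t * g t).
Proof.
move=> [fr fi] [gr gi]; split.
  by under eq_fun do rewrite cReM; apply: measurable_funB; exact: measurable_funM.
by under eq_fun do rewrite cImM; apply: measurable_funD; exact: measurable_funM.
Qed.

Lemma measJ f : meas_on_T f -> meas_on_T (fun t => conjc (f t)).
Proof.
move=> [fr fi]; split.
  by under eq_fun do rewrite cReJ.
by under eq_fun do rewrite cImJ; exact: measurableT_comp.
Qed.

Lemma measX f n : meas_on_T f -> meas_on_T (fun t => f t ^+ n).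
Proof.
move=> mf; elim: n => [|n ih]; first by under eq_fun do rewrite expr0; exact: meas_cst.
by under eq_fun do rewrite exprS; exact: measM.
Qed.

Lemma meas_horner (P : {poly C}) : meas_on_T (fun t => P.[t]).
Proof.
elim/poly_ind: P => [|P c ih].
  by under eq_fun do rewrite horner0; exact: meas_cst.
under eq_fun do rewrite !hornerE.
by apply: measD; [apply: measM => //; exact: meas_id|exact: meas_cst].
Qed.

Lemma meas_cmod f : meas_on_T f -> measurable_fun (@circ R) (fun x => cmod (f (eit x))).
Proof.
move=> [fr fi]; under eq_fun do rewrite cmodE -powR12_sqrt ?addr_ge0 ?sqr_ge0//.
apply: (measurableT_comp (measurable_powR _)).
by apply: measurable_funD; exact: measurable_funX.
Qed.

Lemma meas_cmodX p f : meas_on_T f ->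
  measurable_fun (@circ R) (fun x => (cmod (f (eit x)) `^ p)%:E).
Proof.
move=> mf; apply/measurable_EFinP; apply: (measurableT_comp (measurable_powR _)).
exact: meas_cmod.
Qed.

Lemma meas_real (u : C -> R) : measurable_fun (@circ R) (fun x => u (eit x)) ->
  meas_on_T (fun t => (u t)%:C%C).
Proof. by move=> mu_; split => //=; exact: measurable_cst. Qed.

Lemma meas_invX n : meas_on_T (fun t : C => t ^- n).
Proof.
apply: (@meas_eq (fun t => conjc t ^+ n)); last by apply/measX/measJ/meas_id.
by move=> x; rewrite -eitN eitNV exprVn.
Qed.

Lemma meas_expz (n : int) : meas_on_T (fun t : C => t ^ n).
Proof.
case: n => n; first by apply: measX; exact: meas_id.
exact: meas_invX.
Qed.

Definition pint p f : \bar R :=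
  (\int[mu]_(x in @circ R) ((cmod (f (eit x))) `^ p)%:E)%E.

(* Sealed, lest conversion unfold failing unification problems down to the
   Lebesgue integral. *)
Fact inLp_sealed : {P : R -> (C -> C) -> Prop | forall p f, P p f <-> Lp p f}.
Proof. by exists (@Lp R). Qed.

Definition inLp : R -> (C -> C) -> Prop := sval inLp_sealed.

Lemma LpE p f : inLp p f <-> Lp p f.
Proof. exact: (svalP inLp_sealed). Qed.

Lemma LpP p f : inLp p f <-> meas_on_T f /\ (pint p f < +oo)%E.
Proof. exact: LpE. Qed.

Lemma Lp_meas p f : inLp p f -> meas_on_T f.
Proof. by move=> /LpP[]. Qed.

Lemma Lp_fin p f : inLp p f -> (pint p f < +oo)%E.
Proof. by move=> /LpP[]. Qed.

Lemma pint_ge0 p f : (0 <= pint p f)%E.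
Proof. by apply: integral_ge0 => x _; rewrite lee_fin powR_ge0. Qed.

Definition aeT (P : C -> Prop) : Prop := {ae mu, forall x, circ x -> P (eit x)}.

Lemma aeTW (P : C -> Prop) : (forall t, cmod t = 1 -> P t) -> aeT P.
Proof. by move=> h; apply: aeW => x _; apply: h; rewrite cmod_eit. Qed.

Lemma aeTS (P Q : C -> Prop) : (forall t, cmod t = 1 -> P t -> Q t) ->
  aeT P -> aeT Q.
Proof.
move=> h; rewrite /aeT; apply: (@filterS _ _ (ae_filter_ringOfSetsType mu)) => x hP cx; apply: h; first by rewrite cmod_eit.
exact: hP.
Qed.

Lemma aeTS2 (P Q S : C -> Prop) : (forall t, cmod t = 1 -> P t -> Q t -> S t) ->
  aeT P -> aeT Q -> aeT S.
Proof.
move=> h; rewrite /aeT; apply: (@filterS2 _ _ (ae_filter_ringOfSetsType mu)) => x hP hQ cx.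
by apply: h; [rewrite cmod_eit|exact: hP|exact: hQ].
Qed.

(** Two exponents on the right accommodate Young's inequality, where a product is bounded by a p-th
    power plus a q-th power. *)
Lemma pint_le2 p p1 p2 f f1 f2 (c1 c2 : R) :
  meas_on_T f -> meas_on_T f1 -> meas_on_T f2 -> 0 <= c1 -> 0 <= c2 ->
  aeT (fun t => cmod (f t) `^ p <= c1 * cmod (f1 t) `^ p1 + c2 * cmod (f2 t) `^ p2) ->
  (pint p f <= c1%:E * pint p1 f1 + c2%:E * pint p2 f2)%E.
Proof.
move=> mf mf1 mf2 c10 c20 h.
have Z c r g : 0 <= c -> meas_on_T g -> (c%:E * pint r g =
    \int[mu]_(x in @circ R) (c * cmod (g (eit x)) `^ r)%:E)%E.
  move=> c0 mg; under eq_integral do rewrite EFinM.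
  rewrite ge0_integralZl_EFin//; last exact: meas_cmodX.
  by move=> x _; rewrite lee_fin powR_ge0.
have mZ c r g : meas_on_T g ->
    measurable_fun (@circ R) (fun x => (c * cmod (g (eit x)) `^ r)%:E).
  move=> mg; apply/measurable_EFinP; apply: measurable_funM => //.
  by apply/measurable_EFinP; exact: meas_cmodX.
have Z0 c r g x : 0 <= c -> (0 <= (c * cmod (g (eit x)) `^ r)%:E)%E.
  by move=> c0; rewrite lee_fin mulr_ge0// powR_ge0.
rewrite !Z// -ge0_integralD//=; first last.
- exact: mZ.
- by move=> x _; exact: Z0.
- exact: mZ.
- by move=> x _; exact: Z0.
apply: ae_ge0_le_integral => //=.
- by move=> x _; rewrite lee_fin powR_ge0.
- exact: meas_cmodX.
- by move=> x cx; rewrite adde_ge0//; exact: Z0.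
- by apply: emeasurable_funD; exact: mZ.
Qed.

Lemma powRD_le p (x y : R) : 0 <= p -> 0 <= x -> 0 <= y ->
  (x + y) `^ p <= 2 `^ p * (x `^ p + y `^ p).
Proof.
move=> p0; wlog xy : x y / x <= y => [hw x0 y0|].
  by have [xy|/ltW xy] := leP x y; [exact: hw|rewrite addrC [_ + _ `^ _]addrC; exact: hw].
move=> x0 y0; apply: (@le_trans _ _ ((2 * y) `^ p)).
  by apply: ge0_ler_powR => //; rewrite ?nnegrE; lra.
by rewrite powRM// ler_wpM2l ?powR_ge0// lerDr powR_ge0.
Qed.

(** Young's inequality for [c^-1 * x] and [c * y], with [c] the power [1 / q] of [e]. It serves as
    Hoelder's inequality does: a factor that is small in L^p pays for the large [K], while the other
    factor costs only [e]. *)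
Lemma young_eps p q (e : R) : 1 < p -> p^-1 + q^-1 = 1 -> 0 < e ->
  exists2 K : R, 0 <= K & forall x y : R, 0 <= x -> 0 <= y ->
    x * y <= K * x `^ p + e * y `^ q.
Proof.
move=> p1 pq e0.
have p0 : 0 < p by lra.
have ip1 : p^-1 < 1 by rewrite invf_lt1.
have ip0 : 0 < p^-1 by rewrite invr_gt0.
have iq0 : 0 < q^-1 by lra.
have q0 : 0 < q by rewrite -invr_gt0.
pose c := e `^ q^-1.
have c0 : 0 < c by rewrite powR_gt0.
exists (c^-1 `^ p); first exact: powR_ge0.
move=> x y x0 y0.
have -> : x * y = (c^-1 * x) * (c * y) by field; rewrite gt_eqF.
have ci : 0 <= c^-1 by rewrite invr_ge0 ltW.
apply: le_trans (conjugate_powR _ _ p0 q0 pq) _; rewrite ?mulr_ge0 ?(ltW c0)//.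
rewrite !powRM ?(ltW c0)// -powRrM mulVf ?gt_eqF// powRr1 ?(ltW e0)//.
apply: lerD; rewrite ler_pdivrMr// ler_peMr ?mulr_ge0 ?powR_ge0 ?(ltW e0)//.
  by rewrite ltW.
by rewrite -invf_le1// ; lra.
Qed.

Lemma powR_le1D p (x : R) : 1 <= p -> 0 <= x -> x <= 1 + x `^ p.
Proof.
move=> p1 x0; have [x1|/ltW x1] := leP x 1.
  by rewrite (le_trans x1)// lerDl powR_ge0.
by rewrite (le_trans (le1r_powR x1 p1))// lerDr.
Qed.

Lemma pint_cst p (z : C) : pint p (fun=> z) = (cmod z `^ p * (2 * pi))%:E.
Proof. by rewrite /pint integral_cst//= mu_circ. Qed.

Lemma LpM_le p p1 p2 f f1 f2 (c1 c2 : R) : meas_on_T f -> inLp p1 f1 -> inLp p2 f2 ->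
  0 <= c1 -> 0 <= c2 ->
  aeT (fun t => cmod (f t) `^ p <= c1 * cmod (f1 t) `^ p1 + c2 * cmod (f2 t) `^ p2) ->
  inLp p f.
Proof.
move=> mf /LpP[m1 i1] /LpP[m2 i2] c10 c20 h; apply/LpP; split; first exact: mf.
apply: le_lt_trans (pint_le2 mf m1 m2 c10 c20 h) _.
by apply: lte_add_pinfty; (apply: lte_mul_pinfty; [by rewrite lee_fin|by []|assumption]).
Qed.

Lemma Lp_cst p (z : C) : inLp p (fun=> z).
Proof. by apply/LpP; split; [exact: meas_cst|rewrite pint_cst ltry]. Qed.

Lemma Lp_le p f g (c : R) : meas_on_T f -> inLp p g -> 0 <= c -> 0 <= p ->
  aeT (fun t => cmod (f t) <= c * cmod (g t)) -> inLp p f.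
Proof.
move=> mf gp c0 p0 h.
apply: (@LpM_le p p p f g g (c `^ p) 0) => //; first exact: powR_ge0.
apply: aeTS h => t t1 h; rewrite mul0r addr0 -powRM ?cmod_ge0//.
by apply: ge0_ler_powR; rewrite // nnegrE ?mulr_ge0 ?cmod_ge0.
Qed.

Lemma Lp_bdd p f (M : R) : 0 <= p -> meas_on_T f -> aeT (fun t => cmod (f t) <= M) -> inLp p f.
Proof.
move=> p0 mf h; apply: (@Lp_le p f (fun=> 1) `|M|) => //; first exact: Lp_cst.
by apply: aeTS h => t _ h; rewrite cmod1 mulr1 (le_trans h)// ler_norm.
Qed.

Lemma LpD p f g : 0 <= p -> inLp p f -> inLp p g -> inLp p (fun t => f t + g t).
Proof.
move=> p0 fp gp; apply: (LpM_le _ fp gp (powR_ge0 2 p) (powR_ge0 2 p)).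
  by apply: measD; [exact: Lp_meas fp|exact: Lp_meas gp].
apply: aeTW => t _; rewrite -mulrDr.
apply: le_trans (powRD_le p0 (cmod_ge0 _) (cmod_ge0 _)).
by apply: ge0_ler_powR; rewrite // ?nnegrE ?addr_ge0 ?cmod_ge0// cmodD.
Qed.

Lemma LpM p f g (M : R) : 0 <= p -> meas_on_T g -> aeT (fun t => cmod (g t) <= M) ->
  inLp p f -> inLp p (fun t => g t * f t).
Proof.
move=> p0 mg gM fp; apply: (@Lp_le p _ f `|M|) => //.
  by apply: measM => //; exact: Lp_meas fp.
apply: aeTS gM => t _ h; rewrite cmodM ler_wpM2r ?cmod_ge0//.
by rewrite (le_trans h)// ler_norm.
Qed.

Lemma LpZ p f z : 0 <= p -> inLp p f -> inLp p (fun t => z * f t).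
Proof.
move=> p0 fp; apply: (@LpM p f (fun=> z) (cmod z)) fp => //=.
by apply: aeTW.
Qed.

Lemma LpN p f : 0 <= p -> inLp p f -> inLp p (fun t => - f t).
Proof.
move=> p0 fp; have := LpZ (-1) p0 fp; congr inLp.
by apply/funext => t; rewrite mulN1r.
Qed.

Lemma LpB p f g : 0 <= p -> inLp p f -> inLp p g -> inLp p (fun t => f t - g t).
Proof. by move=> p0 fp gp; apply: LpD => //; exact: LpN. Qed.

Lemma LpJ p f : 0 <= p -> inLp p f -> inLp p (fun t => conjc (f t)).
Proof.
move=> p0 fp; apply: (@Lp_le p _ f 1) => //; first exact: measJ (Lp_meas fp).
by apply: aeTW => t _; rewrite cmod_conj mul1r.
Qed.

Lemma Lp_ae p f g : 0 <= p -> meas_on_T g -> aeT_eq f g -> inLp p f -> inLp p g.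
Proof.
move=> p0 mg fg fp; apply: (@Lp_le p g f 1) => //.
by apply: (@aeTS (fun t => f t = g t)) => // t _ ->; rewrite mul1r.
Qed.

Lemma Lp1_Lp p f : 1 <= p -> inLp p f -> inLp 1 f.
Proof.
move=> p1 fp; apply: (LpM_le _ (Lp_cst p 1) fp (ler01) (ler01)); first exact: Lp_meas fp.
apply: aeTW => t _; rewrite cmod1 powR1 powRr1 ?cmod_ge0// !mul1r.
exact/powR_le1D/cmod_ge0.
Qed.

Lemma Lp1_mul p q f g : 1 < p -> p^-1 + q^-1 = 1 -> inLp p f -> inLp q g ->
  inLp 1 (fun t => f t * g t).
Proof.
move=> p1 pq fp gq; have [K K0 hK] := young_eps p1 pq ltr01.
apply: (LpM_le _ fp gq K0 ler01); first by apply: measM; [exact: Lp_meas fp|exact: Lp_meas gq].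
apply: aeTW => t _; rewrite powRr1 ?cmod_ge0// cmodM.
by apply: hK; exact: cmod_ge0.
Qed.

Lemma Lp1_integrable f : inLp 1 f ->
  mu.-integrable (@circ R) (EFin \o (fun x => cmod (f (eit x)))).
Proof.
move=> /LpP[mf fi]; apply/integrableP; split.
  by apply/measurable_EFinP; exact: meas_cmod.
apply: le_lt_trans fi; apply: ge0_le_integral => //.
- by apply: measurableT_comp => //; apply/measurable_EFinP; exact: meas_cmod.
- exact: meas_cmodX.
- by move=> x _ /=; rewrite lee_fin powRr1 ?cmod_ge0// ger0_norm ?cmod_ge0.
Qed.

Lemma Lp1_Re f : inLp 1 f -> mu.-integrable (@circ R) (EFin \o (fun x => Re (f (eit x)))).
Proof.
move=> fi; have [mr _] := Lp_meas fi; apply: le_integrable (Lp1_integrable fi) => //.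
  exact/measurable_EFinP.
move=> x _ /=; rewrite lee_fin [leRHS]ger0_norm ?cmod_ge0//.
exact: ler_Re_cmod.
Qed.

Lemma Lp1_Im f : inLp 1 f -> mu.-integrable (@circ R) (EFin \o (fun x => Im (f (eit x)))).
Proof.
move=> fi; have [_ mi] := Lp_meas fi; apply: le_integrable (Lp1_integrable fi) => //.
  exact/measurable_EFinP.
move=> x _ /=; rewrite lee_fin [leRHS]ger0_norm ?cmod_ge0//.
exact: ler_Im_cmod.
Qed.

Lemma eq_cmean f g : (forall t, cmod t = 1 -> f t = g t) -> cmean f = cmean g.
Proof.
move=> fg; rewrite /cmean; congr (Complex (_ * _) (_ * _)); apply: eq_Rintegral => x _;
  by rewrite fg// cmod_eit.
Qed.

Lemma cmeanD f g : inLp 1 f -> inLp 1 g -> cmean (fun t => f t + g t) = cmean f + cmean g.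
Proof.
move=> fi gi; apply: complex_ext; rewrite /= -mulrDr; congr (_ * _).
  under eq_Rintegral do rewrite cReD.
  by rewrite RintegralD//; exact: Lp1_Re.
under eq_Rintegral do rewrite cImD.
by rewrite RintegralD//; exact: Lp1_Im.
Qed.

Lemma cmeanZ z f : inLp 1 f -> cmean (fun t => z * f t) = z * cmean f.
Proof.
move=> fi; have fr := Lp1_Re fi; have fm := Lp1_Im fi.
have ir (r : R) (u : R -> R) : mu.-integrable (@circ R) (EFin \o u) ->
    mu.-integrable (@circ R) (EFin \o (fun x => r * u x)).
  by move=> ui; apply: eq_integrable (integrableZl _ r ui).
apply: complex_ext.
  rewrite [LHS]/= cReM/=; under eq_Rintegral do rewrite cReM.
  rewrite RintegralB//; [|exact: ir..].
  by rewrite !RintegralZl//; ring.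
rewrite [LHS]/= cImM/=; under eq_Rintegral do rewrite cImM.
rewrite RintegralD//; [|exact: ir..].
by rewrite !RintegralZl//; ring.
Qed.

Lemma cmeanZr z f : inLp 1 f -> cmean (fun t => f t * z) = cmean f * z.
Proof.
move=> fi; rewrite mulrC -cmeanZ//; apply: eq_cmean => t _; exact: mulrC.
Qed.

Lemma cmeanN f : inLp 1 f -> cmean (fun t => - f t) = - cmean f.
Proof.
move=> fi; rewrite -[RHS]mulN1r -cmeanZ//; apply: eq_cmean => t _.
by rewrite mulN1r.
Qed.

Lemma cmeanB f g : inLp 1 f -> inLp 1 g -> cmean (fun t => f t - g t) = cmean f - cmean g.
Proof. by move=> fi gi; rewrite cmeanD ?cmeanN//; exact: LpN. Qed.

Lemma cmeanJ f : inLp 1 f -> cmean (fun t => conjc (f t)) = conjc (cmean f).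
Proof.
move=> fi; apply: complex_ext => /=.
  by congr (_ * _); apply: eq_Rintegral => x _; rewrite cReJ.
rewrite -mulrN; congr (_ * _); under eq_Rintegral do rewrite cImJ -mulN1r.
by rewrite RintegralZl// ?mulN1r//; exact: Lp1_Im.
Qed.

Lemma cmean_cst z : cmean (fun=> z) = z.
Proof.
have p0 : 2 * pi != 0 :> R by rewrite gt_eqF// mulr_gt0// pi_gt0.
by apply: complex_ext; rewrite /= Rintegral_cst//= mu_circ/= mulrCA mulVf ?mulr1.
Qed.

Lemma cmean_ae f g : meas_on_T f -> meas_on_T g -> aeT_eq f g -> cmean f = cmean g.
Proof.
move=> [fr fm] [gr gm] fg; rewrite /cmean /Rintegral; congr (Complex (_ * fine _) (_ * fine _)).
  apply: ae_eq_integral => //; [exact/measurable_EFinP..|].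
  by apply: (@filterS _ _ (ae_filter_ringOfSetsType mu)) fg => x fg cx; rewrite fg.
apply: ae_eq_integral => //; [exact/measurable_EFinP..|].
by apply: (@filterS _ _ (ae_filter_ringOfSetsType mu)) fg => x fg cx; rewrite fg.
Qed.

Lemma cmean_le f : inLp 1 f -> cmod (cmean f) <= fine (pint 1 f).
Proof.
move=> fi; have fn := Lp1_integrable fi.
have e : fine (pint 1 f) = Rintegral mu (@circ R) (fun x => cmod (f (eit x))).
  by apply: eq_Rintegral => x _; rewrite powRr1// cmod_ge0.
have hr : `|Rintegral mu (@circ R) (fun x => Re (f (eit x)))| <= fine (pint 1 f).
  apply: le_trans (le_normr_Rintegral _ (Lp1_Re fi)) _ => //; rewrite e.
  apply: le_Rintegral => //; last by move=> x _; exact: ler_Re_cmod.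
  exact: (@integrable_norm _ _ _ mu _ _ (Lp1_Re fi)).
have hi : `|Rintegral mu (@circ R) (fun x => Im (f (eit x)))| <= fine (pint 1 f).
  apply: le_trans (le_normr_Rintegral _ (Lp1_Im fi)) _ => //; rewrite e.
  apply: le_Rintegral => //; last by move=> x _; exact: ler_Im_cmod.
  exact: (@integrable_norm _ _ _ mu _ _ (Lp1_Im fi)).
apply: le_trans (ler_cmod_ReIm _) _ => /=.
have p2 := pi_ge2 R.
have i0 : 0 <= (2 * pi)^-1 :> R by rewrite invr_ge0; lra.
rewrite !normrM ger0_norm// -mulrDr.
rewrite ler_pdivrMl; last lra.
have f0 : 0 <= fine (pint 1 f) by rewrite fine_ge0// pint_ge0.
apply: le_trans (lerD hr hi) _; nra.
Qed.

End CircleBasics.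

Arguments measurable_circ {R}.
Arguments pint {R} (p f)%_R.
#[local] Hint Extern 0 (measurable (@circ _)) => solve [apply: measurable_circ] : core.

(** * Means of the characters and of Laurent polynomials *)

Section TrigonometricPolynomials.
Variable R : realType.
Local Notation C := (R[i]).
Local Notation mu := (@lebesgue_measure R).
Local Notation Re := (@complex.Re R).
Local Notation Im := (@complex.Im R).
Implicit Types (f g h : C -> C) (z w t : C) (p q : R).

Lemma Rintegral_derive0 (F f : R -> R) : (forall x, is_derive x (1 : R) F (f x)) ->
  continuous f -> F (2 * pi) = F 0 -> Rintegral mu (@circ R) f = 0.
Proof.
move=> dF cf F0; have p0 : (0 < 2 * pi :> R) by rewrite mulr_gt0// pi_gt0.
have cF : continuous F.
  by move=> x; apply: differentiable_continuous; apply/derivable1_diffP; case: (dF x).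
rewrite /Rintegral (@continuous_FTC2 _ f F)//=.
- by rewrite F0 subrr.
- exact: continuous_subspaceT.
- split => [x _||].
  + by case: (dF x).
  + by apply: cvg_at_right_filter; exact: cF.
  + by apply: cvg_at_left_filter; exact: cF.
- by move=> x _; rewrite derive1E; apply: derive_val.
Qed.

Lemma eit_2pi : eit (2 * pi : R) = 1.
Proof.
by apply: complex_ext; rewrite /= mulr_natl ?cos2pi ?sin2pi.
Qed.

Lemma cmean_expz (n : int) : cmean (fun t : C => t ^ n) = (n == 0)%:R.
Proof.
have [->|n0] := eqVneq n 0.
  by rewrite -[RHS](cmean_cst 1); apply: eq_cmean => t _; rewrite expr0z.
have k0 : n%:~R != 0 :> R by rewrite intr_eq0.
set k : R := n%:~R in k0.
have e2 : eit (k * (2 * pi)) = 1 by rewrite eitXz eit_2pi exp1rz.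
have [c2 s2] : cos (k * (2 * pi)) = 1 /\ sin (k * (2 * pi)) = 0.
  by move: e2 => [-> ->].
apply: complex_ext => /=.
  rewrite (_ : Rintegral _ _ _ = 0) ?mulr0//.
  under eq_Rintegral do rewrite -eitXz /=.
  apply: (@Rintegral_derive0 (fun x => sin (k * x) / k)) => [x|x|].
  - by apply: is_derive_eq; rewrite /= /GRing.scale /=; field.
  - by apply: continuous_comp; [exact: mulrl_continuous|exact: continuous_cos].
  - by rewrite s2 mulr0 sin0.
rewrite (_ : Rintegral _ _ _ = 0) ?mulr0//.
under eq_Rintegral do rewrite -eitXz /=.
apply: (@Rintegral_derive0 (fun x => - cos (k * x) / k)) => [x|x|].
- by apply: is_derive_eq; rewrite /= /GRing.scale /=; field.
- by apply: continuous_comp; [exact: mulrl_continuous|exact: continuous_sin].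
- by rewrite c2 mulr0 cos0.
Qed.

Lemma fourierE f (n : int) : fourier f n = cmean (fun t => f t * t ^ (- n)).
Proof.
have e (x : R) : eit (- n%:~R * x) = eit x ^ (- n) by rewrite -mulrNz eitXz.
by rewrite /fourier /cmean; congr (Complex (_ * _) (_ * _)); apply: eq_Rintegral => x _;
  rewrite e.
Qed.

Lemma cmod_expz t (n : int) : cmod t = 1 -> cmod (t ^ n) = 1.
Proof.
move=> t1; case: n => n; first by rewrite /exprz cmodX t1 expr1n.
by rewrite /exprz cmodV cmodX t1 expr1n invr1.
Qed.

Lemma circ_neq0 t : cmod t = 1 -> t != 0.
Proof. by move=> t1; rewrite -cmod_eq0 t1 oner_eq0. Qed.

Lemma LpMz p f (n : int) : 0 <= p -> inLp p f -> inLp p (fun t => t ^ n * f t).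
Proof.
move=> p0 fp; apply: (@LpM _ p f (fun t => t ^ n) 1) => //; first exact: meas_expz.
by apply: aeTW => t t1; rewrite cmod_expz.
Qed.

Lemma LpMzr p f (n : int) : 0 <= p -> inLp p f -> inLp p (fun t => f t * t ^ n).
Proof.
move=> p0 /(LpMz n p0); congr inLp.
by apply/funext => t; rewrite mulrC.
Qed.

Lemma Lp1_mulz f (n : int) : inLp 1 f -> inLp 1 (fun t => f t * t ^ n).
Proof. exact: LpMzr. Qed.

(** * Trigonometric polynomials *)

Definition trig f := exists (n : nat) (P : {poly C}),
  forall t, cmod t = 1 -> f t = t ^- n * P.[t].

Lemma trig_cst z : trig (fun=> z).
Proof. by exists 0%N, z%:P => t _; rewrite hornerC expr0 invr1 mul1r. Qed.

Lemma trig_poly (P : {poly C}) : trig (fun t => P.[t]).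
Proof. by exists 0%N, P => t _; rewrite expr0 invr1 mul1r. Qed.

Lemma trig_id : trig (fun t : C => t).
Proof. by exists 0%N, 'X => t _; rewrite hornerX expr0 invr1 mul1r. Qed.

Lemma trigM f g : trig f -> trig g -> trig (fun t => f t * g t).
Proof.
move=> [n [P hP]] [m [Q hQ]]; exists (n + m)%N, (P * Q) => t t1.
by rewrite hP// hQ// hornerM exprD invfM; ring.
Qed.

Lemma trigD f g : trig f -> trig g -> trig (fun t => f t + g t).
Proof.
move=> [n [P hP]] [m [Q hQ]]; exists (n + m)%N, ('X^m * P + 'X^n * Q) => t t1.
have t0 := circ_neq0 t1.
rewrite hP// hQ// hornerD !hornerM !hornerXn exprD invfM.
by field; rewrite !expf_neq0.
Qed.

Lemma trigN f : trig f -> trig (fun t => - f t).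
Proof.
move=> [n [P hP]]; exists n, (- P) => t t1.
by rewrite hornerN mulrN hP.
Qed.

Lemma trigB f g : trig f -> trig g -> trig (fun t => f t - g t).
Proof. by move=> tf tg; apply: trigD => //; exact: trigN. Qed.

Lemma trigX f n : trig f -> trig (fun t => f t ^+ n).
Proof.
move=> tf; elim: n => [|n ih].
  by under eq_fun do rewrite expr0; exact: trig_cst.
by under eq_fun do rewrite exprS; exact: trigM.
Qed.

Lemma trig_eq f g : (forall t, cmod t = 1 -> f t = g t) -> trig f -> trig g.
Proof. by move=> fg [n [P hP]]; exists n, P => t t1; rewrite -fg// hP. Qed.

Lemma trigV : trig (fun t : C => t^-1).
Proof. by exists 1%N, 1 => t t1; rewrite hornerC mulr1 expr1. Qed.

Lemma trig_expz (n : int) : trig (fun t : C => t ^ n).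
Proof.
case: n => n; first by apply: trigX; exact: trig_id.
apply: (@trig_eq (fun t => t^-1 ^+ n.+1)); last by apply: trigX; exact: trigV.
by move=> t _; rewrite exprVn.
Qed.

Lemma trigJ f : trig f -> trig (fun t => conjc (f t)).
Proof.
move=> [n [P hP]].
apply: (@trig_eq (fun t => t ^+ n * (map_poly conjc P).[t^-1])); last first.
  apply: trigM; first by apply: trigX; exact: trig_id.
  elim/poly_ind: (map_poly _ _) => [|Q c ih].
    by under eq_fun do rewrite horner0; exact: trig_cst.
  under eq_fun do rewrite !hornerE.
  apply: trigD; last exact: trig_cst.
  by apply: trigM => //; exact: trigV.
move=> t t1; rewrite hP// rmorphM/= fmorphV rmorphXn/= conj_circ// exprVn invrK.
by rewrite -horner_map/= conj_circ.
Qed.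

Lemma trig_meas f : trig f -> meas_on_T f.
Proof.
move=> [n [P hP]]; apply: (@meas_eq _ (fun t => t ^- n * P.[t])).
  by move=> x; rewrite hP// cmod_eit.
by apply: measM; [exact: meas_invX|exact: meas_horner].
Qed.

Lemma horner_bdd (P : {poly C}) : exists M : R, forall t, cmod t = 1 -> cmod P.[t] <= M.
Proof.
elim/poly_ind: P => [|P c [M hM]]; first by exists 0 => t _; rewrite horner0 cmod0.
exists (M + cmod c) => t t1; rewrite !hornerE (le_trans (cmodD _ _))// lerD2r.
by rewrite cmodM t1 mulr1 hM.
Qed.

Lemma trig_bdd f : trig f -> exists M : R, forall t, cmod t = 1 -> cmod (f t) <= M.
Proof.
move=> [n [P hP]]; have [M hM] := horner_bdd P; exists M => t t1.
by rewrite hP// cmodM cmodV cmodX t1 expr1n invr1 mul1r hM.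
Qed.

Lemma trig_Lp p f : 0 <= p -> trig f -> inLp p f.
Proof.
move=> p0 tf; have [M hM] := trig_bdd tf.
by apply: (Lp_bdd p0 (trig_meas tf) (M := M)); exact: aeTW.
Qed.

Lemma inLp_eq p f g : 0 <= p -> (forall t, cmod t = 1 -> f t = g t) ->
  inLp p f -> inLp p g.
Proof.
move=> p0 fg fp; apply: (Lp_ae p0 _ _ fp); last exact: (@aeTW _ (fun t => f t = g t)).
by apply: meas_eq (Lp_meas fp) => x; rewrite fg// cmod_eit.
Qed.

Lemma LpMtrig p f g : 0 <= p -> trig g -> inLp p f -> inLp p (fun t => f t * g t).
Proof.
move=> p0 tg fp; have [M hM] := trig_bdd tg.
apply: (@inLp_eq _ (fun t => g t * f t)) => //; first by move=> t _; rewrite mulrC.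
by apply: (@LpM _ p f g M) => //; [exact: trig_meas|exact: aeTW].
Qed.

Lemma cmean_mul_poly f (P : {poly C}) (k : int) : inLp 1 f ->
  cmean (fun t => f t * (t ^ k * P.[t])) =
  \sum_(i < size P) P`_i * cmean (fun t => f t * t ^ (k + i%:Z)).
Proof.
move=> fi; rewrite -{1}[P]coefK poly_def.
elim/big_ind2 : _ => [|x1 x2 y1 y2 h1 h2|i _].
- rewrite -(cmean_cst 0); apply: eq_cmean => t _.
  by rewrite horner0 !mulr0.
- rewrite -h1 -h2 -cmeanD.
  + by apply: eq_cmean => t _; rewrite hornerD; ring.
  + by apply: LpMtrig => //; apply: trigM; [exact: trig_expz|exact: trig_poly].
  + by apply: LpMtrig => //; apply: trigM; [exact: trig_expz|exact: trig_poly].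
- rewrite -cmeanZ; last exact: Lp1_mulz.
  apply: eq_cmean => t t1; rewrite hornerZ hornerXn.
  by rewrite expfzDr ?circ_neq0// -exprnP; ring.
Qed.

Lemma cmean_mul_trig0 f g : inLp 1 f -> trig g -> (forall n : int, fourier f n = 0) ->
  cmean (fun t => f t * g t) = 0.
Proof.
move=> fi [n [P hP]] f0.
transitivity (cmean (fun t => f t * (t ^ (- n%:Z) * P.[t]))).
  by apply: eq_cmean => t t1; rewrite hP// exprnN.
rewrite cmean_mul_poly// big1// => i _; apply/eqP; rewrite mulf_eq0; apply/orP; right.
by apply/eqP; rewrite -(f0 (- (- n%:Z + i%:Z))) fourierE opprK.
Qed.

End TrigonometricPolynomials.

(** * Uniqueness of Fourier coefficients *)

Section FourierUniqueness.
Variable R : realType.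
Local Notation C := (R[i]).
Local Notation mu := (@lebesgue_measure R).
Local Notation Re := (@complex.Re R).
Local Notation Im := (@complex.Im R).
Implicit Types (f g h : C -> C) (z w t : C) (p q : R).

Lemma bernoulli_powN (x : R) (m : nat) : 0 <= x <= 1 -> (1 - x) ^+ m * (1 + m%:R * x) <= 1.
Proof.
move=> /andP[x0 x1]; elim: m => [|m ih]; first by rewrite expr0 mul0r addr0 mulr1.
have h : 0 <= (1 - x) ^+ m by rewrite exprn_ge0// subr_ge0.
apply: le_trans ih; rewrite exprSr -mulrA ler_wpM2l// -natr1.
have m0 : 0 <= m%:R :> R by [].
have mx : 0 <= m%:R * x by rewrite mulr_ge0.
nra.
Qed.

Lemma bernoulli_pow (x : R) (m : nat) : 0 <= x <= 1 -> 1 - m%:R * x <= (1 - x) ^+ m.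
Proof.
move=> /andP[x0 x1]; elim: m => [|m ih]; first by rewrite expr0 mul0r subr0.
have h : 0 <= (1 - x) ^+ m by rewrite exprn_ge0// subr_ge0.
have h1 : (1 - x) ^+ m <= 1 by rewrite exprn_ile1// ?subr_ge0// lerBlDr lerDl.
rewrite exprSr -natr1.
have mx : 0 <= m%:R * x by rewrite mulr_ge0.
have : (1 - x) ^+ m * (1 - x) = (1 - x) ^+ m - (1 - x) ^+ m * x by ring.
move=> ->; nra.
Qed.

(** The polynomials of the Brosowski-Deutsch proof of the Stone-Weierstrass theorem: on [0, 1] they
    tend to a step function that jumps at [1 / k]. *)
Definition steep (k x : R) (n : nat) : R := 1 - (1 - x ^+ n) ^+ Num.truncn (k ^+ n).

Lemma steep_itv (k x : R) n : 0 <= x <= 1 -> 0 <= steep k x n <= 1.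
Proof.
move=> /andP[x0 x1]; rewrite /steep subr_ge0 lerBlDr lerDl.
have h0 : 0 <= x ^+ n by rewrite exprn_ge0.
have h1 : x ^+ n <= 1 by rewrite exprn_ile1.
by rewrite exprn_ile1 ?exprn_ge0//; lra.
Qed.

(** Bernoulli's inequality gives [1 - (1 - y) ^+ m <= m * y]; for [y = x ^+ n] and [m] at most
    [k ^+ n] the right side is at most [(k * x) ^+ n]. *)
Lemma steep_cvg0 (k x : R) : 0 < k -> 0 <= x <= 1 -> k * x < 1 ->
  steep k x n @[n --> \oo] --> (0 : R).
Proof.
move=> k0 x01 kx; have /andP[x0 x1] := x01.
apply: (@squeeze_cvgr _ _ _ _ (fun=> 0) (fun n => (k * x) ^+ n)).
- apply: nearW => n; have /andP[-> _] := steep_itv k n x01 => /=.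
  have h0 : 0 <= x ^+ n by rewrite exprn_ge0.
  have h1 : x ^+ n <= 1 by rewrite exprn_ile1.
  have := @bernoulli_pow (x ^+ n) (Num.truncn (k ^+ n)).
  rewrite h0 h1 => /(_ erefl); rewrite /steep exprMn.
  have : (Num.truncn (k ^+ n))%:R <= k ^+ n 
    by have /truncn_itv/andP[] : 0 <= k ^+ n by rewrite exprn_ge0// ltW.
  nra.
- exact: cvg_cst.
- by apply: cvg_expr; rewrite ger0_norm// mulr_ge0// ltW.
Qed.

(** Here the bound of [(1 - y) ^+ m] by the inverse of [1 + m * y] is used. Since [m + 1] is at
    least [k ^+ n] and [y <= 1], the sum [1 + m * y] is at least [(k * x) ^+ n], so the rounding in
    [truncn] costs nothing. *)
Lemma steep_cvg1 (k x : R) : 0 < k -> 0 <= x <= 1 -> 1 < k * x ->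
  steep k x n @[n --> \oo] --> (1 : R).
Proof.
move=> k0 x01 kx; have /andP[x0 x1] := x01.
apply: (@squeeze_cvgr _ _ _ _ (fun n => 1 - ((k * x)^-1) ^+ n) (fun=> 1)).
- apply: nearW => n; have /andP[_ ->] := steep_itv k n x01; rewrite andbT.
  have h0 : 0 <= x ^+ n by rewrite exprn_ge0.
  have h1 : x ^+ n <= 1 by rewrite exprn_ile1.
  have := @bernoulli_powN (x ^+ n) (Num.truncn (k ^+ n)).
  rewrite h0 h1 => /(_ erefl); rewrite /steep lerD2l lerN2 exprVn.
  have kn0 : 0 < (k * x) ^+ n by rewrite exprn_gt0//; lra.
  rewrite -[(k * x) ^- n]mulr1 ler_pdivlMl//.
  have t : k ^+ n <= (Num.truncn (k ^+ n))%:R + 1.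
    have /truncn_itv/andP[_ /ltW] : 0 <= k ^+ n by rewrite exprn_ge0// ltW.
    by rewrite natr1.
  have c0 : 0 <= (1 - x ^+ n) ^+ Num.truncn (k ^+ n) by rewrite exprn_ge0// subr_ge0.
  move=> hh; apply: le_trans hh; rewrite mulrC ler_wpM2l// exprMn.
  nra.
- rewrite -[X in _ --> X]subr0; apply: cvgB; first exact: cvg_cst.
  apply: cvg_expr; rewrite ger0_norm ?invr_ge0; last lra.
  by rewrite invf_lt1//; lra.
- exact: cvg_cst.
Qed.

(* [steep] composed with [q = (1 + cos (x - c)) / 2] is a trigonometric polynomial
   converging boundedly to the indicator of an arc centred at [c]. *)
Lemma arc_kernel (a b : R) : 0 <= a -> a < b -> b <= 2 * pi -> b - a < 2 * pi ->
  exists g : nat -> C -> R,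
  [/\ forall n, trig (fun t => (g n t)%:C%C),
      forall n t, cmod t = 1 -> 0 <= g n t <= 1,
      forall x, a < x < b -> g n (eit x) @[n --> \oo] --> (1 : R) &
      forall x, 0 < x < 2 * pi -> (x < a \/ b < x) ->
        g n (eit x) @[n --> \oo] --> (0 : R)].
Proof.
move=> a0 ab bp abp; pose c := (a + b) / 2; pose d := (b - a) / 2.
have p0 := pi_gt0 R.
have d0 : 0 < d by rewrite /d; lra.
have dp : d < pi by rewrite /d; lra.
pose qf (t : C) : R := (1 + Re (t * conjc (eit c))) / 2.
have qE x : qf (eit x) = (1 + cos (x - c)) / 2.
  by rewrite /qf cReM /= cosB; congr (_ / 2); ring.
have q01 t : cmod t = 1 -> 0 <= qf t <= 1.
  move=> /circleP[x -> _]; rewrite qE.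
  by have := cos_geN1 (x - c); have := cos_le1 (x - c) => *; apply/andP; split; lra.
(* At the two ends of the arc [qf] takes the value [1 / k], so [k * qf] exceeds 1 exactly inside
   it. *)
pose k := ((1 + cos d) / 2)^-1.
have cd1 : -1 < cos d.
  by rewrite -cospi ltr_cos// in_itv/= ?lexx ?(ltW p0) ?(ltW d0) ?(ltW dp).
have cd2 : 0 < (1 + cos d) / 2 by lra.
have k0 : 0 < k by rewrite invr_gt0.
have kE y : (k * ((1 + y) / 2) < 1) = (y < cos d).
  by rewrite /k mulrC ltr_pdivrMr// mul1r ltr_pM2r ?invr_gt0// ltrD2l.
have kE' y : (1 < k * ((1 + y) / 2)) = (cos d < y).
  by rewrite /k mulrC ltr_pdivlMr// mul1r ltr_pM2r ?invr_gt0// ltrD2l.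
exists (fun n t => steep k (qf t) n); split.
- move=> n.
  have tq : trig (fun t => (qf t)%:C%C).
    apply: (@trig_eq _ (fun t => (1 + (t * conjc (eit c) +
      conjc (t * conjc (eit c))) / 2%:R) * (2^-1)%:C%C)).
      by move=> t _; rewrite -ReJ_add -(rmorph1 (real_complex R)) -rmorphD -rmorphM.
    apply: trigM; last exact: trig_cst.
    apply: trigD; first exact: trig_cst.
    apply: trigM; last exact: trig_cst.
    have tt : trig (fun t => t * conjc (eit c)).
      by apply: trigM; [exact: trig_id|exact: trig_cst].
    by apply: trigD => //; exact: trigJ.
  apply: (@trig_eq _ (fun t => 1 - (1 - (qf t)%:C%C ^+ n) ^+ Num.truncn (k ^+ n))).
    by move=> t _; rewrite /steep !(rmorphB, rmorphXn, rmorph1).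
  apply: trigB; first exact: trig_cst.
  by apply: trigX; apply: trigB; [exact: trig_cst|exact: trigX].
- by move=> n t t1; apply: steep_itv; exact: q01.
- move=> x /andP[ax xb]; apply: steep_cvg1 => //; first by apply: q01; rewrite cmod_eit.
  have xc : `|x - c| < d by rewrite ltr_norml /c /d; apply/andP; split; lra.
  rewrite qE kE' -(cos_norm (x - c)) ltr_cos// in_itv/= ?normr_ge0.
    by rewrite (ltW (lt_trans xc dp)).
  by rewrite (ltW d0) (ltW dp).
- move=> x /andP[x0 xp] xab; apply: steep_cvg0 => //; first by apply: q01; rewrite cmod_eit.
  rewrite qE kE -cos_norm; set y := `|x - c|.
  have [y1 y2] : d < y /\ y < 2 * pi - d.
    rewrite /y; case: xab => h; [rewrite ltr0_norm|rewrite gtr0_norm];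
      by rewrite /c /d; (split || idtac); lra.
  have [yp|yp] := leP y pi.
    by rewrite ltr_cos// in_itv/=; apply/andP; split; lra.
  have -> : cos y = cos (2 * pi - y).
    by rewrite addrC mulr_natl cosD2pi cosN.
  by rewrite ltr_cos; [lra|rewrite in_itv/=; apply/andP; split; lra..].
Qed.

Lemma ae_neq (s : seq R) : {ae mu, forall x, x \notin s}.
Proof.
elim: s => [|a s ih]; first exact: aeW.
have ha : {ae mu, forall x, x != a}.
  exists [set a]; split => //; first exact: lebesgue_measure_set1.
  by move=> x /= /negP; rewrite negbK => /eqP.
by apply: (@filterS2 _ _ (ae_filter_ringOfSetsType mu)) ha ih => x h1 h2; rewrite inE negb_or h1.
Qed.

Lemma circ_dct (f_ : nat -> R -> R) (f g : R -> R) :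
  (forall n, measurable_fun (@circ R) (f_ n)) -> measurable_fun (@circ R) f ->
  {ae mu, forall x, circ x -> f_ n x @[n --> \oo] --> f x} ->
  mu.-integrable (@circ R) (EFin \o g) ->
  {ae mu, forall x n, circ x -> `|f_ n x| <= g x} ->
  Rintegral mu (@circ R) (f_ n) @[n --> \oo] --> Rintegral mu (@circ R) f.
Proof.
move=> mf_ mf ff gi fg.
have H3 : {ae mu, forall x, circ x -> (f_ n x)%:E @[n --> \oo] --> (f x)%:E}.
  apply: (@filterS _ _ (ae_filter_ringOfSetsType mu)) ff => x h cx.
  by apply: cvg_EFin; [exact: nearW|exact: h].
have H5 : {ae mu, forall x n, circ x -> (`|(f_ n x)%:E| <= (g x)%:E)%E}.
  by apply: (@filterS _ _ (ae_filter_ringOfSetsType mu)) fg => x h n cx; rewrite lee_fin h.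
have H1 n : measurable_fun (@circ R) (fun x => (f_ n x)%:E) by exact/measurable_EFinP.
have H2 : measurable_fun (@circ R) (fun x => (f x)%:E) by exact/measurable_EFinP.
have [fi _ h] := @dominated_convergence _ _ R mu (@circ R) measurable_circ
  (fun n x => (f_ n x)%:E) (EFin \o f) (EFin \o g) H1 H2 H3 gi H5.
have e : (\int[mu]_(x in @circ R) (EFin \o f) x)%E = (Rintegral mu (@circ R) f)%:E.
  rewrite /Rintegral fineK//.
  exact: (@integrable_fin_num _ _ R mu (@circ R) measurable_circ (EFin \o f) fi).
by rewrite e in h; exact: fine_cvg h.
Qed.

(** Dominated convergence for the kernels of [arc_kernel], with [|u|] as bound; their limit is left
    open only at [0], [2 * pi], [a] and [b], a null set. *)
Lemma arc_integral0 (u : R -> R) (a b : R) :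
  mu.-integrable (@circ R) (EFin \o u) ->
  (forall g : C -> R, trig (fun t => (g t)%:C%C) ->
    Rintegral mu (@circ R) (fun x => u x * g (eit x)) = 0) ->
  0 <= a -> a < b -> b <= 2 * pi -> b - a < 2 * pi ->
  Rintegral mu (@circ R) (fun x => u x * \1_(`]a, b[) x) = 0.
Proof.
move=> ui u0 a0 ab bp abp; have [g [gt g01 g1 g0]] := arc_kernel a0 ab bp abp.
have mu_ : measurable_fun (@circ R) u.
  by apply/measurable_EFinP; exact: measurable_int ui.
have mg n : measurable_fun (@circ R) (fun x => g n (eit x)).
  by have [] := trig_meas (gt n).
suff h : Rintegral mu (@circ R) (fun x => u x * g n (eit x)) @[n --> \oo] -->
    Rintegral mu (@circ R) (fun x => u x * \1_(`]a, b[) x).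
  have e : (fun n => Rintegral mu (@circ R) (fun x => u x * g n (eit x))) = fun=> 0.
    by apply/funext => n; rewrite (u0 _ (gt n)).
  by rewrite e in h; rewrite -(cvg_lim _ h)// lim_cst.
apply: (@circ_dct _ _ (fun x => `|u x|)).
- by move=> n; apply: measurable_funM.
- by apply: measurable_funM.
- apply: (@filterS _ _ (ae_filter_ringOfSetsType mu)) (ae_neq [:: 0; 2 * pi; a; b]) => x.
  rewrite !inE !negb_or /circ /= in_itv/= => /and4P[x0 xp xa xb] /andP[x0' xp'].
  apply: cvgM; first exact: cvg_cst.
  rewrite indicE; have [h|h] := boolP (a < x < b).
    by rewrite mem_set//; exact: g1.
  rewrite memNset; last by rewrite /= in_itv/=; exact/negP.
  apply: g0; first by rewrite !lt_neqAle eq_sym x0 x0' xp xp'.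
  move: h; rewrite negb_and -!leNgt => /orP[h|h]; [left|right];
    by rewrite lt_neqAle h ?xa // eq_sym xb.
- exact: (integrable_norm ui).
- apply: aeW => x n cx; rewrite normrM ler_piMr//.
  by have /andP[h1 h2] := g01 n (eit x) (cmod_eit x); rewrite ger0_norm.
Qed.

(** Testing on arcs that start at 0 shows that the primitive of [u] vanishes on the open interval,
    and by Lebesgue's differentiation theorem [u] is almost everywhere the derivative of its
    primitive. *)
Lemma real_fourier_uniqueness (u : R -> R) :
  mu.-integrable (@circ R) (EFin \o u) ->
  (forall g : C -> R, trig (fun t => (g t)%:C%C) ->
    Rintegral mu (@circ R) (fun x => u x * g (eit x)) = 0) ->
  {ae mu, forall x, circ x -> u x = 0}.
Proof.
move=> ui u0; pose v := u \_ (@circ R).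
have vi : mu.-integrable setT (EFin \o v).
  have := (@integrable_mkcond _ _ R mu (@circ R) (EFin \o u) measurable_circ).1 ui.
  by rewrite restrict_EFin.
have F0 y : 0 < y < 2 * pi ->
    Rintegral mu [set` Interval (BLeft 0) (BRight y)] v = 0.
  move=> /andP[y0 yp]; rewrite -[RHS](@arc_integral0 u 0 y)//; last 2 first.
    exact: ltW.
    by rewrite subr0.
  have vE : {in `]0, y[%classic, v =1 u}.
    move=> x; rewrite inE /= in_itv/= => /andP[x0 xy].
    by rewrite /v patchE mem_set// /circ /= in_itv/=; apply/andP; split; lra.
  have vS (A : set R) : measurable A -> mu.-integrable A (EFin \o v).
    by move=> mA; apply: integrableS vi.
  rewrite -Rintegral_itv_obnd_cbnd; last by apply: vS; exact: measurable_itv.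
  rewrite -Rintegral_itv_bndo_bndc; last by apply: vS; exact: measurable_itv.
  rewrite (@eq_Rintegral _ _ R mu _ u v vE).
  transitivity (Rintegral mu (@circ R `&` `]0, y[) u).
    congr (Rintegral mu _ u); rewrite setIidr// => x /=.
    by rewrite /circ /= !in_itv/= => /andP[? ?]; apply/andP; split; lra.
  rewrite Rintegral_mkcondr; apply: eq_Rintegral => x _.
  rewrite patchE indicE; case: ifP => _; first by rewrite mulr1.
  by rewrite mulr0.
have FTC := @FTC1 R v (BLeft 0).
have H : {ae mu, forall x, 0 < x < 2 * pi -> v x = 0}.
  apply: (@filterS _ _ (ae_filter_ringOfSetsType mu)) (FTC _ _).
  - move=> x Hx /andP[x0 xp]; have [|_ <-] := Hx.
      exact: x0.
    rewrite derive1E (@near_eq_derive _ _ _ _ (fun=> 0)) ?derive_cst//.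
    near=> y; apply: F0; apply/andP; split; near: y.
      exact: lt_nbhsr.
    exact: lt_nbhsl.
  - by move=> y; apply: integrableS vi => //; exact: measurable_itv.
  - by apply: open_integrable_locally => //; exact: openT.
apply: (@filterS2 _ _ (ae_filter_ringOfSetsType mu)) H (ae_neq [:: 0; 2 * pi]) => x h.
rewrite !inE negb_or => /andP[x0 xp] cx; rewrite -h; first by rewrite /v patchE mem_set.
move: cx; rewrite /circ /= in_itv/= => /andP[x0' xp'].
by rewrite !lt_neqAle eq_sym x0 x0' xp xp'.
Unshelve. all: by end_near. Qed.

Lemma fourier_uniqueness f : inLp 1 f -> (forall n : int, fourier f n = 0) ->
  aeT_eq f (fun=> 0).
Proof.
move=> fi f0.
(* Testing with real-valued [g] separates the real and the imaginary part of [f]. *)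
have hz (g : C -> R) : trig (fun t => (g t)%:C%C) ->
    Rintegral mu (@circ R) (fun x => Re (f (eit x)) * g (eit x)) = 0 /\
    Rintegral mu (@circ R) (fun x => Im (f (eit x)) * g (eit x)) = 0.
  move=> tg; have := cmean_mul_trig0 fi tg f0.
  have p0 : (2 * pi)^-1 != 0 :> R by rewrite invr_eq0 gt_eqF// mulr_gt0// pi_gt0.
  rewrite /cmean => -[] /eqP; rewrite mulf_eq0 (negPf p0) /= => /eqP hr.
  move=> /eqP; rewrite mulf_eq0 (negPf p0) /= => /eqP hi.
  split; [rewrite -[RHS]hr|rewrite -[RHS]hi]; apply: eq_Rintegral => x _.
    by rewrite cReM /= mulr0 subr0.
  by rewrite cImM /= mulr0 add0r.
have ur := real_fourier_uniqueness (Lp1_Re fi) (fun (g : C -> R) tg => (hz g tg).1).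
have ui := real_fourier_uniqueness (Lp1_Im fi) (fun (g : C -> R) tg => (hz g tg).2).
apply: (@filterS2 _ _ (ae_filter_ringOfSetsType mu)) ur ui => x hr hi cx.
by apply: complex_ext => /=; [exact: hr|exact: hi].
Qed.

End FourierUniqueness.

(** * Completeness of L^p *)

Section Completeness.
Variable R : realType.
Local Notation C := (R[i]).
Local Notation mu := (@lebesgue_measure R).
Local Notation Re := (@complex.Re R).
Local Notation Im := (@complex.Im R).
Implicit Types (f g h : C -> C) (z w t : C) (p q : R).

Lemma cvg_powR p (u : nat -> R) (l : R) : 0 < p -> (forall n, 0 <= u n) ->
  u n @[n --> \oo] --> l -> u n `^ p @[n --> \oo] --> l `^ p.
Proof.
move=> p0 u0 ul.
have l0 : 0 <= l by rewrite -(cvg_lim _ ul)//; apply: limr_ge; [apply/cvg_ex; exists l|exact: nearW].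
move: l0; rewrite le_eqVlt => /predU1P[l0|l0].
  rewrite -l0 powR0 ?gt_eqF//; apply/cvgrPdist_lt => e e0.
  have e1 : 0 < e `^ p^-1 by rewrite powR_gt0.
  move: ul => /cvgrPdist_lt/(_ _ e1); apply: filterS => n.
  rewrite -l0 !sub0r !normrN !ger0_norm ?powR_ge0// => h.
  have -> : e = (e `^ p^-1) `^ p by rewrite -powRrM mulVf ?gt_eqF// powRr1// ltW.
  by apply: gt0_ltr_powR => //; rewrite nnegrE ?powR_ge0.
apply: (cvg_comp u (fun x => x `^ p) ul).
suff : {for l, continuous (fun x : R => x `^ p)} by [].
apply: differentiable_continuous; apply/derivable1_diffP.
by apply: derivable_powR; rewrite in_itv/= l0.
Qed.

Lemma cvg_cmod (u : nat -> C) (l : C) : cmod (u n - l) @[n --> \oo] --> (0 : R) ->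
  cmod (u n) @[n --> \oo] --> cmod l.
Proof.
move=> ul; apply/cvgrPdist_lt => e e0.
move: ul => /cvgrPdist_lt/(_ _ e0); apply: filterS => n.
rewrite sub0r normrN ger0_norm ?cmod_ge0//; apply: le_lt_trans.
rewrite ler_norml; apply/andP; split.
  by rewrite lerNl opprB lerBlDr -{1}(subrK l (u n)); exact: cmodD.
rewrite lerBlDr -{1}(subrK (u n) l) -[cmod (u n - l)]cmodN opprB.
exact: cmodD.
Qed.

Lemma cvg_complex (u : nat -> C) (l : C) :
  Re (u n) @[n --> \oo] --> Re l -> Im (u n) @[n --> \oo] --> Im l ->
  cmod (u n - l) @[n --> \oo] --> (0 : R).
Proof.
move=> hr hi.
apply: (@squeeze_cvgr _ _ _ _ (fun=> 0) (fun n => `|Re (u n) - Re l| + `|Im (u n) - Im l|)).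
- apply: nearW => n; rewrite cmod_ge0 /= (le_trans (ler_cmod_ReIm _))//.
  by rewrite cReD cImD cReN cImN.
- exact: cvg_cst.
- have -> : (0 : R) = `|Re l - Re l| + `|Im l - Im l| by rewrite !subrr normr0 addr0.
  by apply: cvgD; apply: cvg_norm; apply: cvgB => //; exact: cvg_cst.
Qed.

Lemma pint_fatou p (g : nat -> C -> C) f (e : \bar R) : 0 < p ->
  (forall k, meas_on_T (g k)) -> meas_on_T f ->
  aeT (fun t => cmod (g k t - f t) @[k --> \oo] --> (0 : R)) ->
  (forall k, pint p (g k) <= e)%E -> (pint p f <= e)%E.
Proof.
move=> p0 mg mf gf ge.
have mgE k := meas_cmodX p (mg k).
have pos k x : circ x -> (0 <= (cmod (g k (eit x)) `^ p)%:E :> \bar R)%E.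
  by move=> _; rewrite lee_fin powR_ge0.
have le1 : (pint p f <= \int[mu]_(x in @circ R)
    limn_einf (fun k => (cmod (g k (eit x)) `^ p)%:E))%E.
  apply: ae_ge0_le_integral => //.
  - by move=> x _; rewrite lee_fin powR_ge0.
  - exact: meas_cmodX.
  - move=> x cx; rewrite limn_einf_lim; apply: lime_ge; first exact: is_cvg_einfs.
    apply: nearW => n; apply: le_ereal_inf_tmp => _ [k _ <-].
    by rewrite lee_fin powR_ge0.
  - rewrite /limn_einf; apply: measurableT_comp => //.
    apply: measurable_fun_limn_esup => n.
    suff : measurable_fun (@circ R) (fun x => (- (cmod (g n (eit x)) `^ p))%:E) by [].
    by apply/measurable_EFinP; apply: measurable_funN; apply/measurable_EFinP; exact: mgE.
  - apply: (@filterS _ _ (ae_filter_ringOfSetsType mu)) gf => x h cx.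
    have hc := cvg_powR p0 (fun n => cmod_ge0 _) (cvg_cmod (h cx)).
    have hh : (cmod (g k (eit x)) `^ p)%:E @[k --> \oo] --> (cmod (f (eit x)) `^ p)%:E.
      by apply: cvg_EFin; [exact: nearW|exact: hc].
    by have [-> _] := cvg_limn_einf_sup hh.
apply: (le_trans le1); apply: le_trans (fatou mu measurable_circ mgE pos) _.
rewrite limn_einf_lim; apply: lime_le; first exact: is_cvg_einfs.
apply: nearW => n; apply: le_trans (ge n); apply: ereal_inf_lbound.
by exists n => /=.
Qed.

(** Upper limits of the two components: defined for every sequence, measurable in a parameter, and
    equal to the limit wherever one exists. *)
Definition limc (u : nat -> C) : C :=
  Complex (fine (limn_esup (fun k => (Re (u k))%:E)))
          (fine (limn_esup (fun k => (Im (u k))%:E))).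

Lemma limcP (u : nat -> C) (a b : R) :
  Re (u n) @[n --> \oo] --> a -> Im (u n) @[n --> \oo] --> b ->
  cmod (u n - limc u) @[n --> \oo] --> (0 : R).
Proof.
move=> ha hb.
have ha' : (Re (u k))%:E @[k --> \oo] --> a%:E by apply: cvg_EFin => //; exact: nearW.
have hb' : (Im (u k))%:E @[k --> \oo] --> b%:E by apply: cvg_EFin => //; exact: nearW.
apply: cvg_complex; rewrite /limc /=.
  by have [_ ->] := cvg_limn_einf_sup ha'.
by have [_ ->] := cvg_limn_einf_sup hb'.
Qed.

Lemma meas_limc (g : nat -> C -> C) : (forall k, meas_on_T (g k)) ->
  meas_on_T (fun t => limc (fun k => g k t)).
Proof.
move=> mg; split => /=.
  apply: (measurableT_comp (@fine_measurable R setT measurableT)).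
  apply: measurable_fun_limn_esup => n; apply/measurable_EFinP.
  by have [] := mg n.
apply: (measurableT_comp (@fine_measurable R setT measurableT)).
apply: measurable_fun_limn_esup => n; apply/measurable_EFinP.
by have [] := mg n.
Qed.

Lemma cvg_geometric_steps (u : nat -> R) (B : R) :
  (forall k, `|u k.+1 - u k| <= B * 2^-1 ^+ k) -> cvgn u.
Proof.
move=> h.
have s : cvgn (series (telescope u)).
  apply: normed_cvg; apply: (@series_le_cvg _ _ (geometric B 2^-1)).
  - by move=> n; exact: normr_ge0.
  - by move=> n; rewrite (le_trans (normr_ge0 _) (h n)).
  - exact: h.
  - by apply: is_cvg_geometric_series; rewrite ger0_norm// invf_lt1// ltr1n.
have -> : u = (fun n => u 0%N + series (telescope u) n).
  by apply/funext => n; rewrite -eq_sum_telescope.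
by apply: is_cvgD => //; exact: is_cvg_cst.
Qed.

(** The series of the p-th powers of [2 ^+ k * cmod (d k t)] has integral at most 2, hence a finite
    sum almost everywhere. *)
Lemma ae_geometric_bound p (d : nat -> C -> C) : 0 < p -> (forall k, meas_on_T (d k)) ->
  (forall k, pint p (d k) <= ((2^-1 ^+ k) `^ p * 2^-1 ^+ k)%:E)%E ->
  aeT (fun t => exists B : R, forall k, cmod (d k t) <= B * 2^-1 ^+ k).
Proof.
move=> p0 md dp.
pose h k x : \bar R := ((2 ^+ k) `^ p * cmod (d k (eit x)) `^ p)%:E.
have r0 k : 0 < 2 ^+ k :> R by rewrite exprn_gt0.
have mh k : measurable_fun (@circ R) (h k).
  apply/measurable_EFinP; apply: measurable_funM => //.
  by apply/measurable_EFinP; exact: meas_cmodX.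
have h0 k x : (0 <= h k x)%E by rewrite lee_fin mulr_ge0 ?powR_ge0.
have ih k : (\int[mu]_(x in @circ R) h k x <= (2^-1 ^+ k)%:E)%E.
  rewrite /h; under eq_integral do rewrite EFinM.
  rewrite ge0_integralZl_EFin ?powR_ge0//; last 2 first.
  - by move=> x _; rewrite lee_fin powR_ge0.
  - exact: meas_cmodX.
  apply: (@le_trans _ _ (((2 ^+ k) `^ p)%:E * ((2^-1 ^+ k) `^ p * 2^-1 ^+ k)%:E)%E).
    by apply: lee_wpmul2l; [rewrite lee_fin powR_ge0|exact: dp].
  have e1 : 2 ^+ k * 2^-1 ^+ k = 1 :> R by rewrite -exprMn divff// expr1n.
  by rewrite -EFinM lee_fin mulrA -powRM ?exprn_ge0 ?invr_ge0// e1 powR1 mul1r.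
pose S x := (\sum_(k <oo) h k x)%E.
have mS : measurable_fun (@circ R) S.
  by apply: ge0_emeasurable_sum => // k x _ _; exact: h0.
have S0 x : (0 <= S x)%E by apply: nneseries_ge0 => n _ _; exact: h0.
have iS : (\int[mu]_(x in @circ R) S x <= 2%:E)%E.
  rewrite /S integral_nneseries//.
  apply: lime_le; first by apply: is_cvg_nneseries => n _ _; exact: integral_ge0.
  apply: nearW => n.
  apply: (@le_trans _ _ (\sum_(0 <= k < n) (2^-1 ^+ k)%:E)%E); first exact: lee_sum.
  rewrite sumEFin lee_fin.
  suff -> : \sum_(0 <= k < n) 2^-1 ^+ k = 2 - 2 * 2^-1 ^+ n :> R.
    by rewrite lerBlDr lerDl mulr_ge0// exprn_ge0// invr_ge0.
  elim: n => [|n ih']; first by rewrite big_nil expr0 mulr1 subrr.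
  by rewrite big_nat_recr//= ih' exprS; field.
have Si : mu.-integrable (@circ R) S.
  apply/integrableP; split => //.
  under eq_integral do rewrite gee0_abs//.
  by apply: le_lt_trans iS _; rewrite ltry.
have := @integrable_ae _ _ R mu (@circ R) measurable_circ _ Si.
apply: (@filterS _ _ (ae_filter_ringOfSetsType mu)) => x hx cx.
(* Every term of the series is at most its sum, so the p-th root of [S x] serves for all [k] at
   once. *)
exists (fine (S x) `^ p^-1) => k.
have : (h k x <= (fine (S x))%:E)%E.
  rewrite fineK; last exact: hx.
  rewrite /S (@nneseriesD1 _ _ k)//.
  by rewrite leeDl// nneseries_ge0// => n _ _; exact: h0.
rewrite /h lee_fin => hk.
have c0 : 0 <= cmod (d k (eit x)) by exact: cmod_ge0.
rewrite -powRM ?exprn_ge0// in hk.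
have pp : 0 <= p^-1 by rewrite invr_ge0 ltW.
have := ge0_ler_powR pp _ _ hk; rewrite !nnegrE powR_ge0 fine_ge0//.
rewrite -powRrM mulfV ?gt_eqF// powRr1; last by rewrite mulr_ge0// ltW.
move=> /(_ isT isT) hh.
by rewrite exprVn ler_pdivlMr// mulrC.
Qed.

(** Riesz-Fischer: a fast subsequence converges almost everywhere, and Fatou's lemma turns the
    Cauchy condition into convergence of the whole sequence. *)
Lemma Lp_complete p (f_ : nat -> C -> C) : 1 <= p -> (forall k, inLp p (f_ k)) ->
  (forall e : R, 0 < e -> exists K, forall j k, (K <= j)%N -> (K <= k)%N ->
    (pint p (fun t => (f_ j t - f_ k t)%R) <= e%:E)%E) ->
  exists f, inLp p f /\ forall e : R, 0 < e -> exists K, forall k, (K <= k)%N ->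
    (pint p (fun t => (f t - f_ k t)%R) <= e%:E)%E.
Proof.
move=> p1 fp cf; have p0 : 0 < p by lra.
(* The first factor is the p-th power of the geometric size wanted pointwise; the second makes the
   integrals in [ae_geometric_bound] summable. *)
pose ee k : R := (2^-1 ^+ k) `^ p * 2^-1 ^+ k.
have ee0 k : 0 < ee k by rewrite mulr_gt0 ?powR_gt0 ?exprn_gt0 ?invr_gt0.
have /choice[n hn] k := cf _ (ee0 k).
(* Partial sums of [n i + 1] are nondecreasing, at least [n k] and at least [k]; the last property
   is what the comparison of [g (j + K)] with [f_ k] requires. *)
pose m k := (\sum_(i < k.+1) (n i + 1))%N.
have mn k : (n k <= m k)%N by rewrite /m big_ord_recr/= (leq_trans (leq_addr 1 _)) ?leq_addl.
have mm k : (m k <= m k.+1)%N by rewrite [m k.+1]/m big_ord_recr/= leq_addr.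
have mnj k j : (k <= j)%N -> (n k <= m j)%N.
  move=> kj; apply: leq_trans (mn k) _.
  by elim: j kj => [|j ih]; rewrite leq_eqVlt => /predU1P[->//|]//; rewrite ltnS => /ih/leq_trans; apply.
pose g k := f_ (m k).
have mf k := Lp_meas (fp k).
have hb : aeT (fun t => exists B : R, forall k, cmod (g k.+1 t - g k t) <= B * 2^-1 ^+ k).
  apply: (@ae_geometric_bound p (fun k t => g k.+1 t - g k t)) => // k.
    by apply: measB; exact: mf.
  apply: hn; first exact: mnj.
  exact: mn.
pose f t := limc (fun k => g k t).
have mff : meas_on_T f by apply: meas_limc => k; exact: mf.
have gf : aeT (fun t => cmod (g k t - f t) @[k --> \oo] --> (0 : R)).
  apply: aeTS hb => t _ [B hB].
  have [a ha] : exists a : R, Re (g n t) @[n --> \oo] --> a.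
    apply/cvg_ex; apply: (@cvg_geometric_steps _ B) => k; apply: le_trans (hB k).
    by rewrite -cReN -cReD ler_Re_cmod.
  have [b hb'] : exists b : R, Im (g n t) @[n --> \oo] --> b.
    apply/cvg_ex; apply: (@cvg_geometric_steps _ B) => k; apply: le_trans (hB k).
    by rewrite -cImN -cImD ler_Im_cmod.
  exact: limcP ha hb'.
have key (e : R) : 0 < e -> exists K, forall k, (K <= k)%N ->
    (pint p (fun t => (f t - f_ k t)%R) <= e%:E)%E.
  move=> e0; have [K hK] := cf _ e0; exists K => k Kk.
  apply: (@pint_fatou p (fun j t => g (j + K)%N t - f_ k t)) => //.
  - by move=> j; apply: measB; exact: mf.
  - by apply: measB => //; exact: mf.
  - apply: aeTS gf => t _ h.
    have -> : (fun j => cmod (g (j + K)%N t - f_ k t - (f t - f_ k t))) =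
        [sequence cmod (g j t - f t)]_j \o (addn^~ K).
      by apply/funext => j /=; congr cmod; ring.
    by apply: cvg_comp h; exact: cvg_addnr.
  - move=> j; apply: hK => //; rewrite /g.
    apply: (@leq_trans (j + K)); first exact: leq_addl.
    rewrite /m; elim: (j + K)%N => // i ih.
    by rewrite big_ord_recr/= addnA addn1 ltnS (leq_trans ih)// leq_addr.
exists f; split => //.
have [K hK] := key _ ltr01.
apply: (@inLp_eq _ p (fun t => (f t - f_ K t) + f_ K t)); first exact: ltW.
  by move=> t _; rewrite subrK.
apply: LpD => //; first exact: ltW.
apply/LpP; split; first by apply: measB => //; exact: mf.
by apply: le_lt_trans (hK K (leqnn _)) _; rewrite ltry.
Qed.

End Completeness.

(** * Pointwise uniform convexity of the p-th power of the modulus *)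

Section UniformConvexity.
Variable R : realType.
Local Notation C := (R[i]).
Local Notation mu := (@lebesgue_measure R).
Local Notation Re := (@complex.Re R).
Local Notation Im := (@complex.Im R).
Implicit Types (f g h : C -> C) (z w t : C) (p q : R).

Lemma powR1x (x : R) : 1 `^ x = 1 :> R.
Proof. by rewrite powR1. Qed.

(** Young's inequality for [y] and the power [p - 1] of [x] is an equality at [y = x], so it is the
    tangent line inequality. Obtained without derivatives, it includes the point [x = 0]. *)
Lemma powR_tangent p (x y : R) : 1 < p -> 0 <= x -> 0 <= y ->
  x `^ p + p * x `^ (p - 1) * (y - x) <= y `^ p.
Proof.
move=> p1 x0 y0; have p0 : 0 < p by lra.
pose q := p / (p - 1).
have q0 : 0 < q by rewrite divr_gt0//; lra.
have pq : p^-1 + q^-1 = 1 by rewrite /q invf_div; field; rewrite gt_eqF.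
have := conjugate_powR y0 (powR_ge0 x (p - 1)) p0 q0 pq.
have -> : (x `^ (p - 1)) `^ q = x `^ p.
  by rewrite -powRrM /q; congr (_ `^ _); field; rewrite gt_eqF//; lra.
rewrite -(ler_pM2l p0) => h.
have e : p * x `^ (p - 1) * (y - x) = p * (y * x `^ (p - 1)) - p * x `^ p.
  by rewrite -(mulr_powRB1 x0 p0); ring.
have e2 : p * (y `^ p / p + x `^ p / q) = y `^ p + (p - 1) * x `^ p.
  by rewrite /q; field; rewrite !gt_eqF//; lra.
rewrite e2 in h; rewrite e; lra.
Qed.

(** Strict convexity made quantitative: at the point 1 the tangent based at [m] lies below the curve
    by an amount that is uniform as long as [m] keeps the distance [d] from 1. *)
Lemma powR_gap p (d : R) : 1 < p -> 0 < d <= 1 -> exists2 c : R, 0 < c &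
  forall m, 0 <= m <= 1 - d -> c <= 1 - m `^ p - p * m `^ (p - 1) * (1 - m).
Proof.
move=> p1 /andP[d0 d1]; have p0 : 0 < p by lra.
have r0 : 0 < p - 1 by lra.
pose c0 := (2^-1) `^ (p - 1) * (1 - (1 - d / 2) `^ (p - 1)).
have h1 : (1 - d / 2) `^ (p - 1) < 1.
  by rewrite -[ltRHS](powR1x (p - 1)); apply: gt0_ltr_powR => //; rewrite ?nnegrE; lra.
have c00 : 0 < c0 by rewrite mulr_gt0 ?powR_gt0 ?invr_gt0// subr_gt0.
exists (p * (d / 2) * c0) => [|m /andP[m0 md]]; first by rewrite mulr_gt0// mulr_gt0// divr_gt0.
(* The tangent at [m] is followed up to the midpoint [n], and the tangent at [n] from there to 1;
   the gain is the difference of the two slopes over half of the interval. *)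
pose n := (1 + m) / 2.
have n0 : 0 <= n by rewrite /n; lra.
have t1 := powR_tangent p1 n0 (ler01).
have t2 := powR_tangent p1 m0 n0.
rewrite powR1 in t1.
have mn : m `^ (p - 1) <= n `^ (p - 1) * (1 - d / 2) `^ (p - 1).
  rewrite -powRM//; last lra.
  apply: ge0_ler_powR; rewrite ?nnegrE//; first lra.
    by rewrite mulr_ge0//; lra.
  rewrite /n; nra.
have n2 : 2^-1 `^ (p - 1) <= n `^ (p - 1).
  by apply: ge0_ler_powR; rewrite ?nnegrE /n//; lra.
have key : c0 <= n `^ (p - 1) - m `^ (p - 1).
  apply: le_trans (_ : n `^ (p - 1) * (1 - (1 - d / 2) `^ (p - 1)) <= _).
    by rewrite ler_wpM2r// subr_ge0 ltW.
  by rewrite mulrBr mulr1 lerB.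
have e1 : 1 - n = (1 - m) / 2 by rewrite /n; field.
have e2 : n - m = (1 - m) / 2 by rewrite /n; field.
rewrite e1 in t1; rewrite e2 in t2.
have key2 : p * (d / 2) * c0 <= p * ((1 - m) / 2) * (n `^ (p - 1) - m `^ (p - 1)).
  apply: ler_pM => //; first by rewrite mulr_ge0//; lra.
    exact: ltW.
  by rewrite ler_pM2l//; lra.
apply: le_trans key2 _; lra.
Qed.

Lemma powR_mid p (x y : R) : 1 < p -> 0 <= x -> 0 <= y ->
  ((x + y) / 2) `^ p <= (x `^ p + y `^ p) / 2.
Proof.
move=> p1 x0 y0; have m0 : 0 <= (x + y) / 2 by lra.
have t1 := powR_tangent p1 m0 x0; have t2 := powR_tangent p1 m0 y0.
have e1 : x - (x + y) / 2 = (x - y) / 2 by field.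
have e2 : y - (x + y) / 2 = - ((x - y) / 2) by field.
rewrite e1 in t1; rewrite e2 mulrN in t2; lra.
Qed.

(** By homogeneity the larger number may be taken as 1. If the other one is near 1, the left side is
    at most [e]; otherwise [powR_gap] bounds the convexity defect from below, and a large [K]
    suffices. *)
Lemma uniform_convexity_real p (e : R) : 1 < p -> 0 < e -> exists2 K : R, 0 <= K &
  forall x y, 0 <= x -> 0 <= y -> `|x - y| `^ p <=
    e * (x `^ p + y `^ p) + K * ((x `^ p + y `^ p) / 2 - ((x + y) / 2) `^ p).
Proof.
move=> p1 e0; have p0 : 0 < p by lra.
pose d := Num.min 1 (e `^ p^-1) / 2.
have ep : 0 < e `^ p^-1 by rewrite powR_gt0.
have d0 : 0 < d by rewrite divr_gt0// lt_min ltr01.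
have d1 : d <= 1 by rewrite /d ler_pdivrMr// mul1r (@le_trans _ _ 1)// ?ge_min ?lexx// ler1n.
have [c c0 hc] := @powR_gap p d p1 (introT andP (conj d0 d1)).
exists (2 / c); first by rewrite divr_ge0// ltW.
move=> x y; wlog yx : x y / y <= x => [hw x0 y0|x0 y0].
  have [xy|/ltW xy] := leP y x; first exact: hw.
  by rewrite distrC (addrC (x `^ p)) (addrC x); exact: hw.
have D0 := powR_mid p1 x0 y0.
have K0 : 0 <= 2 / c by rewrite divr_ge0// ltW.
move: x0; rewrite le_eqVlt => /predU1P[x0|x0].
  have -> : y = x by apply/le_anti; rewrite yx -x0 y0.
  rewrite subrr normr0 powR0 ?gt_eqF// addr_ge0//.
    by rewrite mulr_ge0 ?(ltW e0)// addr_ge0// powR_ge0.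
  rewrite mulr_ge0// subr_ge0; apply: powR_mid => //; by rewrite -x0.
pose z := y / x.
have z0 : 0 <= z by rewrite divr_ge0// ltW.
have z1 : z <= 1 by rewrite ler_pdivrMr// mul1r.
have yE : y = x * z by rewrite /z mulrCA divff ?mulr1// gt_eqF.
have xp0 : 0 < x `^ p by rewrite powR_gt0.
suff H : (1 - z) `^ p <= e * (1 + z `^ p) + 2 / c * ((1 + z `^ p) / 2 - ((1 + z) / 2) `^ p).
  rewrite yE ger0_norm; last by rewrite subr_ge0 -yE.
  have -> : x - x * z = x * (1 - z) by ring.
  have -> : (x + x * z) / 2 = x * ((1 + z) / 2) by ring.
  have h1z : 0 <= 1 - z by lra.
  have h2z : 0 <= (1 + z) / 2 by lra.
  rewrite (@powRM _ x (1 - z) p (ltW x0) h1z) (@powRM _ x z p (ltW x0) z0).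
  rewrite (@powRM _ x ((1 + z) / 2) p (ltW x0) h2z).
  rewrite -(ler_pM2l xp0) in H; lra.
have z1' : 0 <= 1 - z by lra.
have Dz := powR_mid p1 (ler01) z0; rewrite powR1 in Dz.
have [zd|zd] := leP (1 - z) (2 * d).
  apply: (@le_trans _ _ e).
    have -> : e = (e `^ p^-1) `^ p by rewrite -powRrM mulVf ?gt_eqF// powRr1// ltW.
    apply: ge0_ler_powR; rewrite ?nnegrE ?powR_ge0//; first exact: ltW.
    by apply: (le_trans zd); rewrite /d mulrC divfK// ge_min lexx orbT.
  have zp := powR_ge0 z p.
  have h1 : 0 <= 2 / c * ((1 + z `^ p) / 2 - ((1 + z) / 2) `^ p).
    by rewrite mulr_ge0// subr_ge0.
  have : 0 <= e * z `^ p by rewrite mulr_ge0// ltW.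
  lra.
(* The gap at 1 and the tangent inequality at [z] are both based at the mean [m], so their linear
   terms cancel in the sum. *)
pose m := (1 + z) / 2.
have m01 : 0 <= m <= 1 - d by rewrite /m; apply/andP; split; lra.
have h := hc m m01; have m0 : 0 <= m by case/andP: m01.
have t2 := powR_tangent p1 m0 z0.
have e2 : z - m = - (1 - m) by rewrite /m; field.
rewrite e2 mulrN in t2.
have h2 : c / 2 <= (1 + z `^ p) / 2 - m `^ p by lra.
have h3 : 1 <= 2 / c * ((1 + z `^ p) / 2 - m `^ p).
  rewrite -(ler_pM2l (_ : 0 < 2 / c)) in h2; last by rewrite divr_gt0.
  by apply: le_trans h2; rewrite mulrA divfK ?gt_eqF// divff// .
have h4 : (1 - z) `^ p <= 1.
  rewrite -[leRHS](powR1x p); apply: ge0_ler_powR; rewrite ?nnegrE//; first exact: ltW.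
  lra.
have zp := powR_ge0 z p.
have : 0 <= e * (1 + z `^ p) by rewrite mulr_ge0 ?(ltW e0)//; lra.
rewrite -/m; lra.
Qed.

(** Meant for [r = |z + w| / 2] and [s = (|z| + |w|) / 2]: it controls the part of [z - w] that
    comes from different arguments, which the inequality for the moduli cannot see. *)
Lemma uniform_convexity_angle p (e : R) : 1 < p -> 0 < e -> exists2 K : R, 0 <= K &
  forall r s, 0 <= r <= s -> (s ^+ 2 - r ^+ 2) `^ (p / 2) <=
    e * s `^ p + K * (s `^ p - r `^ p).
Proof.
move=> p1 e0; have p0 : 0 < p by lra.
have p20 : 0 < p / 2 by lra.
pose d := Num.min 2^-1 (e `^ (p / 2)^-1).
have d0 : 0 < d by rewrite lt_min invr_gt0 ltr0n powR_gt0.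
have d1 : d <= 2^-1 by rewrite ge_min lexx.
pose c := 1 - (1 - d) `^ (p / 2).
have c0 : 0 < c.
  rewrite subr_gt0 -[ltRHS](powR1x (p / 2)); apply: gt0_ltr_powR; rewrite ?nnegrE//; lra.
exists c^-1; first by rewrite invr_ge0 ltW.
move=> r s /andP[r0 rs].
have rsp : r `^ p <= s `^ p by apply: ge0_ler_powR; rewrite ?nnegrE//; lra.
have s0 : 0 <= s by lra.
have sq x : 0 <= x -> (x ^+ 2) `^ (p / 2) = x `^ p.
  by move=> x0; rewrite -powR_mulrn// -powRrM; congr (_ `^ _); field.
have r2s2 : r ^+ 2 <= s ^+ 2 by rewrite ler_sqr.
have [h|h] := leP (s ^+ 2 - r ^+ 2) (d * s ^+ 2).
  apply: (@le_trans _ _ (e * s `^ p)); last first.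
    by rewrite lerDl mulr_ge0 ?invr_ge0 ?(ltW c0)// subr_ge0.
  apply: le_trans (ge0_ler_powR (ltW p20) _ _ h) _; rewrite ?nnegrE ?subr_ge0//.
    by rewrite mulr_ge0 ?sqr_ge0// ltW.
  rewrite powRM ?sqr_ge0 ?(ltW d0)// sq// ler_wpM2r ?powR_ge0//.
  have -> : e = (e `^ (p / 2)^-1) `^ (p / 2).
    by rewrite -powRrM mulVf ?gt_eqF// powRr1// ltW.
  by apply: ge0_ler_powR; rewrite ?nnegrE ?powR_ge0 ?(ltW d0) ?(ltW p20)// ge_min lexx orbT.
have h1 : r `^ p <= (1 - d) `^ (p / 2) * s `^ p.
  rewrite -(sq r)// -(sq s)// -powRM ?sqr_ge0//; last lra.
  apply: ge0_ler_powR; rewrite ?nnegrE ?sqr_ge0 ?(ltW p20)//; last lra.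
  by rewrite mulr_ge0 ?sqr_ge0//; lra.
have h2 : s `^ p <= c^-1 * (s `^ p - r `^ p).
  by rewrite mulrC ler_pdivlMr// /c; lra.
apply: (@le_trans _ _ (s `^ p)).
  rewrite -(sq s)//; apply: ge0_ler_powR; rewrite ?nnegrE ?sqr_ge0 ?(ltW p20) ?subr_ge0//.
  by rewrite lerBlDr lerDl sqr_ge0.
have : 0 <= e * s `^ p by rewrite mulr_ge0 ?powR_ge0// ltW.
lra.
Qed.

(** The identity |z - w|^2 = (|z| - |w|)^2 + 4 (s^2 - r^2) separates moduli from arguments. The
    result is linear in p-th powers, hence can be integrated as it stands. *)
Lemma uniform_convexity p (e : R) : 1 < p -> 0 < e -> exists2 K : R, 0 <= K &
  forall z w, cmod (z - w) `^ p <= e * (cmod z `^ p + cmod w `^ p) +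
    K * ((cmod z `^ p + cmod w `^ p) / 2 - cmod ((z + w) / 2%:R) `^ p).
Proof.
move=> p1 e0; have p0 : 0 < p by lra.
pose T := (2 : R) `^ p.
have T0 : 0 < T by rewrite powR_gt0.
(* Both partial inequalities are multiplied by [T], the one for the arguments by a further [T]. *)
pose e' := e / (T * (1 + T)).
have e'0 : 0 < e' by rewrite divr_gt0// mulr_gt0//; lra.
have [K1 K10 h1] := uniform_convexity_real p1 e'0.
have [K2 K20 h2] := uniform_convexity_angle p1 e'0.
exists (T * (K1 + T * K2)); first by rewrite mulr_ge0 ?(ltW T0)// addr_ge0// mulr_ge0// ltW.
move=> z w.
set x := cmod z; set y := cmod w; set r := cmod ((z + w) / 2%:R).
have x0 : 0 <= x := cmod_ge0 _; have y0 : 0 <= y := cmod_ge0 _.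
have r0 : 0 <= r := cmod_ge0 _.
pose s := (x + y) / 2.
have rE : r = cmod (z + w) / 2.
  by rewrite /r cmodM cmodV -[2%:R](rmorph_nat (real_complex R)) cmod_real ger0_norm.
have rs : r <= s by rewrite rE /s ler_pM2r ?invr_gt0//; exact: cmodD.
have par : cmod (z - w) ^+ 2 = (x - y) ^+ 2 + 4 * (s ^+ 2 - r ^+ 2).
  have hx : x ^+ 2 = Re z ^+ 2 + Im z ^+ 2 by rewrite cmod_sqr.
  have hy : y ^+ 2 = Re w ^+ 2 + Im w ^+ 2 by rewrite cmod_sqr.
  have hzw : cmod (z + w) ^+ 2 = (Re z + Re w) ^+ 2 + (Im z + Im w) ^+ 2.
    by rewrite cmod_sqr cReD cImD.
  rewrite cmod_sqr cReD cImD cReN cImN rE /s.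
  have -> : (x - y) ^+ 2 + 4 * (((x + y) / 2) ^+ 2 - (cmod (z + w) / 2) ^+ 2) =
    2 * (x ^+ 2 + y ^+ 2) - cmod (z + w) ^+ 2 by field.
  by rewrite hx hy hzw; ring.
have sr : 0 <= s ^+ 2 - r ^+ 2 by rewrite subr_ge0 ler_sqr ?nnegrE//; lra.
have le1 : cmod (z - w) <= `|x - y| + 2 * Num.sqrt (s ^+ 2 - r ^+ 2).
  rewrite -(ler_pXn2r (n := 2))// ?nnegrE ?cmod_ge0 ?addr_ge0 ?mulr_ge0 ?sqrtr_ge0//.
  have sE : (2 * Num.sqrt (s ^+ 2 - r ^+ 2)) ^+ 2 = 4 * (s ^+ 2 - r ^+ 2).
    by rewrite expr2 mulrACA -[X in _ * X]expr2 sqr_sqrtr//; ring.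
  rewrite par (sqrrD `|x - y|) real_normK ?num_real// sE.
  have : 0 <= `|x - y| * (2 * Num.sqrt (s ^+ 2 - r ^+ 2)).
    by rewrite mulr_ge0// mulr_ge0// sqrtr_ge0.
  rewrite mulr2n; lra.
have le2 : cmod (z - w) `^ p <= T * (`|x - y| `^ p + T * (s ^+ 2 - r ^+ 2) `^ (p / 2)).
  have <- : (2 * Num.sqrt (s ^+ 2 - r ^+ 2)) `^ p = T * (s ^+ 2 - r ^+ 2) `^ (p / 2).
    by rewrite powRM ?sqrtr_ge0// -powR12_sqrt// -powRrM; congr (_ * _ `^ _); field.
  apply: le_trans (powRD_le (ltW p0) (normr_ge0 _) _); last by rewrite mulr_ge0 ?sqrtr_ge0.
  by apply: ge0_ler_powR; rewrite ?nnegrE ?(ltW p0) ?cmod_ge0 ?addr_ge0 ?mulr_ge0 ?sqrtr_ge0.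
have g1 := h1 x y x0 y0.
have g2 := h2 r s (introT andP (conj r0 rs)).
have mid := powR_mid p1 x0 y0; rewrite -/s in g1 mid.
have rsp : r `^ p <= s `^ p by apply: ge0_ler_powR; rewrite ?nnegrE//; lra.
apply: (le_trans le2).
set X := x `^ p in g1 mid *; set Y := y `^ p in g1 mid *.
set S := s `^ p in g1 g2 mid rsp *; set Q := r `^ p in g2 rsp *.
have XY0 : 0 <= X + Y by rewrite addr_ge0// powR_ge0.
have eE : e = e' * (T * (1 + T)) by rewrite /e' divfK// gt_eqF// mulr_gt0//; lra.
apply: (@le_trans _ _ (T * ((e' * (X + Y) + K1 * ((X + Y) / 2 - S)) +
    T * (e' * S + K2 * (S - Q))))).
  by rewrite ler_pM2l// lerD// ler_pM2l.
have a1 : e' * S <= e' * (X + Y) by rewrite ler_pM2l//; lra.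
have a2 : K1 * ((X + Y) / 2 - S) <= K1 * ((X + Y) / 2 - Q) by rewrite ler_wpM2l//; lra.
have a3 : K2 * (S - Q) <= K2 * ((X + Y) / 2 - Q) by rewrite ler_wpM2l//; lra.
have a4 : T * (e' * S + K2 * (S - Q)) <= T * (e' * (X + Y) + K2 * ((X + Y) / 2 - Q)).
  by rewrite ler_pM2l// lerD.
have -> : e * (X + Y) + T * (K1 + T * K2) * ((X + Y) / 2 - Q) =
  T * ((e' * (X + Y) + K1 * ((X + Y) / 2 - Q)) +
    T * (e' * (X + Y) + K2 * ((X + Y) / 2 - Q))) by rewrite eE; ring.
by rewrite ler_pM2l// lerD// lerD2l.
Qed.

End UniformConvexity.

(** * Powers of norms, the pairing and the duality map *)

Section Duality.
Variable R : realType.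
Local Notation C := (R[i]).
Local Notation mu := (@lebesgue_measure R).
Local Notation Re := (@complex.Re R).
Local Notation Im := (@complex.Im R).
Implicit Types (f g h : C -> C) (z w t : C) (p q : R).

(** The p-th power of the norm with respect to arc length, the quantity to which pointwise
    inequalities integrate directly; [lpnorm] enters only at the very end. *)
Definition npow p f : R := fine (pint p f).

Lemma npow_ge0 p f : 0 <= npow p f.
Proof. by rewrite fine_ge0// pint_ge0. Qed.

Lemma pintE p f : inLp p f -> pint p f = (npow p f)%:E.
Proof.
by move=> /Lp_fin h; rewrite fineK// ge0_fin_numE// pint_ge0.
Qed.

Lemma npowE p f : npow p f = Rintegral mu (@circ R) (fun x => cmod (f (eit x)) `^ p).
Proof. by []. Qed.

Lemma npow_integrable p f : inLp p f ->
  mu.-integrable (@circ R) (EFin \o (fun x => cmod (f (eit x)) `^ p)).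
Proof.
move=> fp; apply/integrableP; split; first exact: meas_cmodX (Lp_meas fp).
apply: le_lt_trans (Lp_fin fp); apply: ge0_le_integral => //.
- by apply: measurableT_comp => //; exact: meas_cmodX (Lp_meas fp).
- exact: meas_cmodX (Lp_meas fp).
- by move=> x _ /=; rewrite lee_fin ger0_norm// powR_ge0.
Qed.

Lemma npow_le2 p p1 p2 f f1 f2 (c1 c2 : R) :
  inLp p f -> inLp p1 f1 -> inLp p2 f2 -> 0 <= c1 -> 0 <= c2 ->
  aeT (fun t => cmod (f t) `^ p <= c1 * cmod (f1 t) `^ p1 + c2 * cmod (f2 t) `^ p2) ->
  npow p f <= c1 * npow p1 f1 + c2 * npow p2 f2.
Proof.
move=> fp f1p f2p c10 c20 h.
have := pint_le2 (Lp_meas fp) (Lp_meas f1p) (Lp_meas f2p) c10 c20 h.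
by rewrite !pintE// -!EFinM -EFinD lee_fin.
Qed.

Lemma npow_le1 p p1 f f1 (c1 : R) : inLp p f -> inLp p1 f1 -> 0 <= c1 ->
  aeT (fun t => cmod (f t) `^ p <= c1 * cmod (f1 t) `^ p1) ->
  npow p f <= c1 * npow p1 f1.
Proof.
move=> fp f1p c10 h.
have := @npow_le2 p p1 p1 f f1 f1 c1 0 fp f1p f1p c10 (lexx 0).
rewrite mul0r addr0; apply; apply: aeTS h => t _.
by rewrite mul0r addr0.
Qed.

Lemma npow_ae p f g : inLp p f -> inLp p g -> aeT_eq f g -> npow p f = npow p g.
Proof.
move=> fp gp fg; apply/le_anti/andP; split.
  rewrite -[leRHS]mul1r; apply: npow_le1 => //.
  by apply: (@aeTS _ (fun t => f t = g t)) => // t _ ->; rewrite mul1r.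
rewrite -[leRHS]mul1r; apply: npow_le1 => //.
by apply: (@aeTS _ (fun t => f t = g t)) => // t _ ->; rewrite mul1r.
Qed.

Lemma npowN p f : inLp p f -> 0 <= p -> npow p (fun t => - f t) = npow p f.
Proof.
by move=> fp p0; rewrite !npowE; apply: eq_Rintegral => x _; rewrite cmodN.
Qed.

Lemma npow_distC p f g : npow p (fun t => f t - g t) = npow p (fun t => g t - f t).
Proof.
by rewrite !npowE; apply: eq_Rintegral => x _; rewrite -cmodN opprB.
Qed.

Lemma npowZ p f z : 0 <= p -> inLp p f ->
  npow p (fun t => z * f t) = cmod z `^ p * npow p f.
Proof.
move=> p0 fp; rewrite !npowE -RintegralZl//; last exact: npow_integrable.
by apply: eq_Rintegral => x _; rewrite cmodM powRM// cmod_ge0.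
Qed.

Lemma npowD_le p f g : 0 <= p -> inLp p f -> inLp p g ->
  npow p (fun t => f t + g t) <= 2 `^ p * (npow p f + npow p g).
Proof.
move=> p0 fp gp; rewrite mulrDr; apply: npow_le2; rewrite ?powR_ge0//.
  exact: LpD.
apply: aeTW => t _; rewrite -mulrDr.
apply: le_trans (powRD_le p0 (cmod_ge0 _) (cmod_ge0 _)).
by apply: ge0_ler_powR; rewrite // ?nnegrE ?addr_ge0 ?cmod_ge0// cmodD.
Qed.

Lemma npowB_le p f g : 0 <= p -> inLp p f -> inLp p g ->
  npow p (fun t => f t - g t) <= 2 `^ p * (npow p f + npow p g).
Proof. by move=> p0 fp gp; rewrite -(npowN gp p0); apply: npowD_le => //; exact: LpN. Qed.

(** A triangle inequality whose constant on the first summand is arbitrarily close to 1, as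
    comparisons with a minimal value require. The tangent at [x + y] is evaluated at [x], and
    Young's inequality splits the linear term. *)
Lemma powRD_eps p (e : R) : 1 < p -> 0 < e -> exists2 K : R, 0 <= K &
  forall x y, 0 <= x -> 0 <= y -> (1 - e) * (x + y) `^ p <= x `^ p + K * y `^ p.
Proof.
move=> p1 e0; have p0 : 0 < p by lra.
pose q := p / (p - 1).
have pq : p^-1 + q^-1 = 1 by rewrite /q invf_div; field; rewrite gt_eqF.
have [K K0 hK] := young_eps p1 pq (divr_gt0 e0 p0).
exists (p * K); first by rewrite mulr_ge0// ltW.
move=> x y x0 y0; have s0 : 0 <= x + y by rewrite addr_ge0.
have t := powR_tangent p1 s0 x0.
have := hK y ((x + y) `^ (p - 1)) y0 (powR_ge0 _ _).
have -> : ((x + y) `^ (p - 1)) `^ q = (x + y) `^ p.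
  by rewrite -powRrM /q; congr (_ `^ _); field; rewrite gt_eqF//; lra.
rewrite -(ler_pM2l p0) => h.
have e1 : p * (x + y) `^ (p - 1) * (x - (x + y)) = - (p * (y * (x + y) `^ (p - 1))) by ring.
have e2 : p * (K * y `^ p + e / p * (x + y) `^ p) = p * K * y `^ p + e * (x + y) `^ p.
  by field; rewrite gt_eqF.
rewrite e1 in t; rewrite e2 in h; lra.
Qed.

Lemma npowD_eps p (e : R) : 1 < p -> 0 < e -> exists2 K : R, 0 <= K &
  forall f g, inLp p f -> inLp p g ->
    (1 - e) * npow p (fun t => f t + g t) <= npow p f + K * npow p g.
Proof.
move=> p1 e0; have p0 : 0 <= p by lra.
have [K K0 hK] := powRD_eps p1 e0; exists K => // f g fp gp.
have [e1|e1] := leP e 1; last first.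
  apply: (@le_trans _ _ 0); last by rewrite addr_ge0 ?mulr_ge0 ?npow_ge0.
  by rewrite mulr_le0_ge0 ?npow_ge0//; lra.
have e1' : 0 <= 1 - e by lra.
have -> : 1 - e = cmod (((1 - e) `^ p^-1)%:C%C) `^ p.
  rewrite cmod_real ger0_norm ?powR_ge0// -powRrM mulVf ?powRr1// gt_eqF//; lra.
rewrite -npowZ//; last exact: LpD.
rewrite -[npow p f]mul1r; apply: npow_le2 => //.
  by apply: LpZ => //; exact: LpD.
apply: aeTW => t _; rewrite mul1r cmodM powRM ?cmod_ge0//.
apply: le_trans (hK _ _ (cmod_ge0 (f t)) (cmod_ge0 (g t))).
rewrite cmod_real ger0_norm ?powR_ge0// -powRrM mulVf ?powRr1//; last by rewrite gt_eqF//; lra.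
rewrite ler_wpM2l//; apply: ge0_ler_powR; rewrite ?nnegrE ?addr_ge0 ?cmod_ge0//.
exact: cmodD.
Qed.

Lemma half_frac (x e : R) : 0 <= x -> 0 < e -> x * (e / (2 * (x + 1))) <= e / 2.
Proof.
move=> x0 e0; have -> : x * (e / (2 * (x + 1))) = e / 2 * (x / (x + 1)).
  by field; rewrite gt_eqF//; lra.
rewrite ler_piMr ?divr_ge0 ?(ltW e0)// ler_pdivrMr; lra.
Qed.

(** Continuity of the pairing at 0: in Young's inequality the small coefficient goes to the fixed
    factor [g]. *)
Lemma pairing_small p q g (e : R) : 1 < p -> p^-1 + q^-1 = 1 -> inLp q g -> 0 < e ->
  exists2 d : R, 0 < d & forall f, inLp p f -> npow p f <= d ->
    cmod (cmean (fun t => f t * g t)) <= e.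
Proof.
move=> p1 pq gq e0.
pose G := npow q g; have G0 : 0 <= G := npow_ge0 q g.
pose h := e / (2 * (G + 1)).
have h0 : 0 < h by rewrite divr_gt0// mulr_gt0//; lra.
have [K K0 hK] := young_eps p1 pq h0.
exists (e / (2 * (K + 1))); first by rewrite divr_gt0// mulr_gt0//; lra.
move=> f fp fd; have fg := Lp1_mul p1 pq fp gq.
apply: (le_trans (cmean_le fg)).
have := @npow_le2 1 p q (fun t => f t * g t) f g K h fg fp gq K0 (ltW h0).
move=> /(_ (aeTW _)) le1.
apply: le_trans (le1 _) _ => [t _|].
  by rewrite powRr1 ?cmod_ge0// cmodM; apply: hK; exact: cmod_ge0.
rewrite -/G [leRHS](splitr e); apply: lerD; last by rewrite mulrC; exact: half_frac.
apply: le_trans (ler_wpM2l K0 fd) _; exact: half_frac.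
Qed.

(** The duality map from L^p to L^q: up to conjugation, the gradient of |z|^p / p. At 0 the factor
    [conjc z] gives the value 0, whatever the sign of [p - 2]. *)
Definition dualc p z : C := (cmod z `^ (p - 2))%:C%C * conjc z.

Lemma dualcM p z : 0 < p -> dualc p z * z = (cmod z `^ p)%:C%C.
Proof.
move=> p0; rewrite /dualc -mulrA [conjc z * z]mulrC mulc_conj -rmorphM; congr (_ %:C%C)%C.
have [z0|z0] := eqVneq (cmod z) 0.
  by rewrite z0 expr0n mulr0 powR0// gt_eqF.
rewrite -powR_mulrn ?cmod_ge0// -powRD ?z0 ?implybT//; congr (_ `^ _); ring.
Qed.

Lemma cmod_dualc p z : 1 < p -> cmod (dualc p z) = cmod z `^ (p - 1).
Proof.
move=> p1; rewrite cmodM cmod_conj cmod_real ger0_norm ?powR_ge0//.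
have [z0|z0] := eqVneq (cmod z) 0.
  by rewrite z0 mulr0 powR0// gt_eqF//; lra.
rewrite -{2}[cmod z]powRr1 ?cmod_ge0// -powRD ?z0 ?implybT//; congr (_ `^ _); ring.
Qed.

Lemma cmod_dualc_conj p q z : 1 < p -> p^-1 + q^-1 = 1 ->
  cmod (dualc p z) `^ q = cmod z `^ p.
Proof.
move=> p1 pq; rewrite cmod_dualc// -powRrM; congr (_ `^ _).
have p0 : p != 0 by rewrite gt_eqF//; lra.
have q0 : q != 0.
  apply/eqP => q0; rewrite q0 invr0 addr0 in pq.
  by have := @invf_lt1 _ p (lt_trans ltr01 p1); rewrite pq ltxx p1.
have : p + q = p * q.
  have := congr1 (fun x => p * q * x) pq; rewrite mulr1 => <-.
  by field; rewrite p0 q0.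
by move=> h; rewrite mulrBl mul1r -h addrK.
Qed.

Lemma meas_dualc p f : meas_on_T f -> meas_on_T (fun t => dualc p (f t)).
Proof.
move=> mf; apply: measM; last exact: measJ.
apply: (@meas_real _ (fun t => cmod (f t) `^ (p - 2))).
by apply/measurable_EFinP; exact: meas_cmodX.
Qed.

Lemma Lp_dualc p q f : 1 < p -> p^-1 + q^-1 = 1 -> inLp p f ->
  inLp q (fun t => dualc p (f t)).
Proof.
move=> p1 pq fp; apply: (@LpM_le _ _ p p _ f f 1 0) => //; first exact: meas_dualc (Lp_meas fp).
by apply: aeTW => t _; rewrite (cmod_dualc_conj _ p1 pq) mul1r mul0r addr0.
Qed.

(** The tangent plane inequality for |z|^p: the tangent line inequality for the moduli, together
    with the bound of [Re (dualc p w * z)] by |w|^(p-1) |z|. *)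
Lemma dualc_tangent p z w : 1 < p ->
  cmod w `^ p + p * Re (dualc p w * (z - w)) <= cmod z `^ p.
Proof.
move=> p1; have p0 : 0 < p by lra.
apply: le_trans (powR_tangent p1 (cmod_ge0 w) (cmod_ge0 z)).
rewrite lerD2l -mulrA ler_pM2l// mulrBr cReD cReN dualcM//= mulrBr lerB//.
  by rewrite (le_trans (ler_norm _))// (le_trans (ler_Re_cmod _))// cmodM cmod_dualc.
by rewrite mulrC mulr_powRB1// cmod_ge0.
Qed.

Lemma cvg_dualc p (u : nat -> C) l : 1 < p -> cmod (u n - l) @[n --> \oo] --> (0 : R) ->
  Re (u n) @[n --> \oo] --> Re l -> Im (u n) @[n --> \oo] --> Im l ->
  forall m : C, Re (dualc p (u n) * m) @[n --> \oo] --> Re (dualc p l * m).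
Proof.
move=> p1 ul hr hi m; have cu := cvg_cmod ul.
(* At the limit 0 the exponent [p - 2] may be negative, so continuity is read off from the modulus,
   which is |z|^(p-1). *)
have [l0|l0] := eqVneq l 0.
  have -> : dualc p l * m = 0 by rewrite l0 /dualc conjc0 mulr0 mul0r.
  apply/norm_cvg0P.
  apply: (@squeeze_cvgr _ _ _ _ (fun=> 0) (fun n => cmod (u n) `^ (p - 1) * cmod m)).
  - apply: nearW => n; rewrite normr_ge0/= (le_trans (ler_Re_cmod _))//.
    by rewrite cmodM cmod_dualc.
  - exact: cvg_cst.
  - have -> : (0 : R) = cmod l `^ (p - 1) * cmod m.
      by rewrite l0 cmod0 powR0 ?mul0r// gt_eqF//; lra.
    apply: cvgM; last exact: cvg_cst.
    by apply: cvg_powR => //; [lra|move=> n; exact: cmod_ge0].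
have cl0 : 0 < cmod l by rewrite lt_neqAle cmod_ge0 eq_sym cmod_eq0 l0.
have hp : cmod (u n) `^ (p - 2) @[n --> \oo] --> cmod l `^ (p - 2).
  apply: (cvg_comp _ (fun x => x `^ (p - 2)) cu).
  suff : {for cmod l, continuous (fun x : R => x `^ (p - 2))} by [].
  apply: differentiable_continuous; apply/derivable1_diffP.
  by apply: derivable_powR; rewrite in_itv/= cl0.
have e z : Re (dualc p z * m) =
    cmod z `^ (p - 2) * (Re z * Re m + Im z * Im m).
  by rewrite /dualc !cReM !cImM cReJ cImJ /=; ring.
rewrite e; under eq_fun do rewrite e.
by apply: cvgM => //; apply: cvgD; apply: cvgM => //; exact: cvg_cst.
Qed.

End Duality.

(** * Nearest points and annihilators in L^p *)

Section Annihilators.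
Variable R : realType.
Local Notation C := (R[i]).
Local Notation mu := (@lebesgue_measure R).
Local Notation Re := (@complex.Re R).
Local Notation Im := (@complex.Im R).
Implicit Types (f g h : C -> C) (z w t : C) (p q : R).

Opaque npow pint.

Lemma cmod_small0 z : (forall h : R, 0 < h -> cmod z <= h) -> z = 0.
Proof.
move=> hz; apply/eqP; rewrite -cmod_eq0 eq_le cmod_ge0 andbT.
by apply/ler_addgt0Pr => h h0; rewrite add0r hz.
Qed.

Lemma npow_uniform_convexity p (e : R) : 1 < p -> 0 < e -> exists2 K : R, 0 <= K &
  forall f g, inLp p f -> inLp p g ->
    npow p (fun t => f t - g t) + K * npow p (fun t => (f t + g t) / 2%:R) <=
      (e + K / 2) * (npow p f + npow p g).
Proof.
move=> p1 e0; have p0 : 0 <= p by lra.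
have [K K0 hK] := uniform_convexity p1 e0; exists K; first exact: K0.
move=> f g fp gp.
have fgp := LpB p0 fp gp.
have fgp' : inLp p (fun t => (f t + g t) / 2%:R).
  apply: (@inLp_eq _ p (fun t => 2%:R^-1 * (f t + g t))) => //.
    by move=> t _; rewrite mulrC.
  by apply: LpZ => //; exact: LpD.
have i1 := npow_integrable fgp; have i2 := npow_integrable fgp'.
have i3 := npow_integrable fp; have i4 := npow_integrable gp.
have iZ (r : R) (u : R -> R) : mu.-integrable (@circ R) (EFin \o u) ->
    mu.-integrable (@circ R) (EFin \o (fun x => r * u x)).
  by move=> ui; apply: eq_integrable (integrableZl _ r ui).
have iD (u v : R -> R) : mu.-integrable (@circ R) (EFin \o u) ->
    mu.-integrable (@circ R) (EFin \o v) ->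
    mu.-integrable (@circ R) (EFin \o (fun x => u x + v x)).
  by move=> ui vi; apply: eq_integrable (integrableD _ ui vi).
have mC := @measurable_circ R.
rewrite !npowE -RintegralD; [|exact: mC|exact: i3|exact: i4].
rewrite -RintegralZl; [|exact: mC|exact: i2].
rewrite -RintegralZl; [|exact: mC|exact: iD i3 i4].
rewrite -RintegralD; [|exact: mC|exact: i1|exact: iZ].
apply: le_Rintegral => //.
- by apply: iD => //; exact: iZ.
- by apply: iZ; exact: iD.
move=> x _; have := hK (f (eit x)) (g (eit x)); lra.
Qed.

Lemma cReZ (x : R) z : Re (x%:C%C * z) = x * Re z.
Proof. by rewrite cReM /= mul0r subr0. Qed.

Lemma Re_cmean f : Re (cmean f) = (2 * pi)^-1 * Rintegral mu (@circ R) (fun x => Re (f (eit x))).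
Proof. by []. Qed.

Lemma cvg_invS : (n.+1%:R^-1 : R) @[n --> \oo] --> (0 : R).
Proof. exact: (@cvg_harmonic R). Qed.

(* At a point [r] of minimal norm in [r + M], the derivative of the norm vanishes
   in all directions of [M]. *)
Lemma minimizer_annihilates p q r m : 1 < p -> p^-1 + q^-1 = 1 ->
  inLp p r -> inLp p m ->
  (forall z, npow p r <= npow p (fun t => r t + z * m t)) ->
  cmean (fun t => dualc p (r t) * m t) = 0.
Proof.
move=> p1 pq rp mp rmin; have p0 : 0 <= p by lra.
have half (m' : C -> C) : inLp p m' ->
    (forall x : R, npow p r <= npow p (fun t => r t + x%:C%C * m' t)) ->
    0 <= Re (cmean (fun t => dualc p (r t) * m' t)).
  move=> m'p min.
  have ipos : 0 <= (2 * pi)^-1 :> R by rewrite invr_ge0 mulr_ge0// pi_ge0.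
  rewrite Re_cmean mulr_ge0//.
  (* The tangent inequality is based at the displaced point [w n]: together with the minimality of
     [r] it fixes the sign of the pairing of [m'] with [dualc p (w n)], and then the displacement
     tends to 0. *)
  pose w n (t : C) : C := r t + (n.+1%:R^-1)%:C%C * m' t.
  have wp n : inLp p (w n) by apply: LpD => //; exact: LpZ.
  have ai n : inLp 1 (fun t => dualc p (w n t) * m' t).
    apply: (@inLp_eq _ 1 (fun t => m' t * dualc p (w n t))) => //.
      by move=> t _; rewrite mulrC.
    by apply: (Lp1_mul p1 pq) => //; exact: Lp_dualc.
  have pos n : 0 <= Rintegral mu (@circ R) (fun x => Re (dualc p (w n (eit x)) * m' (eit x))).
    have n0 : 0 < n.+1%:R^-1 :> R by rewrite invr_gt0.
    have c0 : 0 < p * n.+1%:R^-1 by rewrite mulr_gt0//; lra.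
    rewrite -(pmulr_rge0 _ c0).
    have -> : p * n.+1%:R^-1 * Rintegral mu (@circ R)
        (fun x => Re (dualc p (w n (eit x)) * m' (eit x))) =
      Rintegral mu (@circ R) (fun x => p * n.+1%:R^-1 *
        Re (dualc p (w n (eit x)) * m' (eit x))).
      by rewrite RintegralZl//; exact: (Lp1_Re (ai n)).
    have iz : mu.-integrable (@circ R) (EFin \o (fun x => p * n.+1%:R^-1 *
        Re (dualc p (w n (eit x)) * m' (eit x)))).
      by apply: eq_integrable (integrableZl _ (p * n.+1%:R^-1) (Lp1_Re (ai n))).
    rewrite -[leLHS](subrr (npow p (w n))); apply: (@le_trans _ _ (npow p (w n) - npow p r)).
      by apply: lerB; [exact: lexx|exact: (min n.+1%:R^-1)].
    rewrite lerBlDr !npowE -RintegralD; [|exact: measurable_circ|exact: iz|exact: npow_integrable].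
    apply: le_Rintegral => //; first exact: npow_integrable.
      by apply: eq_integrable (integrableD _ iz (npow_integrable rp)).
    move=> x _; have := dualc_tangent (r (eit x)) (w n (eit x)) p1.
    have -> : r (eit x) - w n (eit x) = - ((n.+1%:R^-1)%:C%C * m' (eit x)).
      by rewrite /w; ring.
    rewrite mulrN mulrCA cReN cReZ mulrN => h.
    by rewrite -lerBlDl -mulrA.
  suff h : Rintegral mu (@circ R) (fun x => Re (dualc p (w n (eit x)) * m' (eit x)))
      @[n --> \oo] --> Rintegral mu (@circ R) (fun x => Re (dualc p (r (eit x)) * m' (eit x))).
    by rewrite -(cvg_lim _ h)//; apply: limr_ge; [apply/cvg_ex; eexists; exact: h|exact: nearW].
  (* The p-th power of [b] dominates all the integrands, since displacements are at most [m'] in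
     modulus. *)
  pose b (t : C) : C := (cmod (r t) + cmod (m' t))%:C%C.
  have bp : inLp p b.
    apply: (LpM_le _ rp m'p (powR_ge0 2 p) (powR_ge0 2 p)).
      apply: (@meas_real _ (fun t => cmod (r t) + cmod (m' t))).
      by apply: measurable_funD; apply: meas_cmod; [exact: Lp_meas rp|exact: Lp_meas m'p].
    apply: aeTW => t _; rewrite -mulrDr cmod_real ger0_norm ?addr_ge0 ?cmod_ge0//.
    exact: (powRD_le p0 (cmod_ge0 _) (cmod_ge0 _)).
  apply: (@circ_dct _ _ _ (fun x => cmod (b (eit x)) `^ p)).
  - by move=> n; have [] := Lp_meas (ai n).
  - have [] // : meas_on_T (fun t => dualc p (r t) * m' t).
    by apply: measM; [exact: meas_dualc (Lp_meas rp)|exact: Lp_meas m'p].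
  - apply: aeW => x _.
    have hr : Re (w n (eit x)) @[n --> \oo] --> Re (r (eit x)).
      rewrite -[X in _ --> X]addr0 -[X in _ --> _ + X](mul0r (Re (m' (eit x)))).
      under eq_fun do rewrite /w cReD cReM /= mul0r subr0.
      by apply: cvgD; [exact: cvg_cst|apply: cvgM; [exact: cvg_invS|exact: cvg_cst]].
    have hi : Im (w n (eit x)) @[n --> \oo] --> Im (r (eit x)).
      rewrite -[X in _ --> X]addr0 -[X in _ --> _ + X](mul0r (Im (m' (eit x)))).
      under eq_fun do rewrite /w cImD cImM /= mul0r addr0.
      by apply: cvgD; [exact: cvg_cst|apply: cvgM; [exact: cvg_invS|exact: cvg_cst]].
    exact: (cvg_dualc p1 (cvg_complex hr hi) hr hi).
  - exact: npow_integrable.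
  - apply: aeW => x n _; rewrite (le_trans (ler_Re_cmod _))// cmodM cmod_dualc//.
    have B0 : 0 <= cmod (r (eit x)) + cmod (m' (eit x)) by rewrite addr_ge0 ?cmod_ge0.
    rewrite /b cmod_real ger0_norm// -(mulr_powRB1 B0 (lt_trans ltr01 p1)).
    rewrite mulrC; apply: ler_pM; rewrite ?cmod_ge0 ?powR_ge0// ?lerDr ?cmod_ge0//.
    apply: ge0_ler_powR; rewrite ?nnegrE ?cmod_ge0//; first lra.
    rewrite (le_trans (cmodD _ _))// lerD2l cmodM ler_piMl ?cmod_ge0//.
    by rewrite cmod_real ger0_norm ?invr_ge0// invf_le1// ler1n.
(* The inequality holds for every multiple of [m]; the multiples by 1, -1, i and -i leave only the
   value 0. *)
have lin (z : C) : 0 <= Re (z * cmean (fun t => dualc p (r t) * m t)).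
  have zm : inLp p (fun t => z * m t) by exact: LpZ.
  have := half _ zm; rewrite -cmeanZ; last first.
    apply: (@inLp_eq _ 1 (fun t => m t * dualc p (r t))) => //.
      by move=> t _; rewrite mulrC.
    by apply: (Lp1_mul p1 pq) => //; exact: Lp_dualc.
  rewrite (@eq_cmean _ _ (fun t => z * (dualc p (r t) * m t))); last first.
    by move=> t _; rewrite mulrCA.
  apply=> x; apply: le_trans (rmin (x%:C%C * z)) _.
  rewrite le_eqVlt; apply/orP; left; apply/eqP; congr npow.
  by apply/funext => t; rewrite mulrA.
move: lin; set v := cmean _ => lin.
have := lin 1; have := lin (-1); have := lin ('i)%C; have := lin (- ('i)%C).
case: v {lin} => a b; rewrite !cReM /= => h1 h2 h3 h4.
by apply: complex_ext => /=; lra.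
Qed.

(** Plays the part of Hahn-Banach separation together with the representation of functionals. A
    minimising sequence in [g - M] is Cauchy by uniform convexity, because midpoints stay in
    [g - M]; the duality map applied to its limit [r] gives [k]. The limit may lie outside
    [g - M]. *)
Lemma annihilator p q (M : (C -> C) -> Prop) g (e : R) : 1 < p -> p^-1 + q^-1 = 1 ->
  (forall m, M m -> inLp p m) -> M (fun=> 0) ->
  (forall m m', M m -> M m' -> M (fun t => m t + m' t)) ->
  (forall z m, M m -> M (fun t => z * m t)) ->
  inLp p g -> 0 < e -> (forall m, M m -> e <= npow p (fun t => g t - m t)) ->
  exists k, [/\ inLp q k, forall m, M m -> cmean (fun t => k t * m t) = 0 &
    cmean (fun t => k t * g t) != 0].
Proof.
move=> p1 pq Mp M0 MD MZ gp e0 Me; have p0 : 0 <= p by lra.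
pose S := [set npow p (fun t => g t - m t) | m in M].
have Slb : lbound S e by move=> _ [m Mm <-]; exact: Me.
have Sinf : has_inf S.
  by split; [exists (npow p (fun t => g t - 0)); exists (fun=> 0)|exists e].
pose d := inf S.
have ed : e <= d by apply: lb_le_inf => //; case: Sinf.
have dle m : M m -> d <= npow p (fun t => g t - m t).
  by move=> Mm; apply: ge_inf; [case: Sinf|exists m].
have ex n : exists m, M m /\ npow p (fun t => g t - m t) < d + n.+1%:R^-1.
  have [|_ [m Mm <-] h] := @inf_adherent _ S n.+1%:R^-1 _ Sinf; first by rewrite invr_gt0.
  by exists m.
have /choice[m hm] := ex.
have Mm n := (hm n).1.
pose r_ n t := g t - m n t.
have rp n : inLp p (r_ n) by apply: LpB => //; exact/Mp/Mm.
have rd n : npow p (r_ n) < d + n.+1%:R^-1 := (hm n).2.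
have invS_small (h : R) : 0 < h -> exists N, forall n, (N <= n)%N -> n.+1%:R^-1 <= h.
  move=> h0; have := cvg_invS => /cvgrPdist_le/(_ _ h0)[N _ hN].
  by exists N => n Nn; have := hN n Nn; rewrite sub0r normrN ger0_norm// invr_ge0.
have d0 : 0 < d by lra.
have cauchy (h : R) : 0 < h -> exists N, forall j k, (N <= j)%N -> (N <= k)%N ->
    (pint p (fun t => (r_ j t - r_ k t)%R) <= h%:E)%E.
  (* Both p-th powers are at most [d + 1], so the term with [h'] spends half of [h]; the other half
     pays for the defect at the midpoint, whose power is at least [d]. *)
  move=> h0; pose h' := h / (4 * (d + 1)).
  have h'0 : 0 < h' by rewrite divr_gt0// mulr_gt0//; lra.
  have [K K0 hK] := npow_uniform_convexity p1 h'0.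
  have h''0 : 0 < h / (2 * (K + 1)) by rewrite divr_gt0// mulr_gt0//; lra.
  have [N hN] := invS_small _ h''0; exists N => j k Nj Nk.
  rewrite pintE; last exact: LpB.
  rewrite lee_fin.
  have := hK _ _ (rp j) (rp k).
  have le1 n : n.+1%:R^-1 <= 1 :> R by rewrite invf_le1// ler1n.
  have dm : d <= npow p (fun t => (r_ j t + r_ k t) / 2%:R).
    have -> : (fun t => (r_ j t + r_ k t) / 2%:R) =
        (fun t => g t - 2%:R^-1 * (m j t + m k t)).
      by apply/funext => t; rewrite /r_; field.
    by apply: dle; apply: MZ; exact: MD.
  have a1 := rd j; have a2 := rd k; have b1 := hN _ Nj; have b2 := hN _ Nk.
  have c1 := le1 j; have c2 := le1 k.
  set nj := npow p (r_ j) in a1 *; set nk := npow p (r_ k) in a2 *.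
  set nm := npow p _ in dm *; set nd := npow p _.
  have s1 : h' * (nj + nk) <= h / 2.
    apply: (@le_trans _ _ (h' * (2 * (d + 1)))).
      rewrite ler_pM2l// (_ : 2 * (d + 1) = (d + 1) + (d + 1)); last by ring.
      apply: lerD.
        by rewrite (le_trans (ltW a1))// lerD2l.
      by rewrite (le_trans (ltW a2))// lerD2l.
    rewrite /h'; have -> : h / (4 * (d + 1)) * (2 * (d + 1)) = h / 2.
      by field; rewrite gt_eqF//; lra.
    exact: lexx.
  have s2 : K * ((nj + nk) / 2 - nm) <= h / 2.
    apply: (@le_trans _ _ (K * (h / (2 * (K + 1))))); last exact: half_frac.
    rewrite ler_wpM2l//; set hh := h / _ in b1 b2 *.
    have a1' : nj <= d + hh by rewrite (le_trans (ltW a1))// lerD2l.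
    have a2' : nk <= d + hh by rewrite (le_trans (ltW a2))// lerD2l.
    clear - a1' a2' dm; lra.
  clear - s1 s2; lra.
have [r [rLp hr]] := Lp_complete (ltW p1) rp cauchy.
have hr' (h : R) : 0 < h -> exists N, forall n, (N <= n)%N ->
    npow p (fun t => r t - r_ n t) <= h.
  move=> /hr[N hN]; exists N => n /hN; rewrite pintE ?lee_fin//; exact: LpB.
(* [r + m'] is close to [r_ N + m'], an element of [g - M], and [npowD_eps] loses only an
   arbitrarily small fraction of [d]. *)
have rge m' : M m' -> d <= npow p (fun t => r t + m' t).
  move=> Mm'; apply/ler_addgt0Pr => h h0.
  have h20 : 0 < h / (2 * d) by rewrite divr_gt0// mulr_gt0.
  have [K K0 hK] := npowD_eps p1 h20.
  have h3 : 0 < h / (2 * (K + 1)) by rewrite divr_gt0// mulr_gt0//; lra.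
  have [N hN] := hr' _ h3.
  have rm' : inLp p (fun t => r t + m' t) by apply: LpD => //; exact: Mp.
  have rrn : inLp p (fun t => r_ N t - r t) by exact: LpB.
  have := hK _ _ rm' rrn.
  have -> : (fun t => r t + m' t + (r_ N t - r t)) = (fun t => g t - (m N t + (-1) * m' t)).
    by apply/funext => t; rewrite /r_; ring.
  have a1 := dle _ (MD _ _ (Mm N) (MZ (-1) _ Mm')).
  have a2 := hN N (leqnn _); rewrite npow_distC in a2.
  have a3 : K * npow p (fun t => r_ N t - r t) <= h / 2.
    by apply: le_trans (ler_wpM2l K0 a2) _; exact: half_frac.
  move=> a4.
  have [h1|h1] := leP 1 (h / (2 * d)).
    have hd : d <= h by move: h1; rewrite ler_pdivlMr ?mulr_gt0// mul1r; clear - d0; lra.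
    by rewrite (le_trans hd)// lerDr npow_ge0.
  have : (1 - h / (2 * d)) * d <= npow p (fun t => r t + m' t) + h / 2.
    apply: (le_trans _ (le_trans a4 _)); last by rewrite lerD2l.
    by rewrite ler_pM2l// subr_gt0.
  have -> : (1 - h / (2 * d)) * d = d - h / 2 by field; rewrite gt_eqF.
  rewrite lerBlDr -addrA -splitr; exact.
have rle : npow p r <= d.
  apply/ler_addgt0Pr => h h0.
  have n0 := npow_ge0 p r.
  pose h' := h / (4 * (npow p r + 1)).
  have h'0 : 0 < h' by rewrite divr_gt0// mulr_gt0//; lra.
  have [K K0 hK] := npowD_eps p1 h'0.
  have h3 : 0 < h / 4 / (2 * (K + 1)) by rewrite !divr_gt0// mulr_gt0//; lra.
  have h40 : 0 < h / 4 by rewrite divr_gt0.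
  have [N1 hN1] := hr' _ h3; have [N2 hN2] := invS_small _ h40.
  pose N := maxn N1 N2.
  have rrn : inLp p (fun t => r t - r_ N t) by exact: LpB.
  have := hK _ _ (rp N) rrn.
  have -> : (fun t => r_ N t + (r t - r_ N t)) = r.
    by apply/funext => t; ring.
  have a1 := rd N; have a2 := hN1 N (leq_maxl _ _); have a3 := hN2 N (leq_maxr _ _).
  have a5 : K * npow p (fun t => r t - r_ N t) <= h / 4 / 2.
    by apply: le_trans (ler_wpM2l K0 a2) _; exact: half_frac.
  have a6 : h' * npow p r <= h / 4.
    have <- : h / 2 / 2 = h / 4 by field.
    have <- : h / 2 / (2 * (npow p r + 1)) = h'.
      by rewrite /h'; field; rewrite gt_eqF// ltr_wpDl.
    by rewrite mulrC; apply: half_frac => //; rewrite divr_gt0.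
  have a1' : npow p (r_ N) <= d + h / 4 by rewrite (le_trans (ltW a1))// lerD2l.
  rewrite mulrBl mul1r lerBlDr => a4; apply: (le_trans a4).
  apply: le_trans (lerD (lerD a1' a5) a6) _; clear - h0; lra.
have rmin m' : M m' -> npow p r <= npow p (fun t => r t + m' t).
  by move=> Mm'; apply: le_trans rle _; exact: rge.
pose k t := dualc p (r t).
have kq : inLp q k by exact: Lp_dualc.
have p0' : 0 < p by lra.
have ann m' : M m' -> cmean (fun t => k t * m' t) = 0.
  move=> Mm'; apply: (minimizer_annihilates p1 pq rLp (Mp _ Mm')).
  by move=> z; apply: rmin; exact: MZ.
exists k; split => //.
have i1 f : inLp p f -> inLp 1 (fun t => k t * f t).
  move=> fp; apply: (@inLp_eq _ 1 (fun t => f t * k t)) => //.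
    by move=> t _; rewrite mulrC.
  exact: (Lp1_mul p1 pq).
(* As [k] annihilates [M], it pairs with [g] as with every [r_ n], hence as with the limit [r],
   where the pairing is the positive mean of |r|^p. *)
have -> : cmean (fun t => k t * g t) = cmean (fun t => k t * r t).
  apply/eqP; rewrite -subr_eq0 -cmeanB; [|exact: i1..].
  apply/eqP/cmod_small0 => h h0.
  have [dl dl0 hdl] := pairing_small p1 pq kq h0.
  have [N hN] := hr' _ dl0.
  have grp : inLp p (fun t => r_ N t - r t) by exact: LpB.
  have := hdl _ grp; rewrite npow_distC => /(_ (hN N (leqnn _))).
  suff -> : cmean (fun t => (r_ N t - r t) * k t) = cmean (fun t => k t * g t - k t * r t) by [].
  rewrite (@eq_cmean _ _ (fun t => (k t * g t - k t * r t) - k t * m N t)); last first.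
    by move=> t _; rewrite /r_; ring.
  rewrite cmeanB; last 2 first.
  - by apply: LpB => //; exact: i1.
  - by apply: i1; exact/Mp/Mm.
  by rewrite ann// subr0.
have -> : cmean (fun t => k t * r t) = ((2 * pi)^-1 * npow p r)%:C%C.
  apply: complex_ext => /=.
    congr (_ * _); apply: eq_Rintegral => x _; rewrite dualcM//.
  rewrite (_ : Rintegral _ _ _ = 0) ?mulr0//.
  under eq_Rintegral do rewrite dualcM//=.
  by rewrite /Rintegral integral0.
rewrite -cmod_eq0 cmod_real normr_eq0 mulf_eq0 invr_eq0 negb_or.
rewrite gt_eqF ?mulr_gt0 ?pi_gt0//= gt_eqF//.
have := rge _ M0; rewrite (_ : (fun t => r t + 0) = r); last by apply/funext => t; rewrite addr0.
by apply: lt_le_trans.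
Qed.

End Annihilators.

(** * A pointwise inequality *)

Section PointwiseBound.
Variable R : realType.
Local Notation C := (R[i]).
Local Notation mu := (@lebesgue_measure R).
Local Notation Re := (@complex.Re R).
Local Notation Im := (@complex.Im R).
Implicit Types (f g h : C -> C) (z w t : C) (p q : R).

(** By homogeneity s^(p-1) u^2 / (u + s) equals u^p times [dyw p (s / u)], so the sums over scales
    are sums of this one profile. It tends to 0 both at 0 and at infinity for 1 < p < 2. *)
Definition dyw p (x : R) : R := x `^ (p - 1) / (1 + x).

Lemma telescope_frac (b y : R) : 1 < b -> 0 < y ->
  y / ((1 + y) * (1 + b * y)) = (b * y / (1 + b * y) - y / (1 + y)) / (b - 1).
Proof.
move=> b1 y0; have h1 : 1 + y != 0 by rewrite gt_eqF//; lra.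
have by0 : 0 < b * y by rewrite mulr_gt0//; lra.
have h2 : 1 + b * y != 0 by rewrite gt_eqF//; lra.
have h3 : b - 1 != 0 by rewrite gt_eqF//; lra.
by field; rewrite h1 h2 h3.
Qed.

(** Replaces a two-sided geometric series by a telescoping one: along a progression of ratio [b],
    [telescope_frac] turns the right side into a difference of consecutive values of
    [y / (1 + y)]. *)
Lemma min_frac (b y : R) : 1 < b -> 0 < y ->
  Num.min y y^-1 <= 2 * (1 + b) * (y / ((1 + y) * (1 + b * y))).
Proof.
move=> b1 y0; have D0 : 0 < (1 + y) * (1 + b * y) by rewrite mulr_gt0//; nra.
rewrite mulrA ler_pdivlMr//; have [y1|/ltW y1] := leP y 1.
  apply: (@le_trans _ _ (y * ((1 + y) * (1 + b * y)))).
    by rewrite ler_wpM2r ?(ltW D0)// ge_min lexx.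
  rewrite [leRHS]mulrC ler_pM2l//.
  have : (1 + y) * (1 + b * y) <= 2 * (1 + b).
    by apply: ler_pM; nra.
  exact.
apply: (@le_trans _ _ (y^-1 * ((1 + y) * (1 + b * y)))).
  by rewrite ler_wpM2r ?(ltW D0)// ge_min lexx orbT.
rewrite ler_pdivrMl// mulrA [leRHS](_ : _ = (2 * y) * ((1 + b) * y)); last by ring.
by apply: ler_pM; nra.
Qed.

Lemma dyw_le p (x : R) : 1 < p < 2 -> 0 < x ->
  dyw p x <= Num.min (x `^ (Num.min (p - 1) (2 - p))) (x `^ (Num.min (p - 1) (2 - p)))^-1.
Proof.
move=> /andP[p1 p2] x0; set a := Num.min (p - 1) (2 - p).
have a1 : a <= p - 1 by rewrite ge_min lexx.
have a2 : a <= 2 - p by rewrite ge_min lexx orbT.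
have a0 : 0 < a by rewrite lt_min; apply/andP; split; lra.
have xp0 : 0 < 1 + x by lra.
rewrite /dyw -powRN le_min; have [x1|/ltW x1] := leP x 1.
  have h : x `^ (p - 1) / (1 + x) <= x `^ a.
    rewrite ler_pdivrMr//; apply: (@le_trans _ _ (x `^ a)).
      by apply: ger_powR => //; rewrite x0.
    by rewrite ler_peMr ?powR_ge0//; lra.
  rewrite h /=; apply: (le_trans h).
  by apply: ger_powR; [rewrite x0|lra].
have h : x `^ (p - 1) / (1 + x) <= x `^ (- a).
  rewrite ler_pdivrMr//; apply: (@le_trans _ _ (x `^ (- a) * x)).
    rewrite -{3}[x]powRr1 ?(ltW x0)// -powRD; last by rewrite (gt_eqF x0) implybT.
    by apply: ler_powR => //; lra.
  by rewrite ler_wpM2l ?powR_ge0//; lra.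
rewrite h andbT; apply: (le_trans h).
by apply: ler_powR => //; lra.
Qed.

(** The a-th powers of the dyadic points form a progression of ratio [b], the telescoped bound
    applies, and [y / (1 + y)] stays in [0, 1]; hence a constant independent of [x] and [n]. *)
Lemma dyw_sum p : 1 < p < 2 -> exists2 K : R, 0 <= K &
  forall (x : R) n, 0 < x -> \sum_(0 <= j < n) dyw p (2 ^+ j * x) <= K.
Proof.
move=> p12; pose a := Num.min (p - 1) (2 - p).
have a0 : 0 < a by rewrite lt_min; case/andP: p12 => *; apply/andP; split; lra.
pose b : R := 2 `^ a.
have b1 : 1 < b by rewrite -[ltLHS](powR1x a); apply: gt0_ltr_powR; rewrite ?nnegrE// ltr1n.
have K0 : 0 <= 2 * (1 + b) / (b - 1) by rewrite divr_ge0 ?mulr_ge0//; lra.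
exists (2 * (1 + b) / (b - 1)) => // x n x0.
pose y j : R := (2 ^+ j * x) `^ a.
have y0 j : 0 < y j by apply: powR_gt0; rewrite mulr_gt0// exprn_gt0.
have yS j : y j.+1 = b * y j.
  by rewrite /y exprS -mulrA powRM// mulr_ge0 ?exprn_ge0// ltW.
have step j : dyw p (2 ^+ j * x) <=
    2 * (1 + b) / (b - 1) * (y j.+1 / (1 + y j.+1) - y j / (1 + y j)).
  apply: le_trans (dyw_le p12 _) _; first by rewrite mulr_gt0// exprn_gt0.
  apply: le_trans (min_frac b1 (y0 j)) _.
  by rewrite telescope_frac// yS le_eqVlt; apply/orP; left; apply/eqP; ring.
apply: (@le_trans _ _ (\sum_(0 <= j < n) 2 * (1 + b) / (b - 1) *
    (y j.+1 / (1 + y j.+1) - y j / (1 + y j)))).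
  by apply: ler_sum => j _; exact: step.
rewrite -mulr_sumr telescope_sumr// ler_piMr//.
have h1 : y n / (1 + y n) <= 1.
  by rewrite ler_pdivrMr ?mul1r ?lerDr//; have := y0 n; lra.
have h2 : 0 <= y 0%N / (1 + y 0%N) by rewrite divr_ge0 ?addr_ge0 ?(ltW (y0 _)).
lra.
Qed.

Definition refrac (s u v : R) : R :=
  (u * (u ^+ 2 + v ^+ 2) + s * (u ^+ 2 - v ^+ 2)) / ((u + s) ^+ 2 + v ^+ 2).

Lemma Re_frac (s : R) z : 0 < s -> 0 <= Re z ->
  Re (z ^+ 2 / (z + s%:C%C)) = refrac s (Re z) (Im z).
Proof.
case: z => u v /= s0 u0.
have D0 : (u + s) ^+ 2 + v ^+ 2 != 0.
  rewrite gt_eqF// (lt_le_trans (_ : 0 < (u + s) ^+ 2))// ?lerDl ?sqr_ge0//.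
  by rewrite exprn_gt0//; lra.
rewrite /refrac expr2 /= addr0; field; exact: D0.
Qed.

Lemma dyadic_bracket (n : nat) (y : R) : 1 <= y < 2 ^+ n ->
  exists2 j, (j < n)%N & 2 ^+ j <= y < 2 ^+ j.+1.
Proof.
elim: n => [|n ih] /andP[y1 yn]; first by rewrite expr0 in yn; lra.
have [h|h] := ltP y (2 ^+ n); last by exists n => //; rewrite h.
have [|j jn hj] := ih; first by rewrite y1.
by exists j => //; rewrite (leq_trans jn).
Qed.

(** The scale 2^(j-N); for j < 2N these scales start dyadic intervals that cover all numbers from
    2^-N up to 2^N. *)
Definition dys (N j : nat) : R := 2 ^+ j / 2 ^+ N.

Lemma dys_gt0 N j : 0 < dys N j.
Proof. by rewrite divr_gt0 ?exprn_gt0. Qed.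

(** The terms of [refrac] that count against the estimate. Those without [x] scale with [u]; the
    mixed term [u * x ^+ 2] scales with [x] and leaves the cross term u x^(p-1). *)
Lemma frac_upper p (s u x : R) : 1 < p < 2 -> 0 < s -> 0 < u -> 0 <= x ->
  s `^ (p - 1) * ((s * u ^+ 2 + u ^+ 3 + u * x ^+ 2) / ((u + s) ^+ 2 + x ^+ 2)) <=
  2 * (u `^ p * dyw p (s / u)) + 2 * (u * x `^ (p - 1) * dyw p (s / x)).
Proof.
move=> /andP[p1 p2] s0 u0 x0.
have D0 : 0 < (u + s) ^+ 2 + x ^+ 2 by rewrite ltr_wpDr ?sqr_ge0// exprn_gt0// addr_gt0.
have us0 : 0 < u + s by rewrite addr_gt0.
have sx0 : 0 < s + x by rewrite ltr_wpDr.
have S0 := powR_ge0 s (p - 1).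
have e1 : u `^ p * dyw p (s / u) = s `^ (p - 1) * (u ^+ 2 / (u + s)).
  rewrite /dyw powRM ?invr_ge0 ?(ltW s0) ?(ltW u0)// -(mulr_powRB1 (ltW u0)); last lra.
  have uu : u `^ (p - 1) * (u^-1) `^ (p - 1) = 1.
    by rewrite -powRM ?invr_ge0 ?(ltW u0)// divff ?gt_eqF// powR1x.
  rewrite (_ : _ * _ = (u `^ (p - 1) * (u^-1) `^ (p - 1)) *
    (u * (s `^ (p - 1) / (1 + s / u)))); last by ring.
  by rewrite uu mul1r; field; rewrite !gt_eqF.
have e2 : u * x `^ (p - 1) * dyw p (s / x) = s `^ (p - 1) * (u * x / (s + x)).
  move: x0; rewrite le_eqVlt => /predU1P[<-|x0].
    by rewrite powR0 ?mulr0 ?mul0r ?mulr0// subr_eq0 gt_eqF.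
  rewrite /dyw powRM ?invr_ge0 ?(ltW s0) ?(ltW x0)//.
  have uu : x `^ (p - 1) * (x^-1) `^ (p - 1) = 1.
    by rewrite -powRM ?invr_ge0 ?(ltW x0)// divff ?gt_eqF// powR1x.
  rewrite (_ : _ * _ = (x `^ (p - 1) * (x^-1) `^ (p - 1)) *
    (u * (s `^ (p - 1) / (1 + s / x)))); last by ring.
  by rewrite uu mul1r; field; rewrite !gt_eqF.
rewrite e1 e2 !(mulrCA 2) -mulrDr ler_wpM2l// !mulrDl.
have b1 : s * u ^+ 2 / ((u + s) ^+ 2 + x ^+ 2) <= u ^+ 2 / (u + s).
  rewrite ler_pdivrMr// mulrAC ler_pdivlMr// -subr_ge0.
  rewrite (_ : _ - _ = u ^+ 2 * (u * (u + s) + x ^+ 2)); last by ring.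
  have h0 := ltW u0; have h1 := ltW us0.
  by rewrite mulr_ge0 ?sqr_ge0// addr_ge0 ?sqr_ge0// mulr_ge0.
have b2 : u ^+ 3 / ((u + s) ^+ 2 + x ^+ 2) <= u ^+ 2 / (u + s).
  rewrite ler_pdivrMr// mulrAC ler_pdivlMr// -subr_ge0.
  rewrite (_ : _ - _ = u ^+ 2 * (s * (u + s) + x ^+ 2)); last by ring.
  have h0 := ltW s0; have h1 := ltW us0.
  by rewrite mulr_ge0 ?sqr_ge0// addr_ge0 ?sqr_ge0// mulr_ge0.
have b3 : u * x ^+ 2 / ((u + s) ^+ 2 + x ^+ 2) <= 2 * (u * x / (s + x)).
  rewrite mulrA ler_pdivrMr// mulrAC ler_pdivlMr// -subr_ge0.
  rewrite (_ : _ - _ = u * x * (2 * (u * (u + s)) + 2 * (u * s) + (s - x) ^+ 2 + s ^+ 2 + s * x)); last by ring.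
  have h0 := ltW u0; have h1 := ltW s0; have h2 := ltW us0.
  by rewrite mulr_ge0 ?mulr_ge0// !addr_ge0 ?sqr_ge0// ?mulr_ge0// mulr_ge0.
rewrite (_ : u ^+ 2 * (1 / (u + s) + 1 / (u + s)) = u ^+ 2 / (u + s) + u ^+ 2 / (u + s)); last by ring.
rewrite (_ : u * x * (1 / (s + x) + 1 / (s + x)) = 2 * (u * x / (s + x))); last by ring.
by rewrite lerD ?lerD.
Qed.

(** The negative part of [refrac] at the one scale comparable to [x]: the denominator is at most
    [5 * x ^+ 2], and s^p is at least x^p / 4 because p < 2; hence the constant 20. *)
Lemma frac_lower p (s u x : R) : 1 < p < 2 -> 0 < s -> 0 <= u < x -> s <= x < 2 * s ->
  x `^ p / 20 <= s `^ (p - 1) * (s * x ^+ 2 / ((u + s) ^+ 2 + x ^+ 2)).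
Proof.
move=> /andP[p1 p2] s0 /andP[u0 ux] /andP[sx xs].
have x0 : 0 < x by lra.
have D0 : 0 < (u + s) ^+ 2 + x ^+ 2 by rewrite addr_gt0 ?exprn_gt0//; lra.
have D5 : (u + s) ^+ 2 + x ^+ 2 <= 5 * x ^+ 2 by nra.
have h1 : 5^-1 <= x ^+ 2 / ((u + s) ^+ 2 + x ^+ 2).
  by rewrite ler_pdivlMr// mulrC ler_pdivrMr// mulrC.
have h2 : x `^ p / 4 <= s `^ p.
  apply: (@le_trans _ _ ((x / 2) `^ p)); last first.
    by apply: ge0_ler_powR; rewrite ?nnegrE//; lra.
  rewrite powRM ?(ltW x0)// ler_wpM2l ?powR_ge0//.
  apply: (@le_trans _ _ ((2^-1) `^ 2%:R)); last first.
    by apply: ger_powR; [rewrite invr_gt0 invf_le1// ltr0n ler1n|exact: ltW].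
  by rewrite powR_mulrn// expr2 -invfM -natrM.
rewrite -[s * x ^+ 2 / _]mulrA mulrA [_ * s]mulrC mulr_powRB1 ?(ltW s0)//; last lra.
have := ler_pM _ _ h2 h1; rewrite divr_ge0 ?powR_ge0// invr_ge0 ler0n => /(_ isT isT).
by apply: le_trans; rewrite le_eqVlt; apply/orP; left; apply/eqP; field.
Qed.

(** Where |v| exceeds [u] and is at least 2^-N, one scale contributes a negative amount comparable
    to |v|^p; the positive parts of all scales add up to a multiple of u^p and a cross term. The
    summand with 2^-N accounts for values below the smallest scale. *)
Lemma pointwise_conjugate_bound p : 1 < p < 2 -> exists A B : R, [/\ 0 <= A, 0 <= B &
  forall N (u v : R), 0 <= u -> `|v| < 2 ^+ N ->
    `|v| `^ p <= A * u `^ p + 2 * (2 ^- N) `^ p -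
      B * \sum_(0 <= j < N.*2) dys N j `^ (p - 1) * refrac (dys N j) u v].
Proof.
move=> p12; have /andP[p1 p2] := p12; have p0 : 0 < p by lra.
have [K K0 hK] := dyw_sum p12.
pose q := p / (p - 1).
have pq : p^-1 + q^-1 = 1 by rewrite /q invf_div; field; rewrite gt_eqF.
have e0 : 0 < (80 * K + 1)^-1 by rewrite invr_gt0; lra.
have [L L0 hL] := young_eps p1 pq e0.
(* The lower bound is doubled, whence 40 = 2 * 20, so that a spare |v|^p can absorb the cross term;
   this also dictates the coefficient with [80 * K + 1] in Young's inequality. *)
exists (2 * (1 + 40 * K + 40 * K * L)), 40; split => //.
  by rewrite mulr_ge0// !addr_ge0// !mulr_ge0.
move=> N u v u0 vN; set x := `|v|.
have x0 : 0 <= x := normr_ge0 v.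
have v2 : v ^+ 2 = x ^+ 2 by rewrite real_normK ?num_real.
have Nn0 : 0 < 2 ^- N :> R by rewrite invr_gt0 exprn_gt0.
pose lo j := dys N j `^ (p - 1) * (dys N j * x ^+ 2 / ((u + dys N j) ^+ 2 + x ^+ 2)).
pose up j := dys N j `^ (p - 1) *
  ((dys N j * u ^+ 2 + u ^+ 3 + u * x ^+ 2) / ((u + dys N j) ^+ 2 + x ^+ 2)).
have Dj j : 0 < (u + dys N j) ^+ 2 + x ^+ 2.
  have := dys_gt0 N j => s0.
  by rewrite ltr_wpDr ?sqr_ge0// exprn_gt0// ltr_wpDl.
have split_ : \sum_(0 <= j < N.*2) dys N j `^ (p - 1) * refrac (dys N j) u v =
    \sum_(0 <= j < N.*2) up j - \sum_(0 <= j < N.*2) lo j.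
  rewrite -sumrB; apply: eq_bigr => j _; rewrite /up /lo /refrac v2 -mulrBr -mulrBl.
  by congr (_ * (_ / _)); ring.
have lo0 j : 0 <= lo j.
  have s0 := dys_gt0 N j.
  by rewrite mulr_ge0 ?powR_ge0// divr_ge0 ?mulr_ge0 ?sqr_ge0 ?(ltW s0) ?(ltW (Dj j)).
have lower : x `^ p - u `^ p - (2 ^- N) `^ p <= 20 * \sum_(0 <= j < N.*2) lo j.
  have S0 : 0 <= 20 * \sum_(0 <= j < N.*2) lo j by rewrite mulr_ge0// sumr_ge0.
  have up0 := powR_ge0 u p; have np0 := powR_ge0 (2 ^- N : R) p.
  have [xu|ux] := leP x u.
    have : x `^ p <= u `^ p by apply: ge0_ler_powR; rewrite ?nnegrE// ltW.
    by move=> h; apply: le_trans S0; rewrite lerBlDr add0r lerBlDl (le_trans h)// lerDl.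
  have [xn|nx] := ltP x (2 ^- N).
    have h : x `^ p <= (2 ^- N) `^ p by apply: ge0_ler_powR; rewrite ?nnegrE// ltW.
    by apply: le_trans S0; rewrite lerBlDr add0r lerBlDl (le_trans h)// lerDr.
  have [|j jN /andP[hj1 hj2]] := @dyadic_bracket N.*2 (x * 2 ^+ N).
    rewrite -addnn exprD ltr_pM2r ?exprn_gt0// vN andbT.
    by rewrite -ler_pdivrMr ?exprn_gt0// mul1r.
  have := @frac_lower p (dys N j) u x p12 (dys_gt0 N j).
  have b1 : dys N j <= x by rewrite /dys ler_pdivrMr ?exprn_gt0.
  have b2 : x < 2 * dys N j by rewrite /dys mulrA -exprS ltr_pdivlMr ?exprn_gt0.
  rewrite u0 ux b1 b2 => /(_ isT isT) hh.
  have : lo j <= \sum_(0 <= i < N.*2) lo i.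
    rewrite big_mkord (bigD1 (Ordinal jN))//= lerDl sumr_ge0//.
  move=> h3.
  have := le_trans hh h3; rewrite ler_pdivrMr// [leRHS]mulrC => h4.
  by apply: le_trans h4; rewrite -addrA gerDl -opprD oppr_le0 addr_ge0.
have upper : \sum_(0 <= j < N.*2) up j <= 2 * K * u `^ p + 2 * K * (u * x `^ (p - 1)).
  have R0 : 0 <= 2 * K * u `^ p + 2 * K * (u * x `^ (p - 1)).
    by rewrite addr_ge0// !mulr_ge0 ?powR_ge0.
  move: u0; rewrite le_eqVlt => /predU1P[u0|u0].
    rewrite big1// => j _.
    by rewrite /up -u0 !expr0n /= !mulr0 mul0r !add0r mul0r mulr0.
  have hs j (y : R) : 0 < y -> dys N j / y = 2 ^+ j * (2 ^+ N * y)^-1.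
    by move=> y0; rewrite /dys invfM mulrA.
  have hK' (y : R) : 0 < y -> \sum_(0 <= j < N.*2) dyw p (dys N j / y) <= K.
    move=> y0; rewrite (eq_bigr _ (fun j _ => congr1 (dyw p) (hs j y y0))).
    by apply: hK; rewrite invr_gt0 mulr_gt0// exprn_gt0.
  apply: (@le_trans _ _ (\sum_(0 <= j < N.*2)
      (2 * (u `^ p * dyw p (dys N j / u)) + 2 * (u * x `^ (p - 1) * dyw p (dys N j / x))))).
    by apply: ler_sum => j _; apply: frac_upper => //; exact: dys_gt0.
  rewrite big_split/= -!mulr_sumr -!mulrA lerD// ler_pM2l//.
    by rewrite [leRHS]mulrC ler_wpM2l ?powR_ge0// hK'.
  rewrite [leRHS]mulrC -mulrA ler_wpM2l ?(ltW u0)//.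
  move: x0; rewrite le_eqVlt => /predU1P[<-|x0].
    by rewrite powR0 ?mul0r// subr_eq0 gt_eqF.
  by rewrite ler_wpM2l ?powR_ge0// hK'.
have yg := hL u (x `^ (p - 1)) u0 (powR_ge0 _ _).
have e1 : (x `^ (p - 1)) `^ q = x `^ p.
  by rewrite -powRrM /q mulrCA divff ?mulr1// subr_eq0 gt_eqF.
rewrite split_ {split_}; move: lower upper yg; rewrite e1.
set U := \sum_(0 <= j < _) up j; set W := \sum_(0 <= j < _) lo j.
set X := x `^ p; set Y := u `^ p; set Z := u * _; set E := _ `^ p => lower upper yg.
have X0 : 0 <= X := powR_ge0 _ _.
have KX : 40 * K * ((80 * K + 1)^-1 * X) <= X / 2.
  rewrite mulrA [leRHS]mulrC ler_wpM2r// ler_pdivrMr; lra.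
have KZ : 40 * K * Z <= 40 * K * (L * Y) + 40 * K * ((80 * K + 1)^-1 * X).
  by rewrite -mulrDr ler_wpM2l// mulr_ge0.
by nra.
Qed.

End PointwiseBound.

(** * The Riesz projection *)

Section AnalyticParts.
Variable R : realType.
Local Notation C := (R[i]).
Local Notation mu := (@lebesgue_measure R).
Local Notation Re := (@complex.Re R).
Local Notation Im := (@complex.Im R).
Implicit Types (f g h : C -> C) (z w t : C) (p q : R).

Lemma conj_exp_gt1 p q : 1 < p -> p^-1 + q^-1 = 1 -> 1 < q.
Proof.
move=> p1 pq; have p0 : 0 < p by lra.
have : 0 < p^-1 by rewrite invr_gt0.
have : p^-1 < 1 by rewrite invf_lt1.
move=> a b; have q0 : 0 < q^-1 by lra.
by rewrite -[q]invrK invf_gt1//; lra.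
Qed.

(** Otherwise [annihilator] yields a nonzero [k] in L^q that is orthogonal to every [t ^ n], against
    the uniqueness of Fourier coefficients. *)
Lemma trig_dense p f (e : R) : 1 < p -> inLp p f -> 0 < e ->
  exists2 g, trig g & npow p (fun t => f t - g t) < e.
Proof.
move=> p1 fp e0; have p0 : 0 <= p by lra.
pose q := p / (p - 1).
have pq : p^-1 + q^-1 = 1 by rewrite /q invf_div; field; rewrite gt_eqF//; lra.
apply: contrapT => nex.
have far g : trig g -> e <= npow p (fun t => f t - g t).
  by move=> tg; rewrite leNgt; apply/negP => h; apply: nex; exists g.
have [k [kq k0 kf]] := annihilator p1 pq (fun m => @trig_Lp R p m p0) (trig_cst 0)
  (@trigD R) (fun z m => trigM (trig_cst z)) fp e0 far.
have k1 : inLp 1 k by apply: Lp1_Lp kq; exact/ltW/(conj_exp_gt1 p1 pq).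
have kz : aeT_eq k (fun=> 0).
  by apply: fourier_uniqueness => // n; rewrite fourierE; apply: k0; exact: trig_expz.
move/eqP: kf; apply.
rewrite (@cmean_ae R (fun t => k t * f t) (fun=> 0)) ?cmean_cst//.
  by apply: measM; [exact: Lp_meas kq|exact: Lp_meas fp].
by apply: (aeTS (P := fun t => k t = 0) (Q := fun t => k t * f t = 0) _ kz) => t _ ->; rewrite mul0r.
Qed.

Lemma cmean_expz_poly (k : int) (P : {poly C}) :
  cmean (fun t => t ^ k * P.[t]) = (k <= 0)%R%:R * P`_(absz k).
Proof.
rewrite (_ : cmean _ = cmean (fun t => 1 * (t ^ k * P.[t]))); last first.
  by apply: eq_cmean => t _; rewrite mul1r.
rewrite cmean_mul_poly; last exact: Lp_cst.
have h (i : nat) : cmean (fun t => 1 * t ^ (k + i%:Z)) = (k + i%:Z == 0)%R%:R.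
  by rewrite -cmean_expz; apply: eq_cmean => t _; rewrite mul1r.
under eq_bigr do rewrite h.
have [k0|k0] := leP k 0; last first.
  rewrite mul0r big1// => i _; rewrite gt_eqF ?mulr0//.
  by apply: (lt_le_trans k0); rewrite lerDl.
have kE : k = - (`|k|%N)%:Z by rewrite abszE ler0_norm// opprK.
rewrite mul1r; set n := `|k|%N in kE *; rewrite kE.
have [nP|nP] := ltnP n (size P).
  rewrite (bigD1 (Ordinal nP))//= addNr eqxx mulr1 big1 ?addr0// => i /negPf ni.
  rewrite addrC subr_eq0 eqz_nat; move: ni; rewrite -val_eqE /= => ->.
  by rewrite mulr0.
rewrite nth_default// big1// => i _.
by rewrite addrC subr_eq0 eqz_nat ltn_eqF ?mulr0// (leq_trans (ltn_ord i)).
Qed.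

Lemma fourier_poly (P : {poly C}) (m : int) :
  fourier (fun t => P.[t]) m = (0 <= m)%R%:R * P`_(absz m).
Proof.
rewrite fourierE -(abszN m) -oppr_le0 -cmean_expz_poly.
by apply: eq_cmean => t _; rewrite mulrC.
Qed.

Lemma cmean_poly (P : {poly C}) : cmean (fun t => P.[t]) = P.[0].
Proof.
rewrite horner_coef0 -[P`_0]mul1r -(cmean_expz_poly 0).
by apply: eq_cmean => t _; rewrite expr0z mul1r.
Qed.

Lemma fourierD f g (n : int) : inLp 1 f -> inLp 1 g ->
  fourier (fun t => f t + g t) n = fourier f n + fourier g n.
Proof.
move=> f1 g1; rewrite !fourierE -cmeanD; try exact: Lp1_mulz.
by apply: eq_cmean => t _; rewrite mulrDl.
Qed.

Lemma fourierZ z f (n : int) : inLp 1 f ->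
  fourier (fun t => z * f t) n = z * fourier f n.
Proof.
move=> f1; rewrite !fourierE -cmeanZ; last exact: Lp1_mulz.
by apply: eq_cmean => t _; rewrite mulrA.
Qed.

Lemma fourierB f g (n : int) : inLp 1 f -> inLp 1 g ->
  fourier (fun t => f t - g t) n = fourier f n - fourier g n.
Proof.
move=> f1 g1; rewrite !fourierE -cmeanB; try exact: Lp1_mulz.
by apply: eq_cmean => t _; rewrite mulrBl.
Qed.

Lemma fourierJ f (n : int) : inLp 1 f ->
  fourier (fun t => conjc (f t)) n = conjc (fourier f (- n)).
Proof.
move=> f1; rewrite !fourierE -cmeanJ; last exact: Lp1_mulz.
apply: eq_cmean => t t1; rewrite rmorphM /= opprK; congr (_ * _).
by rewrite conj_circ ?cmod_expz// invr_expz.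
Qed.

(** The index is a [nat]: only the nonnegative coefficients are compared, so [P] is the Riesz
    projection of [f]. *)
Definition analytic_part f (P : {poly C}) := forall n : nat, fourier f n = P`_n.

Lemma trig_analytic_part f : trig f -> exists P, analytic_part f P.
Proof.
move=> [n [P fP]]; exists (drop_poly n P) => m.
rewrite coef_drop_poly fourierE.
rewrite (_ : cmean _ = cmean (fun t => t ^ (- (m + n)%N%:Z) * P.[t])).
  by rewrite cmean_expz_poly oppr_le0 /= mul1r abszN.
apply: eq_cmean => t t1; rewrite fP// PoszD opprD expfzDr ?circ_neq0//.
by rewrite -[t ^ (- n%:Z)]exprnN mulrC mulrA.
Qed.

Lemma analytic_partD f g (P Q : {poly C}) : inLp 1 f -> inLp 1 g -> analytic_part f P ->
  analytic_part g Q -> analytic_part (fun t => f t + g t) (P + Q).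
Proof. by move=> f1 g1 fP gQ n; rewrite fourierD// fP gQ coefD. Qed.

Lemma analytic_partZ z f (P : {poly C}) : inLp 1 f -> analytic_part f P ->
  analytic_part (fun t => z * f t) (z *: P).
Proof. by move=> f1 fP n; rewrite fourierZ// fP coefZ. Qed.

Lemma analytic_partB f g (P Q : {poly C}) : inLp 1 f -> inLp 1 g -> analytic_part f P ->
  analytic_part g Q -> analytic_part (fun t => f t - g t) (P - Q).
Proof. by move=> f1 g1 fP gQ n; rewrite fourierB// fP gQ coefB. Qed.

Lemma cmean_conj_poly f (P : {poly C}) : inLp 1 f -> (forall n : nat, fourier f n = 0) ->
  cmean (fun t => f t * conjc P.[t]) = 0.
Proof.
move=> f1 f0; have fp1 : inLp 1 (fun t => f t * conjc P.[t]).
  by apply: LpMtrig => //; apply: trigJ; exact: trig_poly.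
rewrite -[LHS]conjcK -cmeanJ//.
have fJ : inLp 1 (fun t => conjc (f t)) by apply: LpJ.
rewrite (_ : cmean _ = cmean (fun t => conjc (f t) * (t ^ 0 * P.[t]))); last first.
  by apply: eq_cmean => t _; rewrite rmorphM /= conjcK expr0z mul1r.
rewrite cmean_mul_poly// big1 ?conjc0// => i _.
have := fourierJ (- i%:Z) f1; rewrite opprK f0 fourierE opprK add0r conjc0 => ->.
by rewrite mulr0.
Qed.

Lemma analytic_part_ortho f (P Q : {poly C}) : inLp 1 f -> analytic_part f P ->
  cmean (fun t => (f t - P.[t]) * conjc Q.[t]) = 0.
Proof.
move=> f1 fP; have P1 : inLp 1 (fun t => P.[t]) by apply: trig_Lp => //; exact: trig_poly.
apply: cmean_conj_poly; first by apply: LpB.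
by move=> n; rewrite fourierB// fP fourier_poly/= mul1r subrr.
Qed.

Lemma dualc2 z : dualc 2 z = conjc z.
Proof. by rewrite /dualc subrr powRr0 mul1r. Qed.

Lemma npow_tangent p q f g : 1 < p -> p^-1 + q^-1 = 1 -> inLp p f -> inLp p g ->
  npow p g + p * (2 * pi * Re (cmean (fun t => (f t - g t) * dualc p (g t)))) <= npow p f.
Proof.
move=> p1 pq fp gp; have p0 : 0 <= p by lra.
have dq := Lp_dualc p1 pq gp.
have i1 : inLp 1 (fun t => (f t - g t) * dualc p (g t)).
  by apply: (Lp1_mul p1 pq) => //; exact: LpB.
rewrite Re_cmean mulVKf; last by rewrite mulf_neq0// gt_eqF// pi_gt0.
rewrite !npowE -RintegralZl//; last exact: Lp1_Re i1.
have ig := npow_integrable gp.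
have iz : mu.-integrable (@circ R)
    (EFin \o (fun x => p * Re ((f (eit x) - g (eit x)) * dualc p (g (eit x))))).
  exact: (@integrableZl _ _ R mu (@circ R) (@measurable_circ R) p _ (Lp1_Re i1)).
rewrite -RintegralD//.
apply: le_Rintegral; [exact: measurable_circ| |exact: npow_integrable|].
  exact: (@integrableD _ _ R mu (@circ R) (@measurable_circ R) _ _ ig iz).
by move=> x _; rewrite [_ * dualc _ _]mulrC; exact: dualc_tangent.
Qed.

Lemma conj_exp2 : (2^-1 + 2^-1 : R) = 1. Proof. by field. Qed.

(** The tangent inequality for p = 2 based at [P]: its linear term pairs [f - P] with the conjugate
    of [P], to which it is orthogonal. *)
Lemma analytic_part_L2 f (P : {poly C}) : inLp 2 f -> analytic_part f P ->
  npow 2 (fun t => P.[t]) <= npow 2 f.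
Proof.
move=> f2 fP; have f1 : inLp 1 f by apply: Lp1_Lp f2; rewrite ler1n.
have P2 : inLp 2 (fun t => P.[t]) by apply: trig_Lp => //; exact: trig_poly.
have := npow_tangent (ltr1n R 2) conj_exp2 f2 P2.
rewrite (_ : cmean _ = cmean (fun t => (f t - P.[t]) * conjc P.[t])).
  by have -> := analytic_part_ortho P f1 fP; rewrite [Re 0]/(0 : R) !mulr0 addr0.
by apply: eq_cmean => t _; rewrite dualc2.
Qed.

Lemma npow_cst p z : npow p (fun=> z) = cmod z `^ p * (2 * pi).
Proof. by rewrite /npow pint_cst. Qed.

(** Jensen's inequality, as the tangent inequality based at the constant [cmean f], where the linear
    term averages to 0. *)
Lemma npow_cmean p f : 1 < p -> inLp p f -> npow p (fun=> cmean f) <= npow p f.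
Proof.
move=> p1 fp; pose q := p / (p - 1).
have pq : p^-1 + q^-1 = 1 by rewrite /q invf_div; field; rewrite gt_eqF//; lra.
have f1 : inLp 1 f by apply: Lp1_Lp fp; exact: ltW.
have := npow_tangent p1 pq fp (Lp_cst p (cmean f)).
rewrite cmeanZr; last by apply: LpB => //; exact: Lp_cst.
by rewrite cmeanB ?cmean_cst ?subrr ?mul0r ?mulr0 ?addr0//; exact: Lp_cst.
Qed.

(* Writing Q = c + X Q1, on the circle |Q|^2 = |c|^2 + |Q1|^2 + 2 Re (conj c t Q1). *)
Lemma herglotz_poly (Q : {poly C}) : exists2 F : {poly C},
  (exists2 c : R, 0 <= c & F.[0] = c%:C%C) &
  forall t, cmod t = 1 -> Re F.[t] = cmod Q.[t] ^+ 2.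
Proof.
elim/poly_ind: Q => [|Q1 c [F1 [c1 c10 F10] F1t]].
  exists 0; first by exists 0; rewrite ?hornerC.
  by move=> t _; rewrite !hornerC cmod0 expr0n.
exists ((cmod c ^+ 2)%:C%C%:P + F1 + (2 * conjc c) *: ('X * Q1)).
  exists (cmod c ^+ 2 + c1); first by rewrite addr_ge0// sqr_ge0.
  by rewrite hornerD hornerD hornerC F10 hornerZ hornerM hornerX mul0r mulr0 addr0 rmorphD.
move=> t t1; rewrite !hornerE !cReD F1t//.
have -> : cmod (Q1.[t] * t + c) ^+ 2 =
    cmod c ^+ 2 + cmod (Q1.[t] * t) ^+ 2 + 2 * Re (conjc c * (t * Q1.[t])).
  rewrite !cmod_sqr; case: c t Q1.[t] {t1 F1t F10} => [c d] [x y] [u v] /=; ring.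
rewrite cmodM t1 mulr1; congr (_ + _).
rewrite [X in Re X = _](_ : _ = 2 * (conjc c * (t * Q1.[t]))); last by rewrite /= !mulrA.
by rewrite cReM /= addr0 mul0r subr0.
Qed.

(** The part of the half-plane Re z >= s inside the disc of radius [M] lies in a disc about
    [M ^+ 2 / s] that misses 0. This makes the geometric series for [z^-1] converge. *)
Lemma cmod_sub_frac (z : C) (s M : R) : 0 < s -> s <= Re z -> cmod z <= M ->
  cmod (1 - z / (M ^+ 2 / s)%:C%C) <= Num.sqrt (1 - (s / M) ^+ 2).
Proof.
move=> s0 sz zM; have M0 : 0 < M.
  by apply: lt_le_trans zM; apply: lt_le_trans (ler_Re_cmod z); rewrite gtr0_norm; lra.
rewrite -[leLHS]ger0_norm ?cmod_ge0// -sqrtr_sqr ler_wsqrtr// cmod_sqr.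
have zz : Re z ^+ 2 + Im z ^+ 2 <= M ^+ 2.
  by rewrite -cmod_sqr ler_sqr ?nnegrE ?cmod_ge0 ?(ltW M0).
have -> : z / (M ^+ 2 / s)%:C%C = (s / M ^+ 2)%:C%C * z.
  by rewrite -rmorphV /= ?invf_div 1?mulrC// unitfE mulf_neq0// ?invr_eq0 ?gt_eqF// exprn_gt0.
set k := s / M ^+ 2.
have k0 : 0 < k by rewrite divr_gt0// exprn_gt0.
have -> : (s / M) ^+ 2 = k * s by rewrite /k; field; rewrite gt_eqF.
have kM : k * M ^+ 2 = s by rewrite /k; field; rewrite gt_eqF.
case: z sz zz {zM} => u v /= sz zz.
rewrite !mul0r !(subr0, addr0) add0r.
have : k ^+ 2 * (u ^+ 2 + v ^+ 2) <= k * s.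
  by rewrite expr2 -mulrA ler_pM2l// (le_trans (ler_wpM2l (ltW k0) zz))// kM.
have : k * s <= k * u by rewrite ler_pM2l.
nra.
Qed.

Lemma cvg_geometric_lt (r c e : R) : 0 <= r < 1 -> 0 <= c -> 0 < e ->
  exists n : nat, c * r ^+ n <= e.
Proof.
move=> /andP[r0 r1] c0 e0.
have h : `|r| < 1 by rewrite ger0_norm.
have /cvgrPdist_le /(_ (e / (c + 1))) := cvg_expr h.
case; first by rewrite divr_gt0// ltr_wpDl.
move=> n _ /(_ n (leqnn n)); rewrite sub0r normrN normrX (ger0_norm r0) => H.
exists n; apply: (le_trans (ler_wpM2l c0 H)).
rewrite mulrCA ler_piMr ?(ltW e0)// ler_pdivrMr ?ltr_wpDl// mul1r; lra.
Qed.

Lemma meas_inv f : meas_on_T f -> meas_on_T (fun t => (f t)^-1).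
Proof.
move=> mf; apply: (@meas_eq R (fun t => (cmod (f t) `^ (-2))%:C%C * conjc (f t))).
  move=> x; set z := f (eit x).
  have [->|z0] := eqVneq z 0; first by rewrite conjc0 mulr0 invr0.
  have c0 : cmod z != 0 by rewrite cmod_eq0.
  rewrite powRN powR_mulrn ?cmod_ge0//; apply: (mulIf z0).
  rewrite mulVf// -mulrA [conjc z * z]mulrC mulc_conj -rmorphM /= mulVf//.
  by rewrite expf_neq0.
apply: measM; last exact: measJ.
by apply: meas_real; apply/measurable_EFinP; exact: meas_cmodX.
Qed.

Lemma Re_le_cmod_inv (s : R) z : 0 < s -> s <= Re z -> cmod z^-1 <= s^-1.
Proof.
move=> s0 sz; have h : s <= cmod z.
  by apply: le_trans (ler_Re_cmod z); rewrite ger0_norm//; lra.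
by rewrite cmodV lef_pV2// posrE; lra.
Qed.

(** Polynomials have the mean value property, and the geometric series in [1 - G / k] approximates
    the inverse of [G] by polynomials, uniformly on the circle and at 0 with the same ratio. Each of
    the two places has its own lower bound on the real part. *)
Lemma cmean_inv_poly (G : {poly C}) (s : R) : 0 < s -> s <= Re G.[0] ->
  (forall t, cmod t = 1 -> s <= Re G.[t]) -> cmean (fun t => G.[t]^-1) = G.[0]^-1.
Proof.
move=> s0 G0 Gt; have [M0 GM0] := horner_bdd G.
pose M := Num.max M0 (cmod G.[0]).
have GM t : cmod t = 1 -> cmod G.[t] <= M by move=> t1; rewrite le_max GM0.
have G0M : cmod G.[0] <= M by rewrite le_max lexx orbT.
have M00 : 0 < M.
  by apply: lt_le_trans G0M; apply: lt_le_trans (ler_Re_cmod _); rewrite gtr0_norm; lra.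
pose k : C := (M ^+ 2 / s)%:C%C.
have k0 : k != 0.
  by rewrite fmorph_eq0 gt_eqF// divr_gt0// exprn_gt0.
pose r := Num.sqrt (1 - (s / M) ^+ 2).
have r01 : 0 <= r < 1.
  rewrite sqrtr_ge0 /= -[ltRHS]sqrtr1 ltr_sqrt// gtrDl oppr_lt0 exprn_gt0// divr_gt0//.
have [W WE] : exists W : {poly C}, forall t, W.[t] = 1 - G.[t] / k.
  by exists (1 - k^-1 *: G) => t; rewrite !hornerE mulrC.
have nz t : s <= Re G.[t] -> G.[t] != 0.
  by move=> h; apply/eqP => e; rewrite e /= in h; lra.
have key n t : s <= Re G.[t] ->
    G.[t]^-1 = (k^-1 *: \sum_(i < n) W ^+ i).[t] + W.[t] ^+ n / G.[t].
  move=> h; have := nz _ h => g0; apply: (mulIf g0); rewrite mulVf// mulrDl mulfVK//.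
  have := subrX1 W n => /(congr1 (fun P : {poly C} => P.[t])).
  rewrite hornerM !hornerD !hornerN !horner_exp hornerC WE => e.
  have -> : (1 - G.[t] / k) ^+ n = 1 - (G.[t] / k) * (\sum_(i < n) W ^+ i).[t].
    by apply/eqP; rewrite -subr_eq0 opprB addrA addrAC e; apply/eqP; ring.
  by rewrite hornerZ; ring.
apply/eqP; rewrite -subr_eq0; apply/eqP; apply: cmod_small0 => e e0.
have s10 : 0 <= s^-1 by rewrite invr_ge0 ltW.
have [|n hn] := @cvg_geometric_lt r (s^-1 * (2 * pi) + s^-1) e r01 _ e0.
  by rewrite addr_ge0// mulr_ge0// mulr_ge0// ltW// pi_gt0.
have bnd t : s <= Re G.[t] -> cmod G.[t] <= M -> cmod (W.[t] ^+ n / G.[t]) <= r ^+ n * s^-1.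
  move=> h1 h2; rewrite cmodM cmodX ler_pM ?cmod_ge0 ?exprn_ge0 ?cmod_ge0//.
    apply: lerXn2r; rewrite ?nnegrE ?cmod_ge0 ?sqrtr_ge0// WE.
    exact: cmod_sub_frac.
  exact: Re_le_cmod_inv h1.
have mW : meas_on_T (fun t => W.[t] ^+ n / G.[t]).
  by apply: measM; [apply: measX; exact: meas_horner|apply: meas_inv; exact: meas_horner].
have LW : inLp 1 (fun t => W.[t] ^+ n / G.[t]).
  apply: (@Lp_bdd R _ _ (r ^+ n * s^-1)) => //.
  by apply: aeTW => t t1; apply: bnd; [exact: Gt|exact: GM].
have -> : cmean (fun t => G.[t]^-1) - G.[0]^-1 =
    cmean (fun t => W.[t] ^+ n / G.[t]) - W.[0] ^+ n / G.[0].
  rewrite (_ : cmean _ = cmean (fun t => (k^-1 *: \sum_(i < n) W ^+ i).[t] + W.[t] ^+ n / G.[t])).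
    rewrite cmeanD//; last by apply: trig_Lp => //; exact: trig_poly.
    by rewrite cmean_poly {1}(key n 0 G0) opprD addrACA subrr add0r.
  by apply: eq_cmean => t t1; apply: key; exact: Gt.
apply: (le_trans (cmodB _ _)); apply: le_trans hn; rewrite mulrDl lerD//.
  apply: (le_trans (cmean_le LW)).
  rewrite -/(npow 1 _).
  apply: (@le_trans _ _ (1 * npow 1 (fun=> (r ^+ n * s^-1)%:C%C))).
    apply: npow_le1 => //; first exact: Lp_cst.
    apply: aeTW => t t1; rewrite !powRr1 ?cmod_ge0// mul1r cmod_real ger0_norm.
      by apply: bnd; [exact: Gt|exact: GM].
    by rewrite mulr_ge0// exprn_ge0// sqrtr_ge0.
  rewrite mul1r npow_cst powRr1 ?cmod_ge0// cmod_real ger0_norm; last first.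
    by rewrite mulr_ge0// exprn_ge0// sqrtr_ge0.
  by rewrite le_eqVlt; apply/orP; left; apply/eqP; ring.
by rewrite [leRHS]mulrC; apply: bnd.
Qed.

End AnalyticParts.

(** * Conjugate functions of squared moduli of polynomials *)

Section ConjugateFunctions.
Variable R : realType.
Local Notation C := (R[i]).
Local Notation mu := (@lebesgue_measure R).
Local Notation Re := (@complex.Re R).
Local Notation Im := (@complex.Im R).
Implicit Types (f g h : C -> C) (z w t : C) (p q : R).

Lemma Re_frac_mean (F : {poly C}) (c0 s : R) : 0 < s -> 0 <= c0 -> F.[0] = c0%:C%C ->
  (forall t, cmod t = 1 -> 0 <= Re F.[t]) ->
  mu.-integrable (@circ R) (EFin \o (fun x => refrac s (Re F.[eit x]) (Im F.[eit x]))) /\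
  0 <= Rintegral mu (@circ R) (fun x => refrac s (Re F.[eit x]) (Im F.[eit x])).
Proof.
move=> s0 c00 F0 Ft; pose sc := s%:C%C; pose G := F + sc%:P.
have GE t : G.[t] = F.[t] + sc by rewrite hornerD hornerC.
have Gt t : cmod t = 1 -> s <= Re G.[t] by move=> t1; rewrite GE cReD lerDr Ft.
have G0 : s <= Re G.[0] by rewrite GE F0 lerDr.
have Gnz t : cmod t = 1 -> G.[t] != 0.
  by move=> t1; apply/eqP => e; have := Gt _ t1; rewrite e /=; lra.
have LG : inLp 1 (fun t => G.[t]^-1).
  apply: (@Lp_bdd R _ _ s^-1) => //; first by apply: meas_inv; exact: meas_horner.
  by apply: aeTW => t t1; apply: Re_le_cmod_inv s0 _; exact: Gt.
have LF : inLp 1 (fun t => (F - sc%:P).[t]) by apply: trig_Lp => //; exact: trig_poly.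
(* Division with remainder leaves a polynomial and a multiple of the inverse of [G], both of known
   mean. *)
have eqF t : cmod t = 1 -> F.[t] ^+ 2 / G.[t] = (F - sc%:P).[t] + sc ^+ 2 * G.[t]^-1.
  move=> t1; apply: (mulIf (Gnz _ t1)); rewrite mulfVK ?Gnz// mulrDl mulfVK ?Gnz//.
  by rewrite GE hornerD hornerN hornerC; ring.
have reE x : Re (F.[eit x] ^+ 2 / G.[eit x]) = refrac s (Re F.[eit x]) (Im F.[eit x]).
  by rewrite GE Re_frac// Ft// cmod_eit.
have LFG : inLp 1 (fun t => F.[t] ^+ 2 / G.[t]).
  apply: (@inLp_eq R 1 (fun t => (F - sc%:P).[t] + sc ^+ 2 * G.[t]^-1)) => //.
    by move=> t t1; rewrite eqF.
  by apply: LpD => //; apply: LpZ.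
split.
  have := Lp1_Re LFG; congr (mu.-integrable _ _); apply/funext => x /=.
  by rewrite -reE.
have m : cmean (fun t => F.[t] ^+ 2 / G.[t]) = (c0 ^+ 2 / (c0 + s))%:C%C.
  rewrite (eq_cmean eqF) cmeanD//; last by apply: LpZ.
  rewrite cmeanZ// cmean_poly (cmean_inv_poly s0 G0 Gt) GE F0 hornerD hornerN hornerC F0.
  rewrite /sc -rmorphD -rmorphB -rmorphXn -fmorphV -rmorphM -rmorphD /=; congr (_%:C%C).
  by field; rewrite gt_eqF//; lra.
have /(congr1 (fun z : C => Re z)) := m; rewrite Re_cmean /= => h.
have pi0 : 0 < 2 * pi :> R by rewrite mulr_gt0// pi_gt0.
have -> : Rintegral mu (@circ R) (fun x => refrac s (Re F.[eit x]) (Im F.[eit x])) =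
    2 * pi * (c0 ^+ 2 / (c0 + s)).
  by rewrite -h mulVKf ?gt_eqF//; apply: eq_Rintegral => x _; rewrite reE.
by rewrite mulr_ge0 ?(ltW pi0)// divr_ge0 ?sqr_ge0 ?addr_ge0// ltW.
Qed.

Lemma integrable_sum_ge0 (f_ : nat -> R -> R) (c : nat -> R) (n : nat) :
  (forall j, 0 <= c j) ->
  (forall j, mu.-integrable (@circ R) (EFin \o f_ j) /\ 0 <= Rintegral mu (@circ R) (f_ j)) ->
  mu.-integrable (@circ R) (EFin \o (fun x => \sum_(0 <= j < n) c j * f_ j x)) /\
  0 <= Rintegral mu (@circ R) (fun x => \sum_(0 <= j < n) c j * f_ j x).
Proof.
move=> c0 hf; have mC := @measurable_circ R.
elim: n => [|n [ii pp]].
  under [X in EFin \o X]eq_fun do rewrite big_geq//.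
  under [X in Rintegral _ _ X]eq_fun do rewrite big_geq//.
  split; last by rewrite Rintegral_cst// mul0r.
  exact: (@integrable0 _ _ R mu (@circ R)).
under [X in EFin \o X]eq_fun do rewrite big_nat_recr//=.
under [X in Rintegral _ _ X]eq_fun do rewrite big_nat_recr//=.
have [i1 p1] := hf n.
have iz : mu.-integrable (@circ R) (EFin \o (fun x => c n * f_ n x)).
  exact: (@integrableZl _ _ R mu (@circ R) mC (c n) _ i1).
split; first exact: (@integrableD _ _ R mu (@circ R) mC _ _ ii iz).
by rewrite RintegralD// addr_ge0// RintegralZl// mulr_ge0.
Qed.

(** In the integrated pointwise bound the sum over scales enters with a favourable sign, by
    [Re_frac_mean], and is dropped. *)
Lemma npow_conjugate p : 1 < p < 2 -> exists2 A : R, 0 <= A &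
  forall (F Q : {poly C}) (c0 : R), 0 <= c0 -> F.[0] = c0%:C%C ->
  (forall t, cmod t = 1 -> Re F.[t] = cmod Q.[t] ^+ 2) ->
  npow p (fun t => (Im F.[t])%:C%C) <= A * npow p (fun t => (cmod Q.[t] ^+ 2)%:C%C).
Proof.
move=> p12; have /andP[p1 p2] := p12; have p0 : 0 <= p by lra.
have [A [B [A0 B0 hAB]]] := pointwise_conjugate_bound p12.
exists A => // F Q c0 c00 F0 FQ.
have Ft t : cmod t = 1 -> 0 <= Re F.[t] by move=> t1; rewrite FQ// sqr_ge0.
have [M FM] := horner_bdd F.
have LQ : inLp p (fun t => (cmod Q.[t] ^+ 2)%:C%C).
  apply: (@inLp_eq R p (fun t => Q.[t] * conjc Q.[t])) => //.
    by move=> t _; rewrite mulc_conj.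
  by apply: trig_Lp => //; apply: trigM; [exact: trig_poly|apply: trigJ; exact: trig_poly].
have LI : inLp p (fun t => (Im F.[t])%:C%C).
  apply: (@Lp_bdd R _ _ M) => //.
    by apply: meas_real; case: (meas_horner F).
  apply: aeTW => t t1; rewrite cmod_real; apply: le_trans (FM _ t1); exact: ler_Im_cmod.
apply/ler_addgt0Pr => e e0.
have pi0 : 0 < 2 * pi :> R by rewrite mulr_gt0// pi_gt0.
(* [2 ^+ N] must exceed |Im F| on the circle for the pointwise bound to apply, and the integrated
   error of the smallest scale must not exceed [e]. *)
have [N [hN1 hN2]] : exists N : nat, M < 2 ^+ N /\ (2 ^- N) `^ p * (2 * (2 * pi)) <= e.
  pose X := Num.max M (2 * (2 * pi) / e).
  pose N := (Num.truncn X).+1; exists N.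
  have h : X < 2 ^+ N.
    apply: (lt_trans (truncnS_gt X)); rewrite -natrX ltr_nat; exact: ltn_expl.
  split; first by apply: le_lt_trans h; rewrite le_max lexx.
  have Np : 0 < 2 ^+ N :> R by rewrite exprn_gt0.
  apply: (@le_trans _ _ (2 ^- N * (2 * (2 * pi)))).
    rewrite ler_wpM2r ?mulr_ge0 ?pi_ge0//.
    apply: (@le_trans _ _ ((2 ^- N) `^ 1)); last by rewrite powRr1 ?invr_ge0 ?(ltW Np).
    apply: (ger_powR _ (ltW p1)); rewrite invr_gt0 Np/= invf_le1//.
    by apply: exprn_ege1; rewrite ler1n.
  rewrite ler_pdivrMl// -ler_pdivrMr//.
  by apply: le_trans (ltW h); rewrite le_max lexx orbT.
have ptw x : `|Im F.[eit x]| `^ p <= A * Re F.[eit x] `^ p + 2 * (2 ^- N) `^ p -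
    B * \sum_(0 <= j < N.*2) dys R N j `^ (p - 1) * refrac (dys R N j) (Re F.[eit x]) (Im F.[eit x]).
  apply: hAB; first by rewrite Ft ?cmod_eit.
  by apply: le_lt_trans hN1; apply: le_trans (FM (eit x) (cmod_eit x)); exact: ler_Im_cmod.
have [iH pH] := @integrable_sum_ge0
  (fun j x => refrac (dys R N j) (Re F.[eit x]) (Im F.[eit x])) (fun j => dys R N j `^ (p - 1))
  N.*2 (fun j => powR_ge0 _ _) (fun j => Re_frac_mean (dys_gt0 R N j) c00 F0 Ft).
move: iH pH ptw; set H := fun x => \sum_(0 <= j < N.*2) _ => iH pH ptw.
have mC := @measurable_circ R.
pose cN : C := (2 ^- N)%:C%C.
have Lc : inLp p (fun=> cN) by exact: Lp_cst.
have iI := npow_integrable LI; have iQ := npow_integrable LQ; have ic := npow_integrable Lc.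
have iBH : mu.-integrable (@circ R) (EFin \o (fun x => B * H x)) := @integrableZl _ _ R mu (@circ R) mC B _ iH.
have iAQ : mu.-integrable (@circ R)
    (EFin \o (fun x => A * cmod ((cmod Q.[eit x] ^+ 2)%:C%C) `^ p)) := @integrableZl _ _ R mu (@circ R) mC A _ iQ.
have i2c : mu.-integrable (@circ R) (EFin \o (fun=> 2 * cmod cN `^ p)) := @integrableZl _ _ R mu (@circ R) mC 2 _ ic.
have : Rintegral mu (@circ R) (fun x => cmod ((Im F.[eit x])%:C%C) `^ p + B * H x) <=
       Rintegral mu (@circ R) (fun x => A * cmod ((cmod Q.[eit x] ^+ 2)%:C%C) `^ p +
         2 * cmod cN `^ p).
  apply: le_Rintegral => //.
  - exact: (@integrableD _ _ R mu (@circ R) mC _ _ iI iBH).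
  - exact: (@integrableD _ _ R mu (@circ R) mC _ _ iAQ i2c).
  move=> x _; rewrite !cmod_real -lerBrDr [`|cmod _ ^+ 2|]ger0_norm ?sqr_ge0//.
  by rewrite -FQ ?cmod_eit// [`|2 ^- N|]ger0_norm ?invr_ge0 ?exprn_ge0//; exact: ptw.
rewrite RintegralD; [|exact: mC|exact: iI|exact: iBH].
rewrite RintegralD; [|exact: mC|exact: iAQ|exact: i2c].
rewrite RintegralZl; [|exact: mC|exact: iH].
rewrite RintegralZl; [|exact: mC|exact: iQ].
rewrite RintegralZl; [|exact: mC|exact: ic].
rewrite -[X in _ <= _ + 2 * X -> _](npowE p (fun=> cN)) npow_cst !npowE.
rewrite cmod_real ger0_norm ?invr_ge0 ?exprn_ge0//.
move=> h; apply: le_trans (le_trans _ h) _; first by rewrite lerDl mulr_ge0.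
by rewrite lerD// mulrCA.
Qed.

Lemma eq_fourier f g (n : int) : (forall t, cmod t = 1 -> f t = g t) ->
  fourier f n = fourier g n.
Proof. by move=> fg; rewrite !fourierE; apply: eq_cmean => t t1; rewrite fg. Qed.

Lemma npow_eq p f g : (forall t, cmod t = 1 -> f t = g t) -> npow p f = npow p g.
Proof.
by move=> fg; rewrite !npowE; apply: eq_Rintegral => x _; rewrite fg// cmod_eit.
Qed.

(** On the circle |Q|^2 is the real part of a polynomial [F] with real value at 0, so its analytic
    part is half of [F] plus half of the constant [F.[0]]. That constant is the mean of |Q|^2, which
    [npow_cmean] controls. *)
Lemma riesz_square p : 1 < p < 2 -> exists2 A : R, 0 <= A &
  forall Q : {poly C}, exists2 P : {poly C},
    analytic_part (fun t => (cmod Q.[t] ^+ 2)%:C%C) P &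
    npow p (fun t => P.[t]) <= A * npow p (fun t => (cmod Q.[t] ^+ 2)%:C%C).
Proof.
move=> p12; have /andP[p1 p2] := p12; have p0 : 0 <= p by lra.
have [A A0 hA] := npow_conjugate p12.
exists (2 `^ p * (2 `^ p * (1 + A) + 1)).
  by rewrite mulr_ge0 ?powR_ge0// addr_ge0// mulr_ge0 ?powR_ge0// addr_ge0.
move=> Q; have [F [c0 c00 F0] FQ] := herglotz_poly Q.
set S := fun t => (cmod Q.[t] ^+ 2)%:C%C.
pose h : C := (2^-1)%:C%C.
have h2 : h + h = 1 by rewrite /h -rmorphD /= -[RHS]/((1 : R)%:C%C); congr (_%:C%C); field.
have hn : cmod h <= 1 by rewrite cmod_real ger0_norm ?invr_ge0// invf_le1// ler1n.
have TS : trig S.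
  apply: (@trig_eq R (fun t => Q.[t] * conjc Q.[t])) => [t _|]; first by rewrite mulc_conj.
  by apply: trigM; [exact: trig_poly|apply: trigJ; exact: trig_poly].
have LS : inLp p S by exact: trig_Lp.
have TF : trig (fun t => F.[t]) := trig_poly F.
have TFJ : trig (fun t => conjc F.[t]) := trigJ TF.
have SE t : cmod t = 1 -> S t = h * F.[t] + h * conjc F.[t].
  move=> t1; rewrite /S -FQ// -mulrDr.
  by apply: complex_ext; rewrite /h ?cReM ?cImM cReD cImD cReJ cImJ /=; field.
have fS : analytic_part S (h *: F + (h * c0%:C%C)%:P).
  move=> n; rewrite (eq_fourier _ SE) fourierD; try by apply: LpZ => //; exact: trig_Lp.
  rewrite !fourierZ; try exact: trig_Lp.
  rewrite fourierJ; last exact: trig_Lp.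
  rewrite !fourier_poly coefD coefZ coefC mul1r.
  case: n => [|n]; last by rewrite /= mul0r conjc0 mulr0.
  by rewrite oppr0 /= mul1r -horner_coef0 F0 conjc_real.
exists (h *: F + (h * c0%:C%C)%:P) => //.
have c0E : c0%:C%C = cmean S.
  have := fS 0%N; rewrite fourierE coefD coefZ coefC /= -horner_coef0 F0 -mulrDl h2 mul1r => <-.
  by apply: eq_cmean => t _; rewrite oppr0 expr0z mulr1.
have LF : inLp p (fun t => F.[t]) by exact: trig_Lp.
have LI : inLp p (fun t => (Im F.[t])%:C%C).
  have [M FM] := horner_bdd F; apply: (@Lp_bdd R _ _ M) => //.
    by apply: meas_real; case: (meas_horner F).
  apply: aeTW => t t1; rewrite cmod_real; apply: le_trans (FM _ t1); exact: ler_Im_cmod.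
have hF : npow p (fun t => F.[t]) <= 2 `^ p * (1 + A) * npow p S.
  have -> : npow p (fun t => F.[t]) = npow p (fun t => S t + 'i%C * (Im F.[t])%:C%C).
    apply: npow_eq => t t1; rewrite /S -FQ//.
    by apply: complex_ext; rewrite ?(cReD, cImD) ?(cReM, cImM) /=; ring.
  apply: le_trans (npowD_le p0 LS _) _; first exact: LpZ.
  rewrite -[leRHS]mulrA; apply: ler_wpM2l; first exact: powR_ge0.
  rewrite mulrDl mul1r; apply: lerD => //.
  apply: le_trans (hA F Q c0 c00 F0 FQ); rewrite npowZ//.
  by rewrite cmodE /= expr0n expr1n add0r sqrtr1 powR1x mul1r.
have hZ f : inLp p f -> npow p (fun t => h * f t) <= npow p f.
  move=> Lf; rewrite npowZ// ler_piMl ?npow_ge0//.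
  by rewrite -[leRHS](powR1x p); apply: ge0_ler_powR; rewrite ?nnegrE ?cmod_ge0.
have Lc : inLp p (fun=> c0%:C%C) by exact: Lp_cst.
have -> : npow p (fun t => (h *: F + (h * c0%:C%C)%:P).[t]) =
    npow p (fun t => h * F.[t] + h * c0%:C%C).
  by apply: npow_eq => t _; rewrite hornerD hornerZ hornerC.
apply: le_trans (npowD_le p0 _ _) _; [exact: LpZ|exact: LpZ|].
rewrite -[leRHS]mulrA; apply: ler_wpM2l; first exact: powR_ge0.
rewrite mulrDl mul1r; apply: lerD.
  exact: le_trans (hZ _ LF) hF.
by apply: le_trans (hZ _ Lc) _; rewrite c0E; exact: npow_cmean.
Qed.

(** The square root of [f] lies in L^4, where trigonometric polynomials are dense, and on the circle
    a Laurent polynomial has the modulus of its numerator [Q]. *)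
Lemma nonneg_dense f (e : R) : inLp 2 f -> (forall t, f t = (cmod (f t))%:C%C) -> 0 < e ->
  exists Q : {poly C}, npow 2 (fun t => (cmod Q.[t] ^+ 2)%:C%C - f t) <= e.
Proof.
move=> f2 fE e0; pose rt t : R := cmod (f t) `^ 2^-1.
have rt0 t : 0 <= rt t by exact: powR_ge0.
have rt2 t : rt t ^+ 2 = cmod (f t).
  by rewrite -powR_mulrn// -powRrM mulVf// powRr1// cmod_ge0.
have mr : meas_on_T (fun t => (rt t)%:C%C).
  by apply: meas_real; apply/measurable_EFinP; apply: meas_cmodX; exact: Lp_meas f2.
have L4 : inLp 4 (fun t => (rt t)%:C%C).
  apply: (@LpM_le R 4 2 2 _ f f 1 0) => //; apply: aeTW => t _.
  rewrite mul0r addr0 mul1r cmod_real ger0_norm// !powR_mulrn ?cmod_ge0// -rt2 -exprM//.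
pose e1 := e / (2 * (npow 2 f + 1)).
have e10 : 0 < e1 by rewrite divr_gt0// mulr_gt0// ltr_wpDl// npow_ge0.
(* Makes the difference of the two sides of the pointwise estimate a perfect square, that of
   [4 * x ^+ 2 - e1 * s ^+ 2], divided by [e1]. *)
pose K := 2 + 16 / e1.
have K0 : 0 < K by rewrite addr_gt0// divr_gt0.
have d0 : 0 < e / (2 * K) by rewrite divr_gt0// mulr_gt0.
have p4 : 1 < 4 :> R by rewrite ltr1n.
have [g [n [Q gQ]] hg] := trig_dense p4 L4 d0.
have gq t : cmod t = 1 -> cmod (g t) = cmod Q.[t].
  by move=> t1; rewrite gQ// exprnN cmodM cmod_expz// mul1r.
have Lg : inLp 4 g by apply: trig_Lp => //; exists n, Q.
exists Q; apply: (@le_trans _ _ (K * npow 4 (fun t => (rt t)%:C%C - g t) + e1 * npow 2 f)).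
  apply: npow_le2 => //; [|exact: LpB|exact: ltW|exact: ltW|].
    apply: LpB => //; apply: (@inLp_eq R 2 (fun t => Q.[t] * conjc Q.[t])) => //.
      by move=> t _; rewrite mulc_conj.
    by apply: trig_Lp => //; apply: trigM; [exact: trig_poly|apply: trigJ; exact: trig_poly].
  apply: aeTW => t t1; rewrite [f t in X in _ - X]fE -rmorphB cmod_real !powR_mulrn ?cmod_ge0//.
  rewrite real_normK ?num_real// -rt2 -gq//.
  set x := cmod (_ - _); set y := cmod (g t); set s := rt t.
  have h1 : y <= x + s.
    rewrite /x /y -[s]ger0_norm ?rt0// -cmod_real -[g t in leLHS](subKr (rt t)%:C%C).
    by rewrite (le_trans (cmodB _ _))// addrC.
  have h2 : s <= x + y.
    rewrite /x /y -[s]ger0_norm ?rt0// -cmod_real -[(s%:C%C) in leLHS](subrK (g t)).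
    exact: cmodD.
  have x0 : 0 <= x := cmod_ge0 _; have y0 : 0 <= y := cmod_ge0 _; have s0 : 0 <= s := rt0 t.
  have a1 : (y - s) ^+ 2 <= x ^+ 2 by nra.
  have a2 : (y + s) ^+ 2 <= 2 * x ^+ 2 + 8 * s ^+ 2.
    apply: (@le_trans _ _ ((x + 2 * s) ^+ 2)).
      by rewrite ler_sqr ?nnegrE ?addr_ge0 ?mulr_ge0//; lra.
    by have := sqr_ge0 (x - 2 * s); nra.
  have -> : (y ^+ 2 - s ^+ 2) ^+ 2 = (y - s) ^+ 2 * (y + s) ^+ 2 by ring.
  apply: (@le_trans _ _ (x ^+ 2 * (2 * x ^+ 2 + 8 * s ^+ 2))).
    by apply: ler_pM; rewrite ?sqr_ge0.
  have -> : K * x ^+ 4 + e1 * (s ^+ 2) ^+ 2 =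
     x ^+ 2 * (2 * x ^+ 2 + 8 * s ^+ 2) + (4 * x ^+ 2 - e1 * s ^+ 2) ^+ 2 / e1.
    by rewrite /K; field; rewrite gt_eqF.
  by rewrite lerDl divr_ge0 ?sqr_ge0// ltW.
have -> : e = e / 2 + e / 2 by field.
apply: lerD; last by rewrite mulrC half_frac// npow_ge0.
apply: le_trans (ler_wpM2l (ltW K0) (ltW hg)) _.
by rewrite le_eqVlt; apply/orP; left; apply/eqP; field; rewrite gt_eqF.
Qed.

End ConjugateFunctions.

(** * The theorem of M. Riesz *)

Section RieszProjection.
Variable R : realType.
Local Notation C := (R[i]).
Local Notation mu := (@lebesgue_measure R).
Local Notation Re := (@complex.Re R).
Local Notation Im := (@complex.Im R).
Implicit Types (f g h : C -> C) (z w t : C) (p q : R).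

Lemma cmean_npow f : inLp 1 f -> cmod (cmean f) <= npow 1 f.
Proof. exact: cmean_le. Qed.

Opaque npow cmean fourier.

Lemma pow2_le4 p : p <= 2 -> 2 `^ p <= 4 :> R.
Proof.
move=> p2; apply: (@le_trans _ _ (2 `^ 2)); last by rewrite powR_mulrn//; lra.
by apply: ler_powR => //; rewrite ler1n.
Qed.

Lemma conj_expE p : 1 < p -> p^-1 + (p / (p - 1))^-1 = 1.
Proof. by move=> p1; rewrite invf_div; field; rewrite gt_eqF//; lra. Qed.

Lemma L2_Lp p f : 1 < p < 2 -> inLp 2 f -> inLp p f.
Proof.
move=> /andP[p1 p2] f2; apply: (@LpM_le R p 2 2 f f (fun=> 1) 1 1) => //.
- exact: Lp_meas f2.
- exact: Lp_cst.
apply: aeTW => t _; rewrite cmod1 powR1x !mul1r.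
have x0 := cmod_ge0 (f t); have [h|/ltW h] := leP (cmod (f t)) 1.
  apply: (@le_trans _ _ 1); last by rewrite lerDr powR_ge0.
  by rewrite -(powR1x p); apply: ge0_ler_powR; rewrite ?nnegrE//; lra.
by apply: (@le_trans _ _ (cmod (f t) `^ 2)); [apply: ler_powR => //; exact: ltW|rewrite lerDl].
Qed.

(** Young's inequality with the exponent [2 / p], against the constant 1. *)
Lemma L2_small p (e : R) : 1 < p < 2 -> 0 < e -> exists2 d : R, 0 < d &
  forall f, inLp 2 f -> npow 2 f <= d -> npow p f <= e.
Proof.
move=> p12 e0; have /andP[p1 p2] := p12; have p0 : 0 < p by lra.
pose r := 2 / p; pose r' := r / (r - 1).
have r1 : 1 < r by rewrite ltr_pdivlMr// mul1r.
have rr : r^-1 + r'^-1 = 1 by exact: conj_expE.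
have pi0 : 0 < 2 * pi :> R by rewrite mulr_gt0// pi_gt0.
have e10 : 0 < e / 2 / (2 * pi) by rewrite !divr_gt0.
have [K K0 hK] := young_eps r1 rr e10.
exists (e / (2 * (K + 1))); first by rewrite divr_gt0// mulr_gt0// ltr_wpDl.
move=> f f2 hf.
apply: (@le_trans _ _ (K * npow 2 f + e / 2 / (2 * pi) * npow 1 (fun=> 1))).
  apply: npow_le2 => //; [exact: L2_Lp|exact: Lp_cst|exact: ltW|].
  apply: aeTW => t _; have := hK (cmod (f t) `^ p) 1 (powR_ge0 _ _) ler01.
  rewrite mulr1 powR1x cmod1 powR1x -powRrM (_ : p * r = 2)//.
  by rewrite /r; field; rewrite gt_eqF.
rewrite npow_cst cmod1 powR1x mul1r mulfVK ?gt_eqF//.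
rewrite [leRHS](_ : e = e / 2 + e / 2); last by field.
apply: lerD; last by [].
by apply: le_trans (ler_wpM2l K0 hf) _; exact: half_frac.
Qed.

(** Stands for an L^p bound on the projection of [f] while that projection is not yet available: [f]
    is an L^2 limit of trigonometric polynomials with controlled analytic parts. For p < 2 closeness
    in L^2 implies closeness in L^p. *)
Definition approximable p (B : R) f := forall e : R, 0 < e -> exists S (P : {poly C}),
  [/\ trig S, analytic_part S P, npow 2 (fun t => S t - f t) <= e &
      npow p (fun t => P.[t]) <= B + e].

Lemma absorb_frac (x y n e : R) : 0 <= x * y -> 0 < e ->
  x * (y * (e / (x * y + 1) + n)) <= x * y * n + e.
Proof.
move=> xy e0; rewrite mulrA mulrDr addrC lerD2l mulrCA ger_pMr//.
by rewrite ler_pdivrMr ?ltr_wpDl// mul1r lerDl.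
Qed.

Lemma approximable_nonneg p : 1 < p < 2 -> exists2 A : R, 0 <= A &
  forall f, inLp 2 f -> (forall t, f t = (cmod (f t))%:C%C) -> approximable p (A * npow p f) f.
Proof.
move=> p12; have /andP[p1 p2] := p12; have p0 : 0 <= p by lra.
have [A A0 hA] := riesz_square p12.
have A20 : 0 <= A * 2 `^ p by rewrite mulr_ge0 ?powR_ge0.
exists (A * 2 `^ p) => // f f2 fE e e0.
have e10 : 0 < e / (A * 2 `^ p + 1) by rewrite divr_gt0// ltr_wpDl.
have [d d0 hd] := L2_small p12 e10.
have m0 : 0 < Num.min e d by rewrite lt_min e0.
have [Q hQ] := nonneg_dense f2 fE m0.
have [P SP hP] := hA Q.
set S := (fun t => (cmod Q.[t] ^+ 2)%:C%C) in SP hP hQ *.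
have TS : trig S.
  apply: (@trig_eq R (fun t => Q.[t] * conjc Q.[t])) => [t _|]; first by rewrite mulc_conj.
  by apply: trigM; [exact: trig_poly|apply: trigJ; exact: trig_poly].
have L2 : inLp 2 (fun t => S t - f t) by apply: LpB => //; exact: trig_Lp.
exists S, P; split => //; first by apply: le_trans hQ _; rewrite ge_min lexx.
have hp : npow p (fun t => S t - f t) <= e / (A * 2 `^ p + 1).
  by apply: hd => //; apply: le_trans hQ _; rewrite ge_min lexx orbT.
have SE : npow p S = npow p (fun t => (S t - f t) + f t).
  by apply: npow_eq => t _; rewrite subrK.
apply: (le_trans hP); apply: (@le_trans _ _ (A * (2 `^ p * (e / (A * 2 `^ p + 1) + npow p f)))).
  apply: (ler_wpM2l A0); rewrite SE.
  apply: le_trans (npowD_le p0 (L2_Lp p12 L2) (L2_Lp p12 f2)) _.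
  by apply: ler_wpM2l; [exact: powR_ge0|apply: lerD].
exact: absorb_frac.
Qed.

Lemma approximableD p (B1 B2 : R) f1 f2 : 1 < p < 2 -> inLp 2 f1 -> inLp 2 f2 ->
  approximable p B1 f1 -> approximable p B2 f2 ->
  approximable p (4 * (B1 + B2)) (fun t => f1 t + f2 t).
Proof.
move=> p12 L1 L2 h1 h2 e e0; have /andP[p1 p2] := p12; have p0 : 0 <= p by lra.
have e80 : 0 < e / 8 by rewrite divr_gt0.
have [S1 [P1 [T1 A1 n1 m1]]] := h1 _ e80; have [S2 [P2 [T2 A2 n2 m2]]] := h2 _ e80.
exists (fun t => S1 t + S2 t), (P1 + P2); split.
- exact: trigD.
- by apply: analytic_partD => //; exact: trig_Lp.
- rewrite (_ : npow _ _ = npow 2 (fun t => (S1 t - f1 t) + (S2 t - f2 t))); last first.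
    by apply: npow_eq => t _; ring.
  apply: (@le_trans _ _ (2 `^ 2 * (e / 8 + e / 8))).
    have Ld i (Ti : trig i) h (Lh : inLp 2 h) := LpB (ler0n R 2) (trig_Lp (ler0n R 2) Ti) Lh.
    apply: le_trans (npowD_le (ler0n R 2) (Ld _ T1 _ L1) (Ld _ T2 _ L2)) _.
    by apply: ler_wpM2l; [exact: powR_ge0|apply: lerD n1 n2].
  by rewrite powR_mulrn//; move: e0; clear; lra.
- rewrite (_ : npow _ _ = npow p (fun t => P1.[t] + P2.[t])); last first.
    by apply: npow_eq => t _; rewrite hornerD.
  have LP (P : {poly C}) : inLp p (fun t => P.[t]) by apply: trig_Lp => //; exact: trig_poly.
  apply: le_trans (npowD_le p0 (LP P1) (LP P2)) _.
  have h4 := pow2_le4 (ltW p2).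
  apply: (@le_trans _ _ (4 * (B1 + e / 8 + (B2 + e / 8)))); last by move: e0; clear; lra.
  by apply: ler_pM; rewrite ?powR_ge0 ?addr_ge0 ?npow_ge0// lerD.
Qed.

Lemma approximableZ p (B : R) z f : 1 < p < 2 -> cmod z = 1 -> inLp 2 f ->
  approximable p B f -> approximable p B (fun t => z * f t).
Proof.
move=> /andP[p1 p2] z1 Lf h e e0; have p0 : 0 <= p by lra.
have [S [P [T A n m]]] := h _ e0.
exists (fun t => z * S t), (z *: P); split.
- by apply: trigM => //; exact: trig_cst.
- by apply: analytic_partZ => //; exact: trig_Lp.
- rewrite (_ : npow _ _ = npow 2 (fun t => z * (S t - f t))).
    by rewrite npowZ// ?z1 ?powR1x ?mul1r//; apply: LpB => //; exact: trig_Lp.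
  by apply: npow_eq => t _; rewrite mulrBr.
- rewrite (_ : npow _ _ = npow p (fun t => z * P.[t])).
    by rewrite npowZ// ?z1 ?powR1x ?mul1r//; apply: trig_Lp => //; exact: trig_poly.
  by apply: npow_eq => t _; rewrite hornerZ.
Qed.

Definition riesz_bound p := exists2 A : R, 0 <= A & forall f (P : {poly C}), trig f ->
  analytic_part f P -> npow p (fun t => P.[t]) <= A * npow p f.

(** [f] is a combination of the nonnegative functions |f|, |f| + Re f and |f| + Im f, to which
    [approximable_nonneg] applies. *)
Lemma riesz_lt2 p : 1 < p < 2 -> riesz_bound p.
Proof.
move=> p12; have /andP[p1 p2] := p12; have p0 : 0 <= p by lra.
have [A A0 hA] := approximable_nonneg p12.
exists (2 `^ p * (4 * (4 * (A * 4 + A) + 4 * (A * 4 + A)))).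
  by rewrite mulr_ge0 ?powR_ge0//; lra.
move=> f P tf fP; have f2 : inLp 2 f by exact: trig_Lp.
have fp : inLp p f by exact: trig_Lp.
pose a t := (cmod (f t))%:C%C : C.
pose u t := (cmod (f t) + Re (f t))%:C%C : C.
pose v t := (cmod (f t) + Im (f t))%:C%C : C.
have mf := Lp_meas f2.
have ma : meas_on_T a by apply: meas_real; exact: meas_cmod.
have mU : meas_on_T u.
  by apply: meas_real; apply: measurable_funD; [exact: meas_cmod|case: mf].
have mV : meas_on_T v.
  by apply: meas_real; apply: measurable_funD; [exact: meas_cmod|case: mf].
have aE t : a t = (cmod (a t))%:C%C by rewrite /a cmod_real ger0_norm ?cmod_ge0.
have uu t : 0 <= cmod (f t) + Re (f t) <= 2 * cmod (f t).
  have := ler_Re_cmod (f t); rewrite ler_norml => /andP[? ?]; apply/andP; split; lra.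
have vv t : 0 <= cmod (f t) + Im (f t) <= 2 * cmod (f t).
  have := ler_Im_cmod (f t); rewrite ler_norml => /andP[? ?]; apply/andP; split; lra.
have uE t : u t = (cmod (u t))%:C%C.
  by rewrite /u cmod_real ger0_norm//; case/andP: (uu t).
have vE t : v t = (cmod (v t))%:C%C.
  by rewrite /v cmod_real ger0_norm//; case/andP: (vv t).
have cu t : cmod (u t) <= 2 * cmod (f t).
  by rewrite cmod_real ger0_norm; case/andP: (uu t).
have cv t : cmod (v t) <= 2 * cmod (f t).
  by rewrite cmod_real ger0_norm; case/andP: (vv t).
have La : inLp 2 a.
  apply: (@Lp_le R 2 a f 1) => //; apply: aeTW => t _.
  by rewrite mul1r /a cmod_real ger0_norm ?cmod_ge0.
have Lu : inLp 2 u by apply: (@Lp_le R 2 u f 2) => //; exact: aeTW.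
have Lv : inLp 2 v by apply: (@Lp_le R 2 v f 2) => //; exact: aeTW.
have h4 := pow2_le4 (ltW p2).
have na : npow p a <= npow p f.
  rewrite -[leRHS]mul1r; apply: npow_le1 => //; first exact: L2_Lp.
  by apply: aeTW => t _; rewrite mul1r /a cmod_real ger0_norm ?cmod_ge0.
have n4 (w : C -> C) : inLp 2 w -> (forall t, cmod (w t) <= 2 * cmod (f t)) ->
    npow p w <= 4 * npow p f.
  move=> Lw cw; apply: npow_le1 => //; first exact: L2_Lp.
  apply: aeTW => t _; apply: (@le_trans _ _ ((2 * cmod (f t)) `^ p)).
    by apply: ge0_ler_powR; rewrite ?nnegrE ?mulr_ge0 ?cmod_ge0.
  by rewrite powRM ?cmod_ge0// ler_wpM2r ?powR_ge0.
have apl (B B' : R) (w : C -> C) : B <= B' -> approximable p B w -> approximable p B' w.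
  move=> BB h e e0; have [S [Q [T1 T2 T3 T4]]] := h e e0.
  by exists S, Q; split => //; apply: le_trans T4 _; rewrite lerD2r.
set N := npow p f in na n4 *.
have apu : approximable p (A * (4 * N)) u.
  by apply: apl (hA _ Lu uE); apply: ler_wpM2l => //; exact: n4.
have apv : approximable p (A * (4 * N)) v.
  by apply: apl (hA _ Lv vE); apply: ler_wpM2l => //; exact: n4.
have apa : approximable p (A * N) a.
  by apply: apl (hA _ La aE); apply: ler_wpM2l.
have i1 : cmod ('i%C : C) = 1 by rewrite cmodE /= expr0n expr1n add0r sqrtr1.
have m1 : cmod (-1 : C) = 1 by rewrite cmodN cmod1.
have LZ z (w : C -> C) : inLp 2 w -> inLp 2 (fun t => z * w t) by exact: LpZ.
have apf : approximable p (4 * (4 * (A * (4 * N) + A * N) + 4 * (A * (4 * N) + A * N)))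
    (fun t => (u t + (-1) * a t) + 'i%C * (v t + (-1) * a t)).
  have Lu' := LpD (ler0n R 2) Lu (LZ (-1) _ La).
  have Lv' := LpD (ler0n R 2) Lv (LZ (-1) _ La).
  have am := approximableZ p12 m1 La apa.
  have au := approximableD p12 Lu (LZ (-1) _ La) apu am.
  have av := approximableD p12 Lv (LZ (-1) _ La) apv am.
  exact: approximableD p12 Lu' (LZ _ _ Lv') au (approximableZ p12 i1 Lv' av).
set B := 4 * (_ + _) in apf.
have fE t : f t = (u t + (-1) * a t) + 'i%C * (v t + (-1) * a t).
  by apply: complex_ext; rewrite /u /v /a ?(cReD, cImD) ?(cReM, cImM) /=; ring.
have -> : 2 `^ p * (4 * (4 * (A * 4 + A) + 4 * (A * 4 + A))) * N = 2 `^ p * B.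
  by rewrite /B; ring.
have LP (Q : {poly C}) r : 0 <= r -> inLp r (fun t => Q.[t]).
  by move=> r0; apply: trig_Lp => //; exact: trig_poly.
apply/ler_addgt0Pr => e e0.
have e10 : 0 < e / 8 by rewrite divr_gt0.
have [d d0 hd] := L2_small p12 e10.
have m0 : 0 < Num.min (e / 8) d by rewrite lt_min e10.
have [S [Q [TS SQ h1 h2]]] := apf _ m0.
(* Analytic parts are contractive in L^2, so an approximant of [f] in L^2 has an analytic part close
   to [P] in L^2, hence in L^p. *)
have pQ : npow p (fun t => (P - Q).[t]) <= e / 8.
  apply: hd; first exact: LP.
  apply: (@le_trans _ _ (npow 2 (fun t => f t - S t))).
    apply: analytic_part_L2; first by apply: LpB => //; exact: trig_Lp.
    by apply: analytic_partB => //; exact: trig_Lp.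
  rewrite npow_distC.
  rewrite (_ : npow _ _ = npow 2 (fun t => S t - (u t + (-1) * a t + 'i%C * (v t + (-1) * a t)))).
    by apply: le_trans h1 _; rewrite ge_min lexx orbT.
  by apply: npow_eq => t _; rewrite -fE.
rewrite (_ : npow p _ = npow p (fun t => (P - Q).[t] + Q.[t])); last first.
  by apply: npow_eq => t _; rewrite hornerD hornerN subrK.
apply: le_trans (npowD_le p0 (LP (P - Q) p p0) (LP Q p p0)) _.
have h3 : npow p (fun t => Q.[t]) <= B + e / 8.
  by apply: le_trans h2 _; rewrite lerD2l ge_min lexx.
apply: (@le_trans _ _ (2 `^ p * (e / 8 + (B + e / 8)))).
  by apply: ler_wpM2l; [exact: powR_ge0|apply: lerD].
rewrite addrCA mulrDr; apply: lerD; first by [].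
apply: (@le_trans _ _ (4 * (e / 8 + e / 8))); last by move: e0; clear; lra.
by apply: ler_wpM2r => //; rewrite addr_ge0// ltW.
Qed.

Lemma absorb_half (x y c k e : R) : x <= 2 * c * e + 2 * c * k * y + 2^-1 * (x + e) ->
  x <= 4 * c * k * y + (4 * c * e + e).
Proof. by lra. Qed.

(** The projection is its own adjoint. The p-th power [X] of the norm of [P] is, up to 2 pi, the
    pairing of [P] with [G], its image under the duality map; once [G] is replaced by a
    trigonometric polynomial [g], the projection moves onto the conjugate of [g], where the bound
    for [q] applies. *)
Lemma riesz_dual p q : 1 < p -> p^-1 + q^-1 = 1 -> riesz_bound q -> riesz_bound p.
Proof.
move=> p1 pq [A A0 hA]; have p0 : 0 <= p by lra.
have q1 := conj_exp_gt1 p1 pq; have q0 : 0 <= q by lra.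
have pi0 : 0 < 2 * pi :> R by rewrite mulr_gt0// pi_gt0.
pose M := 2 * pi * A * 2 `^ q.
have M0 : 0 <= M by rewrite mulr_ge0 ?powR_ge0// mulr_ge0// ltW.
(* So small that [X], a finite number, contributes at most half of itself to its own bound. *)
pose dl := (2 * (M + 1))^-1.
have dl0 : 0 < dl by rewrite invr_gt0 mulr_gt0// ltr_wpDl.
have dM : dl * M <= 2^-1.
  rewrite /dl invfM -mulrA ger_pMr ?invr_gt0// mulrC ler_pdivrMr ?ltr_wpDl// mul1r; lra.
have [K K0 hK] := young_eps p1 pq dl0.
exists (4 * pi * K); first by rewrite !mulr_ge0// ltW// pi_gt0.
move=> f P tf fP; set F := npow p f.
have LP (Q : {poly C}) r : 0 <= r -> inLp r (fun t => Q.[t]).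
  by move=> r0; apply: trig_Lp => //; exact: trig_poly.
set X := npow p (fun t => P.[t]).
have X0 : 0 <= X := npow_ge0 _ _.
pose G t := dualc p P.[t].
have LG : inLp q G by apply: Lp_dualc pq _ => //; exact: LP.
have nG : npow q G <= X.
  rewrite -[leRHS]mul1r; apply: npow_le1 => //; first exact: LP.
  by apply: aeTW => t _; rewrite mul1r (cmod_dualc_conj _ p1 pq).
have XE : X = 2 * pi * Re (cmean (fun t => G t * P.[t])).
  rewrite Re_cmean mulVKf ?gt_eqF// /X npowE; apply: eq_Rintegral => x _.
  by rewrite /G dualcM//; lra.
apply/ler_addgt0Pr => e' e'0.
pose e := e' / (4 * pi + 1).
have e0 : 0 < e by rewrite divr_gt0// ltr_wpDl// mulr_ge0// ltW// pi_gt0.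
have qp : q^-1 + p^-1 = 1 by rewrite addrC.
have [d d0 hd] := pairing_small q1 qp (LP P p p0) e0.
have m0 : 0 < Num.min d e by rewrite lt_min d0.
have [g tg hg] := trig_dense q1 LG m0.
have Lg : inLp q g by exact: trig_Lp.
have [Q gQ] := trig_analytic_part (trigJ tg).
have Tr h : trig h -> inLp 1 h by exact: trig_Lp.
have TP (Q' : {poly C}) := trig_poly Q'.
have s1 : cmod (cmean (fun t => (G t - g t) * P.[t])) <= e.
  apply: hd; first exact: LpB.
  by apply: le_trans (ltW hg) _; rewrite ge_min lexx.
(* Both sides equal the pairing of [P] with the conjugate of [Q], because [conjc g - Q] and [f - P]
   are orthogonal to polynomials. *)
have e1 : cmean (fun t => g t * P.[t]) = cmean (fun t => f t * conjc Q.[t]).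
  have h1 := analytic_part_ortho P (Tr _ (trigJ tg)) gQ.
  have h2 := analytic_part_ortho Q (Tr _ tf) fP.
  apply/eqP; rewrite -subr_eq0 -cmeanB; last 2 first.
  - by apply: Tr; apply: trigM.
  - by apply: Tr; apply: trigM => //; exact: trigJ.
  rewrite (_ : cmean _ = cmean (fun t => conjc ((conjc (g t) - Q.[t]) * conjc P.[t]) -
      (f t - P.[t]) * conjc Q.[t])); last first.
    by apply: eq_cmean => t _; rewrite rmorphM rmorphB /= !conjcK; ring.
  have t1 : trig (fun t => (conjc (g t) - Q.[t]) * conjc P.[t]).
    by apply: trigM; [apply: trigB => //; exact: trigJ|exact: trigJ].
  rewrite cmeanB; last 2 first.
  - by apply: Tr; exact: trigJ.
  - by apply: Tr; apply: trigM; [exact: trigB|exact: trigJ].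
  by rewrite cmeanJ ?h1 ?h2 ?conjc0 ?subrr//; exact: Tr.
have s2 : cmod (cmean (fun t => f t * conjc Q.[t])) <= K * F + dl * npow q (fun t => Q.[t]).
  have T1 : trig (fun t => f t * conjc Q.[t]) by apply: trigM => //; exact: trigJ.
  apply: le_trans (cmean_npow (Tr _ T1)) _.
  apply: npow_le2 => //; [exact: Tr|exact: trig_Lp|exact: LP|exact: ltW|].
  by apply: aeTW => t _; rewrite powRr1 ?cmod_ge0// cmodM cmod_conj hK ?cmod_ge0.
have s3 : npow q (fun t => Q.[t]) <= A * (2 `^ q * (X + e)).
  apply: (le_trans (hA _ _ (trigJ tg) gQ)); apply: ler_wpM2l => //.
  have -> : npow q (fun t => conjc (g t)) = npow q g.
    by rewrite !npowE; apply: eq_Rintegral => x _; rewrite cmod_conj.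
  rewrite (_ : npow q g = npow q (fun t => G t - (G t - g t))); last first.
    by apply: npow_eq => t _; rewrite opprB addrCA subrr addr0.
  apply: le_trans (npowB_le q0 LG (LpB q0 LG Lg)) _.
  apply: ler_wpM2l; first exact: powR_ge0.
  by apply: lerD nG _; apply: le_trans (ltW hg) _; rewrite ge_min lexx orbT.
have LGP : inLp 1 (fun t => (G t - g t) * P.[t]).
  by apply: (Lp1_mul q1 qp); [exact: LpB|exact: LP].
have XE2 : X <= 2 * pi * (e + (K * F + dl * (A * (2 `^ q * (X + e))))).
  rewrite {1}XE; apply: ler_wpM2l; first exact: ltW.
  apply: le_trans (ler_norm _) _; apply: le_trans (ler_Re_cmod _) _.
  rewrite (_ : cmean _ = cmean (fun t => (G t - g t) * P.[t] + g t * P.[t])); last first.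
    by apply: eq_cmean => t _; rewrite mulrBl subrK.
  rewrite cmeanD//; last by apply: Tr; exact: trigM.
  apply: le_trans (cmodD _ _) _; apply: lerD => //; rewrite e1.
  apply: (le_trans s2); apply: lerD => //; apply: ler_wpM2l => //; exact: ltW.
have : X <= 2 * pi * e + 2 * pi * K * F + 2^-1 * (X + e).
  apply: (le_trans XE2); rewrite mulrDr -addrA lerD2l mulrDr mulrA lerD2l.
  rewrite (_ : 2 * pi * _ = dl * M * (X + e)); last by rewrite /M; ring.
  by apply: ler_wpM2r dM; rewrite addr_ge0// ltW.
have ee : 4 * pi * e + e = e'.
  by rewrite -{2}[e]mul1r -mulrDl /e mulrC divfK// gt_eqF// ltr_wpDl// mulr_ge0// ltW// pi_gt0.
by move=> /absorb_half; rewrite -ee.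
Qed.

Lemma riesz_gt1 p : 1 < p -> riesz_bound p.
Proof.
move=> p1; have [p2|p2|->] := ltgtP p 2.
- by apply: riesz_lt2; rewrite p1.
- pose q := p / (p - 1).
  have pq : p^-1 + q^-1 = 1 by exact: conj_expE.
  apply: (riesz_dual p1 pq); apply: riesz_lt2; rewrite (conj_exp_gt1 p1 pq)/=.
  by rewrite /q ltr_pdivrMr; lra.
- exists 1 => // f P tf fP; rewrite mul1r; apply: analytic_part_L2 fP; exact: trig_Lp.
Qed.

Lemma fourier_small p (n : int) (e : R) : 1 < p -> 0 < e -> exists2 d : R, 0 < d &
  forall f, inLp p f -> npow p f <= d -> cmod (fourier f n) <= e.
Proof.
move=> p1 e0; pose q := p / (p - 1).
have pq : p^-1 + q^-1 = 1 by exact: conj_expE.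
have q0 : 0 <= q by have := conj_exp_gt1 p1 pq; lra.
have [d d0 hd] := pairing_small p1 pq (trig_Lp q0 (trig_expz R (- n))) e0.
by exists d => // f fp fd; rewrite fourierE; exact: hd.
Qed.

(** The analytic parts of trigonometric approximants of [f] form a Cauchy sequence by [riesz_gt1].
    The last clause records that the projection is a limit of polynomials, which is where
    [hardy_approx] comes from. *)
Lemma riesz_projection p f : 1 < p -> inLp p f -> exists g, [/\ inLp p g,
  forall n : int, fourier g n = (0 <= n)%R%:R * fourier f n &
  forall e : R, 0 < e -> exists P : {poly C}, npow p (fun t => g t - P.[t]) <= e].
Proof.
move=> p1 fp; have p0 : 0 <= p by lra.
have [A A0 hA] := riesz_gt1 p1.
have /choice[F hF] : forall k : nat, exists h, trig h /\
    npow p (fun t => f t - h t) <= k.+1%:R^-1.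
  move=> k; have k0 : 0 < k.+1%:R^-1 :> R by rewrite invr_gt0.
  by have [h th hh] := trig_dense p1 fp k0; exists h; split => //; exact: ltW.
have /choice[P hP] : forall k : nat, exists Q, analytic_part (F k) Q.
  by move=> k; apply: trig_analytic_part; case: (hF k).
have TP k : trig (fun t => (P k).[t]) := trig_poly (P k).
have LP k : inLp p (fun t => (P k).[t]) by apply: trig_Lp.
have LF k : inLp p (F k) by apply: trig_Lp => //; case: (hF k).
have small (e : R) : 0 < e -> exists K, forall k, (K <= k)%N -> npow p (fun t => f t - F k t) <= e.
  move=> e0; have /cvgrPdist_le /(_ e e0) [K _ hK] := @cvg_invS R.
  exists K => k /hK /=; rewrite sub0r normrN ger0_norm ?invr_ge0// => hk.
  by apply: le_trans hk; case: (hF k).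
have C20 : 0 <= A * 2 `^ p by rewrite mulr_ge0 ?powR_ge0.
have [|g [Lg hg]] := @Lp_complete R p (fun k t => (P k).[t]) (ltW p1) LP.
  move=> e e0; have e10 : 0 < e / (2 * (A * 2 `^ p + 1)).
    by rewrite divr_gt0// mulr_gt0// ltr_wpDl.
  have [K hK] := small _ e10; exists K => j k Kj Kk.
  rewrite pintE; last exact: LpB.
  rewrite lee_fin (_ : npow p _ = npow p (fun t => (P j - P k).[t])); last first.
    by apply: npow_eq => t _; rewrite hornerD hornerN.
  apply: (@le_trans _ _ (A * npow p (fun t => F j t - F k t))).
    apply: hA; first by apply: trigB; [case: (hF j)|case: (hF k)].
    by apply: analytic_partB => //; apply: trig_Lp => //; [case: (hF j)|case: (hF k)].
  rewrite (_ : npow p _ = npow p (fun t => (f t - F k t) - (f t - F j t))); last first.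
    by apply: npow_eq => t _; ring.
  have e12 : A * 2 `^ p * (e / (2 * (A * 2 `^ p + 1))) <= e / 2 by exact: half_frac.
  apply: (@le_trans _ _ (A * (2 `^ p * (e / (2 * (A * 2 `^ p + 1)) + e / (2 * (A * 2 `^ p + 1)))))).
    apply: ler_wpM2l => //.
    apply: le_trans (npowB_le p0 (LpB p0 fp (LF k)) (LpB p0 fp (LF j))) _.
    by apply: ler_wpM2l; [exact: powR_ge0|apply: lerD; exact: hK].
  by rewrite mulrA mulrDr [leRHS](_ : _ = e / 2 + e / 2); [apply: lerD|field].
have smg (e : R) : 0 < e -> exists K, forall k, (K <= k)%N -> npow p (fun t => g t - (P k).[t]) <= e.
  move=> e0; have [K hK] := hg e e0; exists K => k /hK.
  by rewrite pintE ?lee_fin//; exact: LpB.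
have L1 h : inLp p h -> inLp 1 h by apply: Lp1_Lp; exact: ltW.
exists g; split => //; last first.
  by move=> e /smg[K hK]; exists (P K); exact: hK.
move=> n; apply/eqP; rewrite -subr_eq0; apply/eqP; apply: cmod_small0 => e e0.
have e20 : 0 < e / 2 by rewrite divr_gt0.
have [d d0 hd] := fourier_small n p1 e20.
have [K1 hK1] := smg d d0; have [K2 hK2] := small d d0; set k := maxn K1 K2.
have a1 : cmod (fourier g n - fourier (fun t => (P k).[t]) n) <= e / 2.
  rewrite -fourierB; [|exact: L1|exact: L1].
  by apply: hd; [exact: LpB|apply: hK1; exact: leq_maxl].
have a2 : cmod (fourier f n - fourier (F k) n) <= e / 2.
  rewrite -fourierB; [|exact: L1|exact: L1].
  by apply: hd; [exact: LpB|apply: hK2; exact: leq_maxr].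
have -> : fourier g n - (0 <= n)%R%:R * fourier f n =
    (fourier g n - fourier (fun t => (P k).[t]) n) -
    (0 <= n)%R%:R * (fourier f n - fourier (F k) n).
  rewrite fourier_poly; have [n0|n0] := leP 0 n; last by rewrite !mul0r !subr0.
  rewrite !mul1r; have := hP k (absz n); rewrite gez0_abs// => ->; ring.
apply: le_trans (cmodB _ _) _; rewrite [leRHS](_ : _ = e / 2 + e / 2); last by field.
apply: lerD => //; rewrite cmodM; apply: le_trans a2; rewrite ler_piMl ?cmod_ge0//.
by case: (0 <= n)%R; rewrite ?cmod1 ?cmod0.
Qed.

End RieszProjection.

(** * Products of functions with half-line spectra *)

Section Spectra.
Variable R : realType.
Local Notation C := (R[i]).
Local Notation mu := (@lebesgue_measure R).
Local Notation Re := (@complex.Re R).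
Local Notation Im := (@complex.Im R).
Implicit Types (f g h : C -> C) (z w t : C) (p q : R).

Opaque npow cmean fourier.

Lemma aeT_eqS f g f' g' : (forall t, cmod t = 1 -> f t = g t -> f' t = g' t) ->
  aeT_eq f g -> aeT_eq f' g'.
Proof. by move=> h fg; exact: (@aeTS R (fun t => f t = g t) (fun t => f' t = g' t) h). Qed.

Lemma aeT_eqS2 f1 g1 f2 g2 f g :
  (forall t, cmod t = 1 -> f1 t = g1 t -> f2 t = g2 t -> f t = g t) ->
  aeT_eq f1 g1 -> aeT_eq f2 g2 -> aeT_eq f g.
Proof.
by move=> h; exact: (@aeTS2 R (fun t => f1 t = g1 t) (fun t => f2 t = g2 t) (fun t => f t = g t) h).
Qed.

Lemma fourier_shift f (k n : int) : fourier (fun t => f t * t ^ k) n = fourier f (n - k).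
Proof.
rewrite !fourierE; apply: eq_cmean => t t1.
by rewrite -mulrA -expfzDr ?circ_neq0// opprB.
Qed.

Lemma fourier_ae f g (n : int) : meas_on_T f -> meas_on_T g -> aeT_eq f g ->
  fourier f n = fourier g n.
Proof.
move=> mf mg fg; rewrite !fourierE.
apply: cmean_ae; try by apply: measM => //; exact: meas_expz.
by apply: aeT_eqS fg => t _ ->.
Qed.

Lemma fourier_inj_ae f g : inLp 1 f -> inLp 1 g ->
  (forall n : int, fourier f n = fourier g n) -> aeT_eq f g.
Proof.
move=> f1 g1 fg; have h : aeT_eq (fun t => f t - g t) (fun=> 0).
  by apply: fourier_uniqueness => [|n]; [exact: LpB|rewrite fourierB// fg subrr].
by apply: aeT_eqS h => t _ /eqP; rewrite subr_eq0 => /eqP.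
Qed.

Lemma hardy_approx p f (e : R) : 1 < p -> inLp p f ->
  (forall n : int, n < 0 -> fourier f n = 0) -> 0 < e ->
  exists P : {poly C}, npow p (fun t => f t - P.[t]) <= e.
Proof.
move=> p1 fp f0 e0; have p0 : 0 <= p by lra.
have [g [Lg gf hg]] := riesz_projection p1 fp.
have [P hP] := hg e e0; exists P.
have LP : inLp p (fun t => P.[t]) by apply: trig_Lp => //; exact: trig_poly.
have fg : aeT_eq f g.
  apply: fourier_inj_ae; [exact: Lp1_Lp (ltW p1) fp|exact: Lp1_Lp (ltW p1) Lg|].
  move=> n; rewrite gf; have [n0|n0] := leP 0 n; first by rewrite mul1r.
  by rewrite f0// mul0r.
rewrite (@npow_ae R p _ (fun t => g t - P.[t])) //; try exact: LpB.
by apply: aeT_eqS fg => t _ ->.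
Qed.

Lemma poly_mul_mean g (P : {poly C}) (n : int) : inLp 1 g -> 0 <= n ->
  (forall n : int, n < 0 -> fourier g n = 0) ->
  cmean (fun t => P.[t] * g t * t ^ n) = (n == 0)%R%:R * (P`_0 * fourier g 0).
Proof.
move=> g1 n0 g0.
rewrite (_ : cmean _ = cmean (fun t => g t * (t ^ n * P.[t]))); last first.
  by apply: eq_cmean => t _; ring.
rewrite cmean_mul_poly//.
have gE (i : nat) : cmean (fun t => g t * t ^ (n + i%:Z)) = fourier g (- (n + i%:Z)).
  by rewrite fourierE opprK.
under eq_bigr do rewrite gE.
have [nz|nz] := eqVneq n 0; last first.
  rewrite mul0r big1// => i _; rewrite g0 ?mulr0// oppr_lt0.
  by rewrite ltr_pwDl// lt_def nz.
rewrite mul1r nz; have [->|P0] := eqVneq P 0.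
  by rewrite size_poly0 big_ord0 coef0 mul0r.
have sP : (0 < size P)%N by rewrite size_poly_gt0.
rewrite (bigD1 (Ordinal sP))//= add0r oppr0 big1 ?addr0// => i i0.
rewrite g0 ?mulr0// oppr_lt0 add0r ltz_nat lt0n.
by apply: contra i0 => /eqP h; apply/eqP/val_inj.
Qed.

(** By continuity of the pairing [f] may be replaced by a polynomial, and then only finitely many
    Fourier coefficients of [g] enter. *)
Lemma hardy_mul p q f g (n : int) : 1 < p -> p^-1 + q^-1 = 1 -> inLp p f -> inLp q g ->
  (forall n : int, n < 0 -> fourier f n = 0) ->
  (forall n : int, n < 0 -> fourier g n = 0) -> 0 <= n ->
  cmean (fun t => f t * g t * t ^ n) = (n == 0)%R%:R * (fourier f 0 * fourier g 0).
Proof.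
move=> p1 pq fp gq f0 g0 n0; have q1 := conj_exp_gt1 p1 pq.
have p0 : 0 <= p by lra. have q0 : 0 <= q by lra.
have gn : inLp q (fun t => g t * t ^ n) by exact: LpMzr.
apply/eqP; rewrite -subr_eq0; apply/eqP; apply: cmod_small0 => e e0.
have e20 : 0 < e / 2 by rewrite divr_gt0.
have [d1 d10 h1] := pairing_small p1 pq gn e20.
pose c := cmod (fourier g 0).
have c0 : 0 < c + 1 by rewrite ltr_wpDl// cmod_ge0.
have e30 : 0 < e / 2 / (c + 1) by rewrite divr_gt0.
have [d2 d20 h2] := fourier_small 0 p1 e30.
have m0 : 0 < Num.min d1 d2 by rewrite lt_min d10.
have [P hP] := hardy_approx p1 fp f0 m0.
have LP : inLp p (fun t => P.[t]) by apply: trig_Lp => //; exact: trig_poly.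
have L1 h : inLp p h -> inLp 1 (fun t => h t * g t * t ^ n).
  move=> Lh; apply: (@inLp_eq R 1 (fun t => h t * (g t * t ^ n))) => //.
    by move=> t _; rewrite mulrA.
  exact: (Lp1_mul p1 pq).
have g1 : inLp 1 g by exact: Lp1_Lp (ltW q1) gq.
have a1 : cmod (cmean (fun t => f t * g t * t ^ n) - cmean (fun t => P.[t] * g t * t ^ n)) <= e / 2.
  rewrite -cmeanB; [|exact: L1|exact: L1].
  rewrite (_ : cmean _ = cmean (fun t => (f t - P.[t]) * (g t * t ^ n))).
    by apply: h1; [exact: LpB|apply: (le_trans hP); rewrite ge_min lexx].
  by apply: eq_cmean => t _; ring.
have a2 : cmod (fourier f 0 - P`_0) <= e / 2 / (c + 1).
  have -> : P`_0 = fourier (fun t => P.[t]) 0 by rewrite fourier_poly mul1r.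
  rewrite -fourierB; [|exact: Lp1_Lp (ltW p1) fp|exact: Lp1_Lp (ltW p1) LP].
  by apply: h2; [exact: LpB|apply: (le_trans hP); rewrite ge_min lexx orbT].
set X := cmean _ in a1 *.
have -> : X - (n == 0)%R%:R * (fourier f 0 * fourier g 0) =
   (X - cmean (fun t => P.[t] * g t * t ^ n)) - (n == 0)%R%:R * ((fourier f 0 - P`_0) * fourier g 0).
  by rewrite poly_mul_mean//; ring.
apply: le_trans (cmodB _ _) _; rewrite [leRHS](_ : _ = e / 2 + e / 2); last by field.
apply: lerD => //; rewrite cmodM cmodM.
apply: (@le_trans _ _ (1 * (e / 2 / (c + 1) * c))).
  apply: ler_pM; rewrite ?cmod_ge0 ?mulr_ge0 ?cmod_ge0//.
    by case: (n == 0)%R; rewrite ?cmod1 ?cmod0.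
  by apply: ler_wpM2r => //; exact: cmod_ge0.
rewrite mul1r -mulrA ger_pMr// mulrC ler_pdivrMr// mul1r lerDl//.
Qed.

Lemma spectrum_mul p q f g (a b n : int) : 1 < p -> p^-1 + q^-1 = 1 ->
  inLp p f -> inLp q g ->
  (forall n : int, n < a -> fourier f n = 0) ->
  (forall n : int, n < b -> fourier g n = 0) -> n <= a + b ->
  fourier (fun t => f t * g t) n = (n == a + b)%R%:R * (fourier f a * fourier g b).
Proof.
move=> p1 pq fp gq fa gb nab; have q1 := conj_exp_gt1 p1 pq.
have p0 : 0 <= p by lra. have q0 : 0 <= q by lra.
have := @hardy_mul p q (fun t => f t * t ^ (- a)) (fun t => g t * t ^ (- b)) (a + b - n)
  p1 pq (LpMzr _ p0 fp) (LpMzr _ q0 gq).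
rewrite !fourier_shift !opprK !add0r subr_ge0 nab => /(_ _ _ isT).
rewrite (subr_eq0 (a + b) n) [a + b == n]eq_sym => <-.
- rewrite fourierE; apply: eq_cmean => t t1.
  rewrite -!mulrA; congr (_ * _); rewrite mulrCA; congr (_ * _).
  have t0 := circ_neq0 t1; rewrite -!expfzDr//; congr (t ^ _); ring.
- by move=> m m0; rewrite fourier_shift opprK fa// -[ltRHS]add0r ltrD2r.
- by move=> m m0; rewrite fourier_shift opprK gb// -[ltRHS]add0r ltrD2r.
Qed.

Lemma lowest_coef f (a : int) : inLp 1 f -> (forall n : int, n < a -> fourier f n = 0) ->
  aeT_eq f (fun=> 0) \/
  exists b, fourier f b != 0 /\ forall n : int, n < b -> fourier f n = 0.
Proof.
move=> f1 fa; have [h|h] := pselect (exists n : nat, fourier f (a + n%:Z) != 0).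
  right; case: (ex_minnP h) => m hm mmin; exists (a + m%:Z); split => // n nm.
  have [na|na] := ltP n a; first exact: fa.
  have nE : n = a + (absz (n - a))%:Z by rewrite gez0_abs ?subr_ge0// addrCA subrr addr0.
  rewrite nE; apply/eqP; apply: contraT => /mmin; rewrite leqNgt => /negP; case.
  by rewrite -ltz_nat -(ltrD2l a) -nE.
left; apply: fourier_uniqueness => // n.
have [na|na] := ltP n a; first exact: fa.
apply/eqP; apply: contraT => fn; exfalso; apply: h; exists (absz (n - a)).
by rewrite gez0_abs ?subr_ge0// addrCA subrr addr0.
Qed.

(** The lowest coefficients of two nonzero factors multiply to a nonzero coefficient of the
    product. *)
Lemma spectrum_mul_eq0 p q f g (a b : int) : 1 < p -> p^-1 + q^-1 = 1 ->
  inLp p f -> inLp q g ->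
  (forall n : int, n < a -> fourier f n = 0) ->
  (forall n : int, n < b -> fourier g n = 0) ->
  (forall n : int, fourier (fun t => f t * g t) n = 0) ->
  aeT_eq f (fun=> 0) \/ aeT_eq g (fun=> 0).
Proof.
move=> p1 pq fp gq fa gb fg; have q1 := conj_exp_gt1 p1 pq.
have [?|[a' [fa' fa'']]] := lowest_coef (Lp1_Lp (ltW p1) fp) fa; first by left.
have [?|[b' [gb' gb'']]] := lowest_coef (Lp1_Lp (ltW q1) gq) gb; first by right.
have := spectrum_mul p1 pq fp gq fa'' gb'' (lexx _); rewrite fg eqxx mul1r => /esym/eqP.
by rewrite mulf_eq0 (negPf fa') (negPf gb').
Qed.

Lemma spectrum_mul_conj p q f g (a b n : int) : 1 < p -> p^-1 + q^-1 = 1 ->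
  inLp p f -> inLp q g ->
  (forall n : int, a < n -> fourier f n = 0) ->
  (forall n : int, b < n -> fourier g n = 0) -> a + b < n ->
  fourier (fun t => f t * g t) n = 0.
Proof.
move=> p1 pq fp gq fa gb nab; have q1 := conj_exp_gt1 p1 pq.
have p0 : 0 <= p by lra. have q0 : 0 <= q by lra.
have f1 := Lp1_Lp (ltW p1) fp; have g1 := Lp1_Lp (ltW q1) gq.
have := @spectrum_mul p q (fun t => conjc (f t)) (fun t => conjc (g t)) (- a) (- b) (- n)
  p1 pq (LpJ p0 fp) (LpJ q0 gq).
rewrite -opprD lerN2 (ltW nab) eqr_opp (gt_eqF nab) mul0r => /(_ _ _ isT) h.
have L1 := Lp1_mul p1 pq fp gq.
have : fourier (fun t => conjc (f t * g t)) (- n) = 0.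
  rewrite -[RHS]h.
  - by apply: eq_fourier => t _; rewrite rmorphM.
  - by move=> m ma; rewrite fourierJ// fa ?conjc0// -ltrN2 opprK.
  - by move=> m mb; rewrite fourierJ// gb ?conjc0// -ltrN2 opprK.
by rewrite fourierJ// opprK => /(congr1 (fun z : C => conjc z)); rewrite conjcK conjc0.
Qed.

End Spectra.

(** * Changes of variable with bounded distortion *)

Section ChangeOfVariable.
Variable R : realType.
Local Notation C := (R[i]).
Local Notation mu := (@lebesgue_measure R).
Local Notation Re := (@complex.Re R).
Local Notation Im := (@complex.Im R).
Implicit Types (f g h : C -> C) (z w t : C) (p q : R).

Opaque npow cmean fourier.

(** Lebesgue measure is an infimum over countable covers by half-open intervals, and every interval
    of a cover satisfies the bound. *)
Lemma compose_measure_le (k : R -> R) (K : R) : 0 < K ->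
  measurable_fun (@circ R) k ->
  (forall a b, a < b -> (mu (@circ R `&` k @^-1` `]a, b]) <= (K * (b - a))%:E)%E) ->
  forall X : set R, measurable X -> (mu (@circ R `&` k @^-1` X) <= K%:E * mu X)%E.
Proof.
move=> Kp mk hI X mX; have K0 := ltW Kp; have mC := @measurable_circ R.
have [->|Xoo] := eqVneq (mu X) +oo%E; first by rewrite gt0_muley ?lte_fin// leey.
apply/lee_addgt0Pr => e e0.
have eK0 : 0 < e / K by rewrite divr_gt0.
have /ereal_inf_lt[z [/= M covM sMz zXe]] : (mu X < mu X + (e / K)%:E)%E.
  by rewrite lte_spaddre ?lte_fin// ge0_fin_numE ?measure_ge0// ltey.
have mM n : measurable (M n : set R) by apply: sub_sigma_algebra; case: covM => /(_ n).
have hM n : (mu (@circ R `&` k @^-1` (M n)) <= K%:E * mu (M n))%E.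
  have /ocitvP[->|[[a b /= ab ->]]] : ocitv (M n) by case: covM => /(_ n).
    by rewrite preimage_set0 setI0 !measure0 mule0.
  by rewrite lebesgue_measure_itv/= lte_fin ab -EFinB -EFinM hI.
apply: (@le_trans _ _ (\sum_(n <oo) mu (@circ R `&` k @^-1` (M n)))%E).
  apply: measure_sigma_subadditive.
  - by move=> n; exact: mk.
  - exact: mk.
  by move=> x [xc /(cover_subset covM)[n _ Mx]]; exists n.
apply: (@le_trans _ _ (\sum_(n <oo) K%:E * mu (M n))%E).
  by apply: lee_nneseries => // n _; exact: measure_ge0.
rewrite nneseriesZl; last by move=> n _; exact: measure_ge0.
have -> : (K%:E * mu X + e%:E = K%:E * (mu X + (e / K)%:E))%E.
  rewrite ge0_muleDr ?measure_ge0 ?lee_fin ?(ltW eK0)//.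
  by rewrite -EFinM mulrC divfK// gt_eqF.
apply: lee_wpmul2l; first by rewrite lee_fin.
apply: le_trans (ltW zXe); rewrite -sMz le_eqVlt; apply/orP; left; apply/eqP.
congr (limn _); apply/funext => n; apply: eq_bigr => i _.
have /ocitvP[->|[[a b /= ab ->]]] : ocitv (M i) by case: covM => /(_ i).
  by rewrite measure0 wlength0.
by rewrite lebesgue_measure_itv/= lte_fin ab wlength_itv_bnd// ltW.
Qed.

(** The image of Lebesgue measure under [k] is dominated by [K] times Lebesgue measure, and
    integrals of nonnegative functions are monotone in the measure. *)
Lemma compose_integral_le (k : R -> R) (K : R) (F : R -> \bar R) : 0 < K ->
  measurable_fun (@circ R) k -> (forall x, circ x -> circ (k x)) ->
  (forall X : set R, measurable X -> (mu (@circ R `&` k @^-1` X) <= K%:E * mu X)%E) ->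
  measurable_fun (@circ R) F -> (forall x, circ x -> (0 <= F x)%E) ->
  (\int[mu]_(x in @circ R) F (k x) <= K%:E * \int[mu]_(x in @circ R) F x)%E.
Proof.
move=> Kp mk kc hX mF F0; have mC := @measurable_circ R.
(* The value -1 lies outside [circ], so the preimage of [circ] under [phi] is [circ] itself. *)
pose phi : measurableTypeR R -> measurableTypeR R := fun x => if x \in @circ R then k x else -1.
have m1c : ~ circ (-1 : R) by rewrite /circ/= in_itv/= => /andP[]; rewrite ler0N1.
have mphi : measurable_fun setT phi.
  apply: measurable_fun_if => //.
  - apply: (measurable_fun_bool true); rewrite setTI (_ : _ @^-1` _ = @circ R)//.
    apply/seteqP; split => x /=; first by move/set_mem.
    by move/mem_set.
  - apply: measurable_funS mk => //.
    by move=> x [_ /= /set_mem].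
have pre S : phi @^-1` S `&` @circ R = @circ R `&` k @^-1` S.
  apply/seteqP; split => x /= [h1 h2]; split => //.
    by move: h1; rewrite /phi mem_set.
  by rewrite /phi mem_set.
have prec : phi @^-1` (@circ R) = @circ R.
  apply/seteqP; split => x /=; rewrite /phi.
    by case: ifPn => [/set_mem//|_ /m1c].
  by move=> xc; rewrite mem_set//; exact: kc.
pose nu0 : {measure set (measurableTypeR R) -> \bar R} :=
  measure_function_pushforward__canonical__measure_function_Measure mu mphi.
pose nu := mrestr nu0 mC.
have Kn : 0 <= K by exact: ltW.
pose KK := NngNum Kn.
pose m2 := mscale KK mu.
have le S : measurable S -> (nu S <= m2 S)%E.
  move=> mS; rewrite /nu /mrestr /= /pushforward preimage_setI prec pre /m2 /mscale/=.
  exact: hX.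
pose F' := F \_ (@circ R).
have F'0 x : (0 <= F' x)%E by rewrite /F' /patch; case: ifPn => //; rewrite inE => /F0.
have mF' : measurable_fun setT F' by exact/(measurable_restrictT _ mC).
have E1 : (\int[mu]_(x in @circ R) F (k x) = \int[nu0]_(x in @circ R) F' x)%E.
  rewrite (ge0_integral_pushforward mphi)//; last exact: measurable_funTS.
  rewrite prec; apply: eq_integral => x xc; rewrite /= /phi xc /F' patchE.
  by rewrite ifT// inE; apply: kc; rewrite inE in xc.
have E2 : (\int[nu0]_(x in @circ R) F' x = \int[nu]_(x in @circ R) F' x)%E.
  apply: eq_measure_integral => A mA Ac; rewrite /nu /mrestr /=.
  by rewrite -[in LHS](setIidl Ac).
rewrite E1 E2; apply: le_trans (ge0_le_measure_integral le mC F'0 mF') _.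
rewrite ge0_integral_mscale//=; last exact: measurable_funTS.
rewrite lee_wpmul2l ?lee_fin// le_eqVlt; apply/orP; left; apply/eqP.
by apply: eq_integral => x xc; rewrite /F' patchE xc.
Qed.

Lemma compose_ae (k : R -> R) (K : R) (P : R -> Prop) :
  measurable_fun (@circ R) k -> (forall x, circ x -> circ (k x)) ->
  (forall X : set R, measurable X -> (mu (@circ R `&` k @^-1` X) <= K%:E * mu X)%E) ->
  {ae mu, forall x, circ x -> P x} -> {ae mu, forall x, circ x -> P (k x)}.
Proof.
move=> mk kc hX [A [mA muA hA]]; have mC := @measurable_circ R.
exists (@circ R `&` k @^-1` A); split.
- exact: mk.
- apply/eqP; rewrite eq_le measure_ge0 andbT; have := hX _ mA.
  by rewrite muA mule0.
move=> x /= h; have xc : circ x by apply: contrapT => nx; apply: h => /nx.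
split => //; apply: hA => /= H; apply: h => _; apply: H; exact: kc.
Qed.

(** * The circle involution *)

Lemma cmodB_eit_le (u v : R) : cmod (eit u - eit v) <= 2 * `|u - v|.
Proof.
wlog uv : u v / v <= u => [h|].
  have [/h//|/ltW/h] := leP v u.
  by rewrite distrC -cmodN opprB.
have [c _ hc] : exists2 c : R, c \in `[v, u]%R & cos u - cos v = (- sin c) * (u - v).
  apply: (@MVT_segment R cos (fun x => - sin x) _ _ uv).
  by apply: continuous_subspaceT => x; exact: continuous_cos.
have [d _ hd] : exists2 c : R, c \in `[v, u]%R & sin u - sin v = cos c * (u - v).
  apply: (@MVT_segment R sin cos _ _ uv).
  by apply: continuous_subspaceT => x; exact: continuous_sin.
apply: le_trans (ler_cmod_ReIm _) _; rewrite cReD cReN cImD cImN /= hc hd mulr2n mulrDl !mul1r.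
by rewrite !normrM normrN lerD// ler_piMl// ?sin_max ?cos_max// ler_norml ?cos_geN1 ?cos_le1 ?sin_geN1 ?sin_le1.
Qed.

Lemma sin_small_le (y r : R) : 0 <= y <= pi / 2 -> r < 1 -> sin y <= r / 2 -> y <= r.
Proof.
move=> /andP[y0 yp] r1 hs.
have pi0 := @pi_gt0 R.
have [c cin hc] : exists2 c : R, c \in `[0, y]%R & sin y - sin 0 = cos c * (y - 0).
  apply: (@MVT_segment R sin cos _ _ y0).
  by apply: continuous_subspaceT => x; exact: continuous_sin.
move: hc; rewrite sin0 !subr0 => hc.
have s0 : 0 <= sin y by apply: sin_ge0_pi; apply/andP; split => //; lra.
have c0 : 0 <= cos y by apply: cos_ge0_pihalf; apply/andP; split; lra.
have cy : cos y <= cos c.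
  move: cin; rewrite in_itv/= => /andP[c1 c2].
  by rewrite leNgt ltr_cos ?in_itv/= -?leNgt//; apply/andP; split; lra.
have h2 : 2^-1 <= cos y.
  have := cos2Dsin2 y; have : sin y ^+ 2 <= 4^-1 by nra.
  nra.
nra.
Qed.

(** A short chord means an angle near 0 or near 2 pi. The constant 8 exceeds 2 pi, which settles r
    >= 1; for smaller [r] the half angle, or its supplement, is at most twice its sine. *)
Lemma chord_lower (d r : R) : 0 <= d <= 2 * pi -> cmod (eit d - 1) <= r -> d <= 8 * r \/ 2 * pi - d <= 8 * r.
Proof.
move=> /andP[d0 dp] h; have r0 : 0 <= r by apply: le_trans h; exact: cmod_ge0.
have pi0 := @pi_gt0 R.
have [r1|r1] := ltP r 1; last first.
  by left; have := @pihalf_lt2 R; lra.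
set y := d / 2.
have sy : sin y <= r / 2.
  have : cmod (eit d - 1) ^+ 2 <= r ^+ 2 by rewrite ler_sqr ?nnegrE ?cmod_ge0.
  have -> : cmod (eit d - 1) ^+ 2 = (2 * sin y) ^+ 2.
    rewrite cmod_sqr cReD cReN cImD cImN /=.
    have -> : d = y *+ 2 by rewrite /y mulr2n -splitr.
    rewrite cos_mulr2n sin_mulr2n; have := cos2Dsin2 y.
    move: (cos y) (sin y) => a b ab.
    have -> : a ^+ 2 = 1 - b ^+ 2 by rewrite -ab; ring.
    have : (a * b) ^+ 2 = (1 - b ^+ 2) * b ^+ 2 by rewrite exprMn -ab; ring.
    move=> e; rewrite [LHS](_ : _ = 4 * b ^+ 4 + 4 * (a * b) ^+ 2); last by ring.
    by rewrite e; ring.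
  have s0 : 0 <= sin y by apply: sin_ge0_pi; apply/andP; rewrite /y; split; lra.
  by rewrite ler_sqr ?nnegrE//; lra.
have [yp|yp] := leP y (pi / 2).
  left; have := @sin_small_le y r; rewrite yp r1 sy /y divr_ge0// => /(_ isT isT isT); lra.
right; have := @sin_small_le (pi - y) r; rewrite addrC sinDpi sinN opprK r1 sy.
rewrite (_ : (_ <= _ <= _)%R)  => [/(_ isT isT isT)|]; first by rewrite /y; lra.
by apply/andP; rewrite /y in yp *; split; lra.
Qed.

(** The argument in [0, 2 pi]. Clipping makes the inverse cosine monotone on the whole line, hence
    measurable there. *)
Definition arg_circ (x y : R) : R :=
  let c := acos (Num.max (-1) (Num.min x 1)) in if 0 <= y then c else 2 * pi - c.

Lemma measurable_acos_clip : measurable_fun setT (fun x : R => acos (Num.max (-1) (Num.min x 1))).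
Proof.
apply: nonincreasing_measurable => // s t st.
have cl (x : R) : -1 <= Num.max (-1) (Num.min x 1) <= 1.
  by rewrite le_max lexx ge_max ge_min lexx orbT; apply/andP; split => //; lra.
have h : Num.max (-1) (Num.min s 1) <= Num.max (-1) (Num.min t 1).
  by rewrite ge_max !le_max lexx/= le_min !ge_min st lexx !orbT.
rewrite leNgt -ltr_cos ?in_itv/= ?acos_ge0 ?acos_lepi//.
by rewrite !acosK ?in_itv//= -leNgt.
Qed.

Lemma arg_circP z : cmod z = 1 ->
  eit (arg_circ (Re z) (Im z)) = z /\ circ (arg_circ (Re z) (Im z)).
Proof.
move=> z1; have h : Re z ^+ 2 + Im z ^+ 2 = 1 by rewrite -cmod_sqr z1 expr1n.
have hRe : -1 <= Re z <= 1 by rewrite -ler_norml -z1 ler_Re_cmod.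
have hs : Num.sqrt (1 - Re z ^+ 2) = `|Im z|.
  by rewrite -h addrAC subrr add0r sqrtr_sqr.
have := acos_ge0 hRe; have := acos_lepi hRe; have p0 := pi_ge0 R => a1 a0.
rewrite /arg_circ; have -> : Num.max (-1) (Num.min (Re z) 1) = Re z.
  case/andP: hRe => r1 r2; rewrite (min_idPl r2); exact: max_idPr.
have [i0|i0] := leP 0 (Im z).
  split; last by rewrite /circ/= in_itv/=; apply/andP; split => //; lra.
  apply: complex_ext => /=; first by rewrite acosK.
  by rewrite sin_acos// hs ger0_norm.
split; last by rewrite /circ/= in_itv/=; apply/andP; split; lra.
have e : 2 * pi - acos (Re z) = - acos (Re z) + pi *+ 2 by rewrite mulr2n; ring.
apply: complex_ext => /=; rewrite e.
  by rewrite cosD2pi cosN acosK.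
by rewrite sinD2pi sinN sin_acos// hs ltr0_norm// opprK.
Qed.

Lemma measurable_arg_circ f : meas_on_T f ->
  measurable_fun (@circ R) (fun x => arg_circ (Re (f (eit x))) (Im (f (eit x)))).
Proof.
move=> [mR mI]; have mC := @measurable_circ R.
have ma : measurable_fun (@circ R) (fun x => acos (Num.max (-1) (Num.min (Re (f (eit x))) 1))).
  exact: (measurableT_comp measurable_acos_clip mR).
apply: measurable_fun_if => //.
- exact: measurable_fun_ler.
- by apply: measurable_funS ma => // x [].
- by apply: measurable_funB => //; apply: measurable_funS ma => // x [].
Qed.

Section Involution.
Variable beta : C.
Hypothesis beta1 : 1 < cmod beta.
Local Notation al := (alpha beta).

Lemma den_ge t : cmod t = 1 -> cmod beta - 1 <= cmod (conjc beta * t - 1).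
Proof.
move=> t1; have := cmodD (conjc beta * t - 1) 1.
by rewrite subrK cmodM cmod_conj t1 mulr1 cmod1; lra.
Qed.

Lemma den_neq0 t : cmod t = 1 -> conjc beta * t - 1 != 0.
Proof. by move=> /den_ge h; have b1 := beta1; rewrite -cmod_eq0 gt_eqF//; lra. Qed.

Lemma den_conj t : cmod t = 1 -> conjc (conjc beta * t - 1) = - (t - beta) / t.
Proof.
move=> t1; rewrite rmorphB rmorph1 rmorphM /= conjcK (conj_circ t1).
by field; exact: circ_neq0.
Qed.

Lemma num_cmod t : cmod t = 1 -> cmod (t - beta) = cmod (conjc beta * t - 1).
Proof.
by move=> t1; rewrite -[RHS]cmod_conj den_conj// cmodM cmodV t1 invr1 mulr1 cmodN.
Qed.

Lemma num_neq0 t : cmod t = 1 -> t - beta != 0.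
Proof. by move=> t1; rewrite -cmod_eq0 num_cmod// cmod_eq0 den_neq0. Qed.

Lemma cmod_alpha t : cmod t = 1 -> cmod (al t) = 1.
Proof.
move=> t1; rewrite /alpha cmodM cmodV num_cmod// divff// cmod_eq0; exact: den_neq0.
Qed.

Lemma beta_neq : 1 - beta * conjc beta != 0.
Proof.
rewrite mulc_conj -[1](rmorph1 (real_complex R)) -rmorphB /= fmorph_eq0 subr_eq0 lt_eqF//.
by rewrite exprn_egt1.
Qed.

Lemma alphaK t : cmod t = 1 -> al (al t) = t.
Proof.
move=> t1; have d := den_neq0 t1; have d' := den_neq0 (cmod_alpha t1).
have b := beta_neq.
have E : conjc beta * al t - 1 = (1 - beta * conjc beta) / (conjc beta * t - 1).
  by rewrite /alpha; field.
rewrite {1}/alpha E /alpha; field.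
by apply/andP; split; [exact: d|exact: b].
Qed.

Definition alip : R := (cmod beta + 1) / (cmod beta - 1).

Lemma alip_gt0 : 0 < alip.
Proof. by have b1 := beta1; rewrite divr_gt0//; lra. Qed.

Lemma alpha_lip z w : cmod z = 1 -> cmod w = 1 -> cmod (al z - al w) <= alip * cmod (z - w).
Proof.
move=> z1 w1; have dz := den_neq0 z1; have dw := den_neq0 w1.
have -> : al z - al w = (beta * conjc beta - 1) / ((conjc beta * z - 1) * (conjc beta * w - 1)) * (z - w).
  by rewrite /alpha; field; apply/andP; split; [exact: dw|exact: dz].
rewrite cmodM ler_wpM2r ?cmod_ge0// cmodM cmodV cmodM.
have b1 := beta1; have B0 : 0 < cmod beta - 1 by lra.
have h := ler_pM (ltW B0) (ltW B0) (den_ge z1) (den_ge w1).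
have hn : cmod (beta * conjc beta - 1) = (cmod beta + 1) * (cmod beta - 1).
  have -> : beta * conjc beta - 1 = (cmod beta ^+ 2 - 1)%:C%C by rewrite mulc_conj rmorphB.
  rewrite cmod_real ger0_norm; first by ring.
  by rewrite subr_ge0 exprn_ege1// ltW.
rewrite hn ler_pdivrMr; last by apply: lt_le_trans h; rewrite mulr_gt0.
rewrite /alip mulrAC ler_pdivlMr// -mulrA ler_wpM2l//; last by lra.
Qed.

(** [alpha] read in the angle variable, so that the lemmas on changes of variable for subsets of the
    line apply. *)
Definition akap (x : R) : R := arg_circ (Re (al (eit x))) (Im (al (eit x))).

Lemma akapE x : eit (akap x) = al (eit x).
Proof. by case: (arg_circP (cmod_alpha (cmod_eit x))). Qed.

Lemma akap_circ x : circ (akap x).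
Proof. by case: (arg_circP (cmod_alpha (cmod_eit x))). Qed.

Lemma meas_alpha : meas_on_T al.
Proof.
apply: measM; first by apply: measB; [exact: meas_id|exact: meas_cst].
apply: meas_inv; apply: measB; last exact: meas_cst.
by apply: measM; [exact: meas_cst|exact: meas_id].
Qed.

Lemma measurable_akap : measurable_fun (@circ R) akap.
Proof. exact: measurable_arg_circ meas_alpha. Qed.

(** [alpha] is its own inverse, so its Lipschitz bound controls preimages: points sent to nearby
    angles are close on the circle. Their angles may still differ by about 2 pi, so three intervals
    of length [2 * r] are needed, and 96 = 3 * 2 * 8 * 2. *)
Lemma akap_itv (a b : R) : a < b ->
  (mu (@circ R `&` akap @^-1` `]a, b]) <= (96 * alip * (b - a))%:E)%E.
Proof.
move=> ab; have mC := @measurable_circ R; have L0 := alip_gt0.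
have mS : measurable (@circ R `&` akap @^-1` `]a, b]) by apply: measurable_akap.
have [->|/set0P[x1 [x1c x1k]]] := eqVneq (@circ R `&` akap @^-1` `]a, b]) set0.
  by rewrite measure0 lee_fin; apply: mulr_ge0; rewrite ?subr_ge0 ?ltW// mulr_gt0.
pose r := 8 * (2 * alip * (b - a)).
have r0 : 0 < r.
  by apply: mulr_gt0 => //; apply: mulr_gt0; rewrite ?subr_gt0// mulr_gt0.
pose I (c : R) : set R := `[c - r, c + r]%classic.
have muI c : mu (I c) = (2 * r)%:E.
  rewrite /I lebesgue_measure_itv/= lte_fin ifT; last by lra.
  by rewrite -EFinB; congr (_%:E); ring.
have mI c : measurable (I c) by exact: measurable_itv.
have sub : @circ R `&` akap @^-1` `]a, b] `<=` I x1 `|` (I (x1 + 2 * pi) `|` I (x1 - 2 * pi)).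
  move=> x [xc xk].
  have h1 : cmod (eit x - eit x1) <= 2 * alip * (b - a).
    rewrite -[eit x]alphaK ?cmod_eit// -[eit x1]alphaK ?cmod_eit// -(akapE x) -(akapE x1).
    apply: le_trans (alpha_lip (cmod_eit _) (cmod_eit _)) _.
    rewrite [leRHS](_ : _ = alip * (2 * (b - a))); last by ring.
    apply: ler_wpM2l; first exact: ltW.
    apply: le_trans (cmodB_eit_le _ _) _; apply: ler_wpM2l => //.
    move: xk x1k; rewrite /= !in_itv/= => /andP[? ?] /andP[? ?].
    by rewrite ler_norml; apply/andP; split; lra.
  have h2 (u v : R) : circ u -> circ v -> v <= u -> cmod (eit u - eit v) <= 2 * alip * (b - a) ->
      u - v <= r \/ 2 * pi - (u - v) <= r.
    rewrite /circ/= !in_itv/= => /andP[u0 up] /andP[v0 vp] uv huv.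
    apply: chord_lower; first by apply/andP; split; lra.
    have -> : eit (u - v) - 1 = (eit u - eit v) * eit (- v).
      by rewrite eitD mulrBl -[eit v * _]eitD subrr eit0.
    by rewrite cmodM cmod_eit mulr1.
  have [xx|/ltW xx] := leP x1 x.
    case: (h2 _ _ xc x1c xx h1) => h; [left|right; left].
      by rewrite /I/= in_itv/=; apply/andP; split; lra.
    by move: xc x1c; rewrite /I/circ/= !in_itv/= => /andP[? ?] /andP[? ?]; apply/andP; split; lra.
  rewrite -cmodN opprB in h1.
  case: (h2 _ _ x1c xc xx h1) => h; [left|right; right].
    by rewrite /I/= in_itv/=; apply/andP; split; lra.
  by move: xc x1c; rewrite /I/circ/= !in_itv/= => /andP[? ?] /andP[? ?]; apply/andP; split; lra.
have mU := measurableU _ _ (mI (x1 + 2 * pi)) (mI (x1 - 2 * pi)).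
apply: (@le_trans _ _ (mu (I x1 `|` (I (x1 + 2 * pi) `|` I (x1 - 2 * pi))))).
  apply: le_measure; [by rewrite inE|rewrite inE|exact: sub].
  exact: (measurableU _ _ (mI x1) mU).
have u1 : (mu (I x1 `|` (I (x1 + 2 * pi)%R `|` I (x1 - 2 * pi)%R)) <=
  mu (I x1) + mu (I (x1 + 2 * pi)%R `|` I (x1 - 2 * pi)%R))%E := measureU2 mu (mI x1) mU.
have u2 : (mu (I (x1 + 2 * pi)%R `|` I (x1 - 2 * pi)%R) <=
  mu (I (x1 + 2 * pi)%R) + mu (I (x1 - 2 * pi)%R))%E := measureU2 mu (mI (x1 + 2 * pi)) (mI (x1 - 2 * pi)).
apply: (le_trans u1); apply: (le_trans (leeD2l _ u2)).
by rewrite !muI -!EFinD lee_fin /r le_eqVlt; apply/orP; left; apply/eqP; ring.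
Qed.

Lemma akap_measure : forall X : set R, measurable X ->
  (mu (@circ R `&` akap @^-1` X) <= (96 * alip)%:E * mu X)%E.
Proof.
apply: compose_measure_le; [|exact: measurable_akap|exact: akap_itv].
by rewrite mulr_gt0// alip_gt0.
Qed.

Lemma aeT_alpha (P : C -> Prop) : aeT P -> aeT (fun t => P (al t)).
Proof.
move=> h; have := compose_ae measurable_akap (fun x _ => akap_circ x) akap_measure h.
move=> [A [mA A0 hA]]; exists A; split => // x /= hx; apply: hA => /= H.
by apply: hx => xc; rewrite -akapE; exact: H.
Qed.

Lemma meas_comp_alpha f : meas_on_T f -> meas_on_T (fun t => f (al t)).
Proof.
move=> [mR mI]; have mC := @measurable_circ R.
have sub : akap @` @circ R `<=` @circ R by move=> _ [x _ <-]; exact: akap_circ.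
split.
  apply: (eq_measurable_fun (fun x => Re (f (eit (akap x))))).
    by move=> x _; rewrite akapE.
  exact: (measurable_comp mC sub mR measurable_akap).
apply: (eq_measurable_fun (fun x => Im (f (eit (akap x))))).
  by move=> x _; rewrite akapE.
exact: (measurable_comp mC sub mI measurable_akap).
Qed.

Lemma pint_alpha p f : meas_on_T f ->
  (pint p (fun t => f (al t)) <= (96 * alip)%:E * pint p f)%E.
Proof.
move=> mf; have L0 : 0 < 96 * alip by rewrite mulr_gt0// alip_gt0.
have := compose_integral_le L0 measurable_akap (fun x _ => akap_circ x) akap_measure
  (meas_cmodX p mf).
rewrite /pint; under [X in (_ -> X <= _)%E -> _]eq_integral do rewrite akapE.
by apply => x _; rewrite lee_fin powR_ge0.
Qed.

Lemma Lp_alpha p f : inLp p f -> inLp p (fun t => f (al t)).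
Proof.
move=> /LpP[mf fi]; apply/LpP; split; first exact: meas_comp_alpha.
apply: le_lt_trans (pint_alpha p mf) _; rewrite lte_mul_pinfty// lee_fin mulr_ge0//.
exact: ltW alip_gt0.
Qed.

Lemma npow_alpha p f : inLp p f -> npow p (fun t => f (al t)) <= 96 * alip * npow p f.
Proof.
move=> Lf; have := pint_alpha p (Lp_meas Lf).
by rewrite (pintE Lf) (pintE (Lp_alpha Lf)) -EFinM lee_fin.
Qed.

End Involution.

End ChangeOfVariable.

(** * The weighted composition operator *)

Section WeightedComposition.
Variable R : realType.
Local Notation C := (R[i]).
Local Notation mu := (@lebesgue_measure R).
Local Notation Re := (@complex.Re R).
Local Notation Im := (@complex.Im R).
Implicit Types (f g h : C -> C) (z w t : C) (p q : R).

Opaque npow cmean fourier.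

Definition Bdd f : Prop := meas_on_T f /\ exists M : R, forall t, cmod t = 1 -> cmod (f t) <= M.

Definition spec_le f (m : int) := forall n : int, m < n -> fourier f n = 0.
Definition spec_ge f (m : int) := forall n : int, n < m -> fourier f n = 0.

Lemma Bdd_Lp p f : 0 <= p -> Bdd f -> inLp p f.
Proof. by move=> p0 [mf [M hM]]; apply: (@Lp_bdd R p f M) => //; exact: aeTW. Qed.

Lemma BddM f g : Bdd f -> Bdd g -> Bdd (fun t => f t * g t).
Proof.
move=> [mf [M hM]] [mg [N hN]]; split; first exact: measM.
exists (M * N) => t t1; rewrite cmodM; apply: ler_pM; rewrite ?cmod_ge0//.
  exact: hM.
exact: hN.
Qed.

Lemma BddMl p f g : 0 <= p -> Bdd f -> inLp p g -> inLp p (fun t => f t * g t).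
Proof. by move=> p0 [mf [M hM]]; apply: LpM => //; exact: aeTW hM. Qed.

Lemma BddMr p f g : 0 <= p -> Bdd f -> inLp p g -> inLp p (fun t => g t * f t).
Proof.
move=> p0 fB gp; apply: (@inLp_eq R p (fun t => f t * g t)) => //.
  by move=> t _; rewrite mulrC.
exact: BddMl.
Qed.

Lemma BddJ f : Bdd f -> Bdd (fun t => conjc (f t)).
Proof.
move=> [mf [M hM]]; split; first exact: measJ.
by exists M => t t1; rewrite cmod_conj hM.
Qed.

Lemma Bdd_trig f : trig f -> Bdd f.
Proof. by move=> tf; split; [exact: trig_meas|exact: trig_bdd]. Qed.

Lemma Bdd_eq f g : (forall t, cmod t = 1 -> f t = g t) -> Bdd f -> Bdd g.
Proof.
move=> fg [mf [M hM]]; split.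
  by apply: meas_eq mf => x; apply: fg; exact: cmod_eit.
by exists M => t t1; rewrite -fg// hM.
Qed.

Lemma spec_le_eq f g m : (forall t, cmod t = 1 -> f t = g t) -> spec_le f m -> spec_le g m.
Proof. by move=> fg h n mn; rewrite -(eq_fourier n fg) h. Qed.

Lemma spec_leZ z f m : inLp 1 f -> spec_le f m -> spec_le (fun t => z * f t) m.
Proof. by move=> f1 h n mn; rewrite fourierZ// h// mulr0. Qed.

Lemma spec_geZ z f m : inLp 1 f -> spec_ge f m -> spec_ge (fun t => z * f t) m.
Proof. by move=> f1 h n mn; rewrite fourierZ// h// mulr0. Qed.

Lemma spec_geJ f m : inLp 1 f -> spec_le f m -> spec_ge (fun t => conjc (f t)) (- m).
Proof.
by move=> f1 h n nm; rewrite fourierJ// h ?conjc0//; rewrite ltrNr.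
Qed.

Lemma spec_leJ f m : inLp 1 f -> spec_ge f m -> spec_le (fun t => conjc (f t)) (- m).
Proof.
by move=> f1 h n nm; rewrite fourierJ// h ?conjc0//; rewrite ltrNl.
Qed.

Lemma spec_geW f m m' : m' <= m -> spec_ge f m -> spec_ge f m'.
Proof. by move=> mm h n nm; apply: h; exact: lt_le_trans mm. Qed.

Lemma spec_le_expz (k : int) : spec_le (fun t => t ^ k) k.
Proof.
move=> n kn; rewrite fourierE (_ : cmean _ = cmean (fun t : C => t ^ (k - n))).
  by rewrite cmean_expz subr_eq0 lt_eqF.
by apply: eq_cmean => t t1; rewrite expfzDr ?circ_neq0.
Qed.

Lemma spec_ge_expz (k : int) : spec_ge (fun t => t ^ k) k.
Proof.
move=> n kn; rewrite fourierE (_ : cmean _ = cmean (fun t : C => t ^ (k - n))).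
  by rewrite cmean_expz subr_eq0 gt_eqF.
by apply: eq_cmean => t t1; rewrite expfzDr ?circ_neq0.
Qed.

Lemma spec_leM p q f g (a b : int) : 1 < p -> p^-1 + q^-1 = 1 -> inLp p f -> inLp q g ->
  spec_le f a -> spec_le g b -> spec_le (fun t => f t * g t) (a + b).
Proof. by move=> p1 pq fp gq fa gb n; exact: (spectrum_mul_conj p1 pq fp gq fa gb). Qed.

Lemma spec_geM p q f g (a b : int) : 1 < p -> p^-1 + q^-1 = 1 -> inLp p f -> inLp q g ->
  spec_ge f a -> spec_ge g b -> spec_ge (fun t => f t * g t) (a + b).
Proof.
move=> p1 pq fp gq fa gb n nab.
by rewrite (spectrum_mul p1 pq fp gq fa gb (ltW nab)) lt_eqF// mul0r.
Qed.

Lemma cmean_fourier0 f : cmean f = fourier f 0.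
Proof. by rewrite fourierE; apply: eq_cmean => t _; rewrite oppr0 expr0z mulr1. Qed.

Lemma spec_leM_bdd f g (a b : int) : Bdd f -> Bdd g ->
  spec_le f a -> spec_le g b -> spec_le (fun t => f t * g t) (a + b).
Proof. by move=> Bf Bg; apply: (spec_leM (ltr1n R 2) (conj_exp2 R)); exact: Bdd_Lp. Qed.

Lemma spec_leX f n : Bdd f -> spec_le f 0 -> Bdd (fun t => f t ^+ n) /\ spec_le (fun t => f t ^+ n) 0.
Proof.
move=> Bf f0; elim: n => [|n [B h]].
  split; first by apply: (Bdd_eq (f := fun=> 1)) => //; exact/Bdd_trig/trig_cst.
  apply: (spec_le_eq (f := fun t => t ^ 0)); last exact: spec_le_expz.
  by move=> t _; rewrite expr0z expr0.
split; first by apply: Bdd_eq (BddM Bf B) => t _; rewrite exprS.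
rewrite -[X in spec_le _ X]addr0.
apply: (spec_le_eq (f := fun t => f t * f t ^+ n)); last exact: spec_leM_bdd.
by move=> t _; rewrite exprS.
Qed.

Section Weighted.
Variable beta : C.
Hypothesis beta1 : 1 < cmod beta.
Local Notation al := (alpha beta).
Local Notation chi := (chi beta).
Local Notation J := (Jalpha beta).

Definition cauchy_den t : C := (conjc beta * t - 1)^-1.
Local Notation u := cauchy_den.

Lemma Bdd_u : Bdd u.
Proof.
split.
  apply: meas_inv; apply: measB; last exact: meas_cst.
  by apply: measM; [exact: meas_cst|exact: meas_id].
exists (cmod beta - 1)^-1 => t t1; have b1 := beta1.
have h := den_ge beta t1; rewrite cmodV lef_pV2// posrE; lra.
Qed.

Lemma u_L1 : inLp 1 u. Proof. by apply: Bdd_Lp => //; exact: Bdd_u. Qed.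

(* (conj beta t - 1) u = 1 gives the recursion u^(n+1) = conj beta u^(n) for n >= 0, and
   |conj beta| > 1 while Fourier coefficients are bounded. *)
Lemma spec_u : spec_le u (-1).
Proof.
have rec (n : nat) : fourier u n.+1 = conjc beta * fourier u n.
  have h : fourier (fun t => conjc beta * (u t * t ^ 1) - u t) n.+1 = 0.
    rewrite -[RHS](@spec_le_expz 0 n.+1 isT); apply: eq_fourier => t t1.
    rewrite expr1z expr0z /cauchy_den.
    have d := den_neq0 beta1 t1.
    by field.
  have u1 := u_L1; have u1t : inLp 1 (fun t => u t * t ^ 1) by exact: Lp1_mulz.
  rewrite fourierB// in h; last exact: LpZ.
  rewrite fourierZ// fourier_shift -addn1 PoszD addrK in h.
  by apply/eqP; rewrite eq_sym -subr_eq0 -addn1; apply/eqP.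
have pw (n : nat) : fourier u n = conjc beta ^+ n * fourier u 0.
  by elim: n => [|n ih]; rewrite ?mul1r// rec ih exprS mulrA.
have [M hM] : exists M : R, forall n : int, cmod (fourier u n) <= M.
  exists (npow 1 u) => n; rewrite fourierE.
  apply: le_trans (cmean_npow (Lp1_mulz _ u_L1)) _; rewrite -[leRHS]mul1r.
  apply: npow_le1 => //; [exact: Lp1_mulz u_L1|exact: u_L1|].
  by apply: aeTW => t t1; rewrite cmodM cmod_expz// mulr1 mul1r.
have b1 := beta1.
have u0 : fourier u 0 = 0.
  apply: cmod_small0 => e e0.
  have M0 : 0 <= M := le_trans (cmod_ge0 _) (hM 0).
  have r01 : 0 <= (cmod beta)^-1 < 1.
    by rewrite invr_ge0 cmod_ge0/= invf_lt1//; lra.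
  have [n hn] := cvg_geometric_lt r01 M0 e0.
  apply: le_trans hn; have := hM n; rewrite pw cmodM cmodX cmod_conj exprVn.
  by rewrite ler_pdivlMr ?exprn_gt0 1?mulrC//; lra.
move=> n; rewrite -lezD1 addNr => n0; have -> : n = (absz n)%:Z by rewrite gez0_abs.
by rewrite pw u0 mulr0.
Qed.

(** Affine in [cauchy_den], which has only negative frequencies; hence [alpha] and its powers have
    no positive ones. *)
Lemma alphaE t : cmod t = 1 -> al t = (conjc beta)^-1 + ((conjc beta)^-1 - beta) * u t.
Proof.
move=> t1; rewrite /alpha /cauchy_den; have d := den_neq0 beta1 t1; field.
have b1 := beta1; have cb : conjc beta != 0 by rewrite -cmod_eq0 cmod_conj gt_eqF//; lra.
by apply/andP; split; [exact: d|exact: cb].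
Qed.

Lemma Bdd_alpha : Bdd al.
Proof. by split; [exact: meas_alpha|exists 1 => t t1; rewrite cmod_alpha]. Qed.

Lemma spec_alpha : spec_le al 0.
Proof.
move=> n n0; rewrite (eq_fourier n alphaE) fourierD; last 2 first.
- exact: Lp_cst.
- by apply: LpZ => //; exact: u_L1.
rewrite [X in _ + X]fourierZ; last exact: u_L1.
rewrite spec_u ?(lt_trans _ n0)// mulr0 addr0.
rewrite (_ : fourier _ n = fourier (fun t => (conjc beta)^-1 * t ^ 0) n); last first.
  by apply: eq_fourier => t _; rewrite expr0z mulr1.
by apply: (spec_leZ _ _ (@spec_le_expz 0) n0); apply: trig_Lp => //; exact: trig_expz.
Qed.

Lemma alpha_neq0 t : cmod t = 1 -> al t != 0.
Proof. by move=> t1; rewrite -cmod_eq0 (cmod_alpha beta1 t1) oner_eq0. Qed.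

Lemma alphaX_le n : Bdd (fun t => al t ^+ n) /\ spec_le (fun t => al t ^+ n) 0.
Proof. exact: spec_leX Bdd_alpha spec_alpha. Qed.

Lemma alphaX_conj n t : cmod t = 1 -> conjc (al t ^+ n) = al t ^- n.
Proof. by move=> t1; rewrite rmorphXn /= conj_circ ?(cmod_alpha beta1 t1)// exprVn. Qed.

(** Analytic because its pole [beta] lies outside the closed disc; it satisfies
    [alpha * num_inv = beta * u] on the circle. *)
Definition num_inv t : C := beta / (t - beta).

Lemma num_invE t : cmod t = 1 -> num_inv t = - 1 - conjc (u t).
Proof.
move=> t1; rewrite /num_inv /cauchy_den conjc_inv (den_conj beta t1).
have n0 := num_neq0 beta1 t1; have t0 := circ_neq0 t1.
by field; rewrite n0 t0.
Qed.

Lemma Bdd_num_inv : Bdd num_inv.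
Proof.
have [mu_ [M hM]] := Bdd_u; split.
  apply: measM; first exact: meas_cst.
  by apply: meas_inv; apply: measB; [exact: meas_id|exact: meas_cst].
exists (1 + M) => t t1; rewrite num_invE//; apply: le_trans (cmodB _ _) _.
by rewrite cmodN cmod1 cmod_conj lerD2l hM.
Qed.

Lemma fourier_num_inv (n : int) : fourier num_inv n = - (n == 0)%R%:R - conjc (fourier u (- n)).
Proof.
rewrite (eq_fourier n num_invE) fourierB; last 2 first.
- exact: Lp_cst.
- by apply: LpJ => //; exact: u_L1.
rewrite fourierJ; last exact: u_L1.
congr (_ - _); rewrite fourierE (_ : cmean _ = cmean (fun t : C => -1 * t ^ (- n))).
  rewrite cmeanZ ?cmean_expz ?oppr_eq0 ?mulN1r//.
  by apply: trig_Lp => //; exact: trig_expz.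
by apply: eq_cmean.
Qed.

Lemma spec_num_inv : spec_ge num_inv 0.
Proof.
move=> n n0; rewrite fourier_num_inv lt_eqF// oppr0 sub0r spec_u ?conjc0 ?oppr0//.
by rewrite (@lt_trans _ _ 0)// oppr_gt0.
Qed.

(** The Jacobian of [alpha] on the circle, split into antianalytic and analytic parts; it is the
    Poisson kernel (|beta|^2 - 1) / |conj beta t - 1|^2. *)
Definition omega t : C := u t - num_inv t.

Lemma Bdd_omega : Bdd omega.
Proof.
have [m1 [M1 h1]] := Bdd_u; have [m2 [M2 h2]] := Bdd_num_inv.
split; first exact: measB.
exists (M1 + M2) => t t1; apply: le_trans (cmodB _ _) _; apply: lerD; [exact: h1|exact: h2].
Qed.

Lemma omega_real t : cmod t = 1 -> conjc (omega t) = omega t.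
Proof.
move=> t1; rewrite /omega num_invE// rmorphB rmorphB rmorphN rmorph1 /= conjcK.
by rewrite !opprB !opprK; ring.
Qed.

(** The change of variables for powers, read off from spectra: the product of a power of [alpha]
    with [u] has only negative frequencies, and in the product with [num_inv] one factor [alpha]
    turns [num_inv] into [beta * u]. *)
Lemma cmean_alphaX_omega n : cmean (fun t => al t ^+ n * omega t) = (n == 0)%N%:R.
Proof.
have [Ba sa] := alphaX_le n.
have L (h : C -> C) : Bdd h -> inLp 1 h by exact: Bdd_Lp.
have Bu := Bdd_u; have Bn := Bdd_num_inv.
rewrite (_ : cmean _ = cmean (fun t => al t ^+ n * u t - al t ^+ n * num_inv t)); last first.
  by apply: eq_cmean => t _; rewrite mulrBr.
rewrite cmeanB; [|exact/L/BddM|exact/L/BddM].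
rewrite cmean_fourier0 (spec_leM_bdd Ba Bu sa spec_u)// sub0r.
case: n Ba sa => [|n] Ba sa.
  rewrite (_ : cmean _ = cmean num_inv); last by apply: eq_cmean => t _; rewrite expr0 mul1r.
  by rewrite cmean_fourier0 fourier_num_inv eqxx oppr0 spec_u// conjc0 subr0 opprK.
rewrite (_ : cmean _ = cmean (fun t => beta * (al t ^+ n * u t))); last first.
  apply: eq_cmean => t t1; rewrite exprSr /num_inv {2}/alpha /cauchy_den.
  by have n0 := num_neq0 beta1 t1; have d := den_neq0 beta1 t1; field; rewrite n0 d.
have [Ba' sa'] := alphaX_le n.
rewrite cmeanZ; last exact/L/BddM.
by rewrite cmean_fourier0 (spec_leM_bdd Ba' Bu sa' spec_u)// mulr0 oppr0.
Qed.

(** Negative exponents follow by conjugation, since [omega] is real and [alpha] unimodular on the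
    circle. *)
Lemma cmean_alpha_expz_omega (n : int) : cmean (fun t => al t ^ n * omega t) = (n == 0)%R%:R.
Proof.
case: n => n; first exact: cmean_alphaX_omega.
rewrite -[LHS]conjcK -cmeanJ; last first.
  apply: (@inLp_eq R 1 (fun t => conjc (al t ^+ n.+1) * omega t)) => //.
    by move=> t t1; rewrite alphaX_conj// NegzE exprnN.
  apply: Bdd_Lp => //; apply: BddM Bdd_omega; apply: BddJ; by case: (alphaX_le n.+1).
rewrite (_ : cmean _ = cmean (fun t => al t ^+ n.+1 * omega t)).
  by rewrite cmean_alphaX_omega conjc0.
apply: eq_cmean => t t1; rewrite rmorphM /= omega_real// NegzE -exprnN.
by rewrite -alphaX_conj// conjcK.
Qed.

Lemma cmean_alpha_trig g : trig g -> cmean (fun t => g (al t) * omega t) = cmean g.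
Proof.
move=> [n [P gP]].
have L (h : C -> C) : Bdd h -> inLp 1 h by exact: Bdd_Lp.
have Baz (k : int) : Bdd (fun t => al t ^ k * omega t).
  split; first (apply: measM; last by case: Bdd_omega).
    have [m|m] := leP 0 k.
      apply: (@meas_eq R (fun t => al t ^+ absz k)); first by move=> x; rewrite -{2}(gez0_abs m).
      by apply: measX; exact: meas_alpha.
    apply: (@meas_eq R (fun t => (al t ^+ absz k)^-1)).
      by move=> x; rewrite -{2}[k]opprK -(ltz0_abs m) exprnN.
    by apply: meas_inv; apply: measX; exact: meas_alpha.
  have [_ [M hM]] := Bdd_omega; exists M => t t1.
  by rewrite cmodM cmod_expz ?(cmod_alpha beta1 t1)// mul1r hM.
have gE t : cmod t = 1 -> g t = \sum_(i < size P) P`_i * t ^ (i%:Z - n%:Z).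
  move=> t1; rewrite gP// horner_coef mulr_sumr; apply: eq_bigr => i _.
  by rewrite expfzDr ?circ_neq0// -exprnN -exprnP; ring.
have sumE (k : nat) (F : nat -> C -> C) : (forall i, inLp 1 (F i)) ->
    inLp 1 (fun t => \sum_(i < k) P`_i * F i t) /\
    cmean (fun t => \sum_(i < k) P`_i * F i t) = \sum_(i < k) P`_i * cmean (F i).
  move=> hF; elim: k => [|k [L1 ih]].
    split; first by apply: (@inLp_eq R 1 (fun=> 0)) => [//|t _|]; rewrite ?big_ord0//; exact: Lp_cst.
    rewrite big_ord0 -[RHS](cmean_cst (0 : C)); apply: eq_cmean => t _; by rewrite big_ord0.
  split.
    apply: (@inLp_eq R 1 (fun t => \sum_(i < k) P`_i * F i t + P`_k * F k t)) => //.
      by move=> t _; rewrite big_ord_recr.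
    by apply: LpD => //; exact: LpZ.
  rewrite big_ord_recr /= -ih -cmeanZ// -cmeanD//; last exact: LpZ.
  by apply: eq_cmean => t _; rewrite big_ord_recr.
have [_ e1] := sumE (size P) (fun i t => t ^ (i%:Z - n%:Z))
  (fun i => trig_Lp ler01 (trig_expz R _)).
have [_ e2] := sumE (size P) (fun i t => al t ^ (i%:Z - n%:Z) * omega t) (fun i => L _ (Baz _)).
rewrite (eq_cmean gE) e1.
rewrite (_ : cmean _ = cmean (fun t => \sum_(i < size P) P`_i * (al t ^ (i%:Z - n%:Z) * omega t))).
  by rewrite e2; apply: eq_bigr => i _; rewrite cmean_alpha_expz_omega cmean_expz.
apply: eq_cmean => t t1; rewrite gE ?(cmod_alpha beta1 t1)// mulr_suml.
by apply: eq_bigr => i _; rewrite mulrA.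
Qed.

(** Density of trigonometric polynomials; [npow_alpha] keeps the composite with [alpha] close as
    well. *)
Lemma cmean_alpha p g : 1 < p -> inLp p g -> cmean (fun t => g (al t) * omega t) = cmean g.
Proof.
move=> p1 gp; have p0 : 0 <= p by lra.
pose q := p / (p - 1); have pq : p^-1 + q^-1 = 1 by exact: conj_expE.
have q0 : 0 <= q by have := conj_exp_gt1 p1 pq; lra.
have Lw : inLp q omega by apply: Bdd_Lp => //; exact: Bdd_omega.
have A0 := alip_gt0 beta1; pose K := 96 * alip beta.
have K0 : 0 <= K by rewrite mulr_ge0// ltW.
apply/eqP; rewrite -subr_eq0; apply/eqP; apply: cmod_small0 => e e0.
have e20 : 0 < e / 2 by rewrite divr_gt0.
have [d1 d10 h1] := pairing_small p1 pq Lw e20.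
have [d2 d20 h2] := fourier_small 0 p1 e20.
have m0 : 0 < Num.min (d1 / (K + 1)) d2 by rewrite lt_min d20 divr_gt0// ltr_wpDl.
have [h th hh] := trig_dense p1 gp m0.
have Lh : inLp p h by exact: trig_Lp.
have Ld := LpB p0 gp Lh.
have L1 (k : C -> C) : inLp p k -> inLp 1 (fun t => k (al t) * omega t).
  by move=> Lk; apply: (Lp1_mul p1 pq) => //; exact: Lp_alpha.
have a1 : cmod (cmean (fun t => g (al t) * omega t) - cmean (fun t => h (al t) * omega t)) <= e / 2.
  rewrite -cmeanB; [|exact: L1|exact: L1].
  rewrite (_ : cmean _ = cmean (fun t => (fun t => g t - h t) (al t) * omega t)); last first.
    by apply: eq_cmean => t _; rewrite mulrBl.
  apply: h1; first exact: (Lp_alpha beta1 Ld).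
  apply: le_trans (npow_alpha beta1 Ld) _; rewrite -/K.
  apply: (@le_trans _ _ (K * (d1 / (K + 1)))).
    by apply: ler_wpM2l => //; apply: (le_trans (ltW hh)); rewrite ge_min lexx.
  rewrite mulrCA ger_pMr// ler_pdivrMr ?ltr_wpDl// mul1r lerDl//.
have a2 : cmod (cmean g - cmean h) <= e / 2.
  rewrite -cmeanB; [|exact: Lp1_Lp (ltW p1) gp|exact: Lp1_Lp (ltW p1) Lh].
  rewrite cmean_fourier0; apply: h2 => //.
  by apply: (le_trans (ltW hh)); rewrite ge_min lexx orbT.
have -> : cmean (fun t => g (al t) * omega t) - cmean g =
    (cmean (fun t => g (al t) * omega t) - cmean (fun t => h (al t) * omega t)) - (cmean g - cmean h).
  by rewrite (cmean_alpha_trig th); ring.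
apply: le_trans (cmodB _ _) _; rewrite [leRHS](_ : _ = e / 2 + e / 2); last by field.
exact: lerD.
Qed.

Lemma lam_sqr : lam beta ^+ 2 = 1 - beta * conjc beta.
Proof.
rewrite /lam exprMn -rmorphXn /= sqr_sqrtr; last first.
  by rewrite subr_ge0 exprn_ege1// ltW.
by rewrite mulc_conj sqr_i mulN1r rmorphB opprB.
Qed.

Lemma lam_neq0 : lam beta != 0.
Proof. by rewrite -sqrf_eq0 lam_sqr; exact: beta_neq. Qed.

Lemma chiE t : cmod t = 1 -> chi t = (conjc beta * t - 1) / lam beta.
Proof.
move=> t1; rewrite /Defs.chi /alpha_minus; have t0 := circ_neq0 t1.
have d := den_neq0 beta1 t1; have l0 := lam_neq0.
by field; rewrite t0 d l0.
Qed.

Lemma chi_neq0 t : cmod t = 1 -> chi t != 0.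
Proof.
by move=> t1; rewrite chiE// mulf_neq0 ?invr_eq0 ?lam_neq0// den_neq0.
Qed.

Lemma chiV t : cmod t = 1 -> (chi t)^-1 = lam beta * u t.
Proof. by move=> t1; rewrite chiE// invf_div. Qed.

(** The normalisation by [lam] is made for this: [conjc beta * t - 1] and its composite with [alpha]
    multiply to 1 - |beta|^2, the square of [lam beta]. *)
Lemma chi_alpha t : cmod t = 1 -> chi (al t) = (chi t)^-1.
Proof.
move=> t1; rewrite chiE ?(cmod_alpha beta1 t1)// chiV// /cauchy_den.
have d := den_neq0 beta1 t1; have l0 := lam_neq0.
apply: (mulIf l0); rewrite mulfVK// mulrAC -expr2 lam_sqr /alpha.
by field.
Qed.

Lemma Bdd_chi : Bdd chi.
Proof.
apply: (Bdd_eq (f := fun t => (conjc beta *: 'X - 1%:P).[t] * (lam beta)^-1)).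
  by move=> t t1; rewrite chiE// !hornerE.
by apply: Bdd_trig; apply: trigM; [exact: trig_poly|exact: trig_cst].
Qed.

Lemma Bdd_chiV : Bdd (fun t => (chi t)^-1).
Proof.
apply: (Bdd_eq (f := fun t => lam beta * u t)); first by move=> t t1; rewrite chiV.
by apply: BddM Bdd_u; apply: Bdd_trig; exact: trig_cst.
Qed.

Lemma spec_chiV : spec_le (fun t => (chi t)^-1) (-1).
Proof.
apply: (spec_le_eq (f := fun t => lam beta * u t)); first by move=> t t1; rewrite chiV.
by apply: spec_leZ; [exact: u_L1|exact: spec_u].
Qed.

Lemma chi_split t : cmod t = 1 -> chi t = conjc beta / lam beta * t ^ 1 - (lam beta)^-1 * t ^ 0.
Proof. by move=> t1; rewrite chiE// expr1z expr0z; field; exact: lam_neq0. Qed.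

Lemma spec_chi : spec_ge chi 0 /\ spec_le chi 1.
Proof.
have T (k : int) z : inLp 1 (fun t => z * t ^ k).
  by apply: LpZ => //; apply: trig_Lp => //; exact: trig_expz.
have T1 (k : int) : inLp 1 (fun t => t ^ k) by apply: trig_Lp => //; exact: trig_expz.
split=> n nn; rewrite (eq_fourier n chi_split) fourierB// !fourierZ//.
  by rewrite !spec_ge_expz ?mulr0 ?subr0// (lt_trans nn).
by rewrite !spec_le_expz ?mulr0 ?subr0// (lt_trans _ nn).
Qed.

Lemma JK f t : cmod t = 1 -> J (J f) t = f t.
Proof.
move=> t1; rewrite /Jalpha chi_alpha// invrK mulrA mulVf ?chi_neq0// mul1r.
by rewrite alphaK.
Qed.

Lemma Lp_J p f : 0 <= p -> inLp p f -> inLp p (J f).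
Proof. by move=> p0 fp; apply: (BddMl p0 Bdd_chiV (Lp_alpha beta1 fp)). Qed.

Lemma J_ae f g : aeT_eq f g -> aeT_eq (J f) (J g).
Proof.
move=> fg; have h := aeT_alpha beta1 (P := fun t => f t = g t) fg.
by apply: (aeT_eqS (f := fun t => f (al t)) (g := fun t => g (al t))) h => t _ e; rewrite /Jalpha e.
Qed.

(* Since omega = t chi^-2 / alpha, this is the change of variables t |-> alpha t. *)
Lemma cmean_J p f g h : 1 < p -> inLp p (fun t => f t * (t * J h t)) ->
  (forall t, cmod t = 1 -> h t = t^-1 * g t) ->
  cmean (fun t => J f t * g t) = cmean (fun t => f t * (t * J h t)).
Proof.
move=> p1 Lf hg; rewrite -(cmean_alpha p1 Lf); apply: eq_cmean => t t1.
have a1 := cmod_alpha beta1 t1.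
rewrite /Jalpha chi_alpha// alphaK// invrK hg// /omega /num_inv /cauchy_den chiE// /alpha.
have n0 := num_neq0 beta1 t1; have d := den_neq0 beta1 t1; have l0 := lam_neq0.
have t0 := circ_neq0 t1.
have l2 : lam beta * lam beta = 1 - beta * conjc beta by rewrite -expr2 lam_sqr.
rewrite (_ : (conjc beta * t - 1)^-1 - beta / (t - beta) =
   t * (lam beta * lam beta) / ((conjc beta * t - 1) * (t - beta))); last first.
  by rewrite l2; field; rewrite n0 d.
by field; rewrite n0 d l0 t0.
Qed.

(** A change of variable turns the coefficient at n >= 0 into the mean of [f] times a multiple of
    [t * k] with [k] analytic, a product without constant term. *)
Lemma spec_J_hardy p f : 1 < p -> inLp p f -> spec_ge f 0 -> spec_le (J f) (-1).
Proof.
move=> p1 fp f0; have p0 : 0 <= p by lra.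
pose q := p / (p - 1); have pq : p^-1 + q^-1 = 1 by exact: conj_expE.
have q0 : 0 <= q by have := conj_exp_gt1 p1 pq; lra.
move=> n; rewrite -lezD1 addNr => n0.
pose m := absz n; have nm : n = m%:Z by rewrite /m gez0_abs.
(* [cmean_J] asks for the quotient by [t] of the function paired with [J f], which is
   [t ^ (- n)]. *)
pose h t : C := t ^ (- n - 1).
pose k t : C := num_inv t * conjc (al t ^+ m).
have hE t : cmod t = 1 -> t * J h t = lam beta / beta * (t ^ 1 * k t).
  move=> t1; have b0 : beta != 0 by rewrite -cmod_eq0 gt_eqF//; have b1 := beta1; lra.
  rewrite /Jalpha /h /k chiV// -opprD nm -[X in _ + X]/(1%:Z) -PoszD -exprnN addn1.
  have aE : (al t)^-1 = (conjc beta * t - 1) / (t - beta) by rewrite /alpha invf_div.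
  rewrite alphaX_conj// exprSr invfM aE /num_inv /cauchy_den expr1z.
  have n1 := num_neq0 beta1 t1; have d := den_neq0 beta1 t1.
  have a0 : al t ^- m != 0 by rewrite invr_eq0 expf_neq0// alpha_neq0.
  by move: (al t ^- m) => X; field; rewrite n1 d b0.
have Ba := BddJ (alphaX_le m).1.
have Bk : Bdd k by apply: BddM Ba; exact: Bdd_num_inv.
have sk : spec_ge k 0.
  have L2 (v : C -> C) : Bdd v -> inLp 2 v by exact: Bdd_Lp.
  have sJ := spec_geJ (Bdd_Lp ler01 (alphaX_le m).1) (alphaX_le m).2.
  rewrite oppr0 in sJ.
  rewrite -[0]addr0.
  by apply: (spec_geM (ltr1n R 2) (conj_exp2 R) (L2 _ Bdd_num_inv) (L2 _ Ba)) => //; exact: spec_num_inv.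
have Btk : Bdd (fun t => t ^ 1 * k t) by apply: BddM Bk; apply: Bdd_trig; exact: trig_expz.
have stk : spec_ge (fun t => t ^ 1 * k t) 1.
  move=> i i1; rewrite (eq_fourier (g := fun t => k t * t ^ 1)); last by move=> t _; rewrite mulrC.
  by rewrite fourier_shift sk// subr_lt0.
have BF : Bdd (fun t => t * J h t).
  apply: (Bdd_eq (f := fun t => lam beta / beta * (t ^ 1 * k t))) => [t t1|]; first by rewrite hE.
  by apply: BddM Btk; apply: Bdd_trig; exact: trig_cst.
rewrite fourierE (@cmean_J p f (fun t => t ^ (- n)) h p1).
- rewrite (_ : cmean _ = cmean (fun t => f t * (lam beta / beta * (t ^ 1 * k t)))); last first.
    by apply: eq_cmean => t t1; rewrite hE.
  rewrite (_ : cmean _ = cmean (fun t => lam beta / beta * (f t * (t ^ 1 * k t)))); last first.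
    by apply: eq_cmean => t _; ring.
  have Ltk : inLp q (fun t => t ^ 1 * k t) by exact: Bdd_Lp.
  rewrite cmeanZ; last exact: (Lp1_mul p1 pq).
  by rewrite cmean_fourier0 (spec_geM p1 pq fp Ltk f0 stk) ?mulr0.
- exact: BddMr.
- by move=> t t1; rewrite /h mulrC -exprN1 expfzDr ?circ_neq0.
Qed.

(** The mirror image for n < 0, with powers of [alpha] unconjugated: now [t * k] has no positive
    frequencies, while those of [f] are all negative. *)
Lemma spec_J_anti p f : 1 < p -> inLp p f -> spec_le f (-1) -> spec_ge (J f) 0.
Proof.
move=> p1 fp f0; have p0 : 0 <= p by lra.
pose q := p / (p - 1); have pq : p^-1 + q^-1 = 1 by exact: conj_expE.
have q0 : 0 <= q by have := conj_exp_gt1 p1 pq; lra.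
move=> n n0; pose m := (absz n).-1.
have nm : - n = m%:Z + 1.
  by rewrite /m -(ltz0_abs n0) -[RHS]/((m + 1)%N%:Z) addn1 prednK// absz_gt0 lt_eqF.
pose h t : C := t ^ (- n - 1).
pose k t : C := al t ^+ m * (chi t)^-1.
have hE t : t * J h t = t ^ 1 * k t.
  by rewrite /Jalpha /h /k nm addrK -exprnP expr1z [X in _ * X]mulrC.
have Ba := (alphaX_le m).1.
have Bk : Bdd k by apply: BddM Ba _; exact: Bdd_chiV.
have sk : spec_le k (-1).
  by rewrite -[X in spec_le _ X]add0r; exact: spec_leM_bdd Ba Bdd_chiV (alphaX_le m).2 spec_chiV.
have Btk : Bdd (fun t => t ^ 1 * k t) by apply: BddM Bk; apply: Bdd_trig; exact: trig_expz.
have stk : spec_le (fun t => t ^ 1 * k t) 0.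
  move=> i i1; rewrite (eq_fourier (g := fun t => k t * t ^ 1)); last by move=> t _; rewrite mulrC.
  by rewrite fourier_shift sk// ltrBrDr addNr.
rewrite fourierE (@cmean_J p f (fun t => t ^ (- n)) h p1).
- rewrite (_ : cmean _ = cmean (fun t => f t * (t ^ 1 * k t))); last first.
    by apply: eq_cmean => t t1; rewrite hE.
  have Ltk : inLp q (fun t => t ^ 1 * k t) by exact: Bdd_Lp.
  by rewrite cmean_fourier0 (spec_leM p1 pq fp Ltk f0 stk).
- apply: (@inLp_eq R p (fun t => f t * (t ^ 1 * k t))) => // [t _|]; first by rewrite hE.
  exact: BddMr.
- by move=> t t1; rewrite /h mulrC -exprN1 expfzDr ?circ_neq0.
Qed.

End Weighted.

End WeightedComposition.

(** * Kernel and range *)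

Section KernelRange.
Variable R : realType.
Local Notation C := (R[i]).
Local Notation mu := (@lebesgue_measure R).
Local Notation Re := (@complex.Re R).
Local Notation Im := (@complex.Im R).
Implicit Types (f g h : C -> C) (z w t : C) (p q : R).

Opaque npow cmean fourier.

(** The theorem of M. Riesz supplies the witness that gives the choice in [RieszP] its meaning. *)
Lemma RieszP_spec p f : 1 < p -> inLp p f -> inLp p (RieszP p f) /\
  forall n : int, fourier (RieszP p f) n = (0 <= n)%R%:R * fourier f n.
Proof.
move=> p1 fp; have [g [gp gf _]] := riesz_projection p1 fp.
have [|[L neg] pos] := ClassicalEpsilon.epsilon_spec (inhabits (fun _ : C => 0 : C))
    (fun g => Hp p g /\ forall n : int, (0 <= n)%R -> fourier g n = fourier f n).
  exists g; split; first split; first exact/LpE.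
    by move=> n n0; rewrite gf leNgt n0 mul0r.
  by move=> n n0; rewrite gf n0 mul1r.
rewrite -/(RieszP p f) in L neg pos; split; first exact/LpE.
move=> n; have [n0|n0] := leP 0 n; first by rewrite mul1r pos.
by rewrite mul0r neg.
Qed.

Lemma BddM_spec_ge p f g (m n : int) : 1 < p -> Bdd f -> inLp p g -> spec_ge f m ->
  spec_ge g n -> spec_ge (fun t => f t * g t) (m + n).
Proof.
move=> p1 Bf gp fm gn; have pq := conj_expE p1; have q1 := conj_exp_gt1 p1 pq.
have Lf : inLp (p / (p - 1)) f by apply: Bdd_Lp => //; lra.
have qp : (p / (p - 1))^-1 + p^-1 = 1 by rewrite addrC.
exact: (spec_geM q1 qp Lf gp fm gn).
Qed.

Lemma BddM_spec_le p f g (m n : int) : 1 < p -> Bdd f -> inLp p g -> spec_le f m ->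
  spec_le g n -> spec_le (fun t => f t * g t) (m + n).
Proof.
move=> p1 Bf gp fm gn; have pq := conj_expE p1; have q1 := conj_exp_gt1 p1 pq.
have Lf : inLp (p / (p - 1)) f by apply: Bdd_Lp => //; lra.
have qp : (p / (p - 1))^-1 + p^-1 = 1 by rewrite addrC.
exact: (spec_leM q1 qp Lf gp fm gn).
Qed.

Lemma aeT_eq_cst z z' : aeT_eq (fun=> z) (fun=> z') -> z = z'.
Proof.
move=> h; rewrite -(cmean_cst z) -(cmean_cst z').
by apply: cmean_ae => //; exact: meas_cst.
Qed.

Lemma aeT_eqW f g : (forall t, cmod t = 1 -> f t = g t) -> aeT_eq f g.
Proof. exact: (@aeTW R (fun t => f t = g t)). Qed.

Lemma spec_disjoint f g : inLp 1 f -> inLp 1 g -> spec_ge f 0 -> spec_le g (-1) ->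
  aeT_eq f g -> aeT_eq f (fun=> 0).
Proof.
move=> f1 g1 f0 g0 fg; apply: fourier_uniqueness => // n.
have [n0|n0] := ltP n 0; first exact: f0.
by rewrite (fourier_ae n (Lp_meas f1) (Lp_meas g1) fg) g0// -lezD1 addNr.
Qed.

(** * Eigenfunctions of the weighted composition operator *)

Section Eigen.
Variable beta : C.
Hypothesis beta1 : 1 < cmod beta.
Local Notation al := (alpha beta).
Local Notation chi := (chi beta).
Local Notation J := (Jalpha beta).

(** For [d] equal to 1 or [chi] the two sides have disjoint spectra. For the inverse of [chi] one
    gets [h = - chi * J h], which has no positive frequencies, so [h] is constant; since [J]
    multiplies constants by the inverse of [chi], the sign forces that constant to be 0. *)
Lemma eigen_zero p h (d : C -> C) z : 1 < p -> inLp p h -> spec_ge h 0 -> z != 0 ->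
  (forall t, cmod t = 1 -> d t = 1) \/ (forall t, cmod t = 1 -> d t = chi t) \/
  ((forall t, cmod t = 1 -> d t = (chi t)^-1) /\ z = -1) ->
  aeT_eq (J h) (fun t => z * (d t * h t)) -> aeT_eq h (fun=> 0).
Proof.
move=> p1 hp h0 z0 cases hJ; have p0 : 0 <= p by lra.
have L1 (f : C -> C) : inLp p f -> inLp 1 f by apply: Lp1_Lp; exact: ltW.
have LJ := Lp_J beta1 p0 hp.
have sJ := spec_J_hardy beta1 p1 hp h0.
have Bchi := Bdd_chi beta1.
have Lchi := BddMl p0 Bchi hp.
case: cases => [d1|[dchi|[dchi z1]]].
- have e : aeT_eq (fun t => z * h t) (J h).
    by apply: aeT_eqS hJ => t t1 ->; rewrite d1// mul1r.
  have hz : aeT_eq (fun t => z * h t) (fun=> 0).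
    apply: (spec_disjoint _ _ _ sJ e); [exact/L1/LpZ|exact: L1|].
    by apply: spec_geZ => //; exact: L1.
  apply: aeT_eqS hz => t _ /eqP; rewrite mulf_eq0 (negPf z0) /=.
  by move/eqP.
- have e : aeT_eq (fun t => z * (chi t * h t)) (J h).
    by apply: aeT_eqS hJ => t t1 ->; rewrite dchi.
  have hz : aeT_eq (fun t => z * (chi t * h t)) (fun=> 0).
    apply: (spec_disjoint _ _ _ sJ e); [exact/L1/LpZ|exact: L1|].
    apply: spec_geZ; first exact: L1.
    by rewrite -[0]addr0; apply: BddM_spec_ge p1 Bchi hp _ h0; case: (spec_chi beta1).
  apply: aeT_eqS hz => t t1 /eqP.
  rewrite mulf_eq0 (negPf z0) mulf_eq0 (negPf (chi_neq0 beta1 t1)) /=.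
  by move/eqP.
have hle : spec_le h 0.
  have hJ' : aeT_eq (fun t => -1 * (chi t * J h t)) h.
    apply: aeT_eqS hJ => t t1 ->; rewrite dchi// z1; have c0 := chi_neq0 beta1 t1.
    by field.
  have L' : inLp p (fun t => -1 * (chi t * J h t)) by apply: LpZ => //; exact: BddMl.
  move=> n n0; rewrite -(fourier_ae n (Lp_meas L') (Lp_meas hp) hJ').
  rewrite fourierZ; last by apply: L1; exact: BddMl.
  by rewrite (BddM_spec_le p1 Bchi LJ (spec_chi beta1).2 sJ)// mulr0.
have hc : aeT_eq h (fun=> fourier h 0).
  apply: fourier_inj_ae; [exact: L1|exact: Lp_cst|] => n.
  have hE : fourier (fun=> fourier h 0) n = fourier h 0 * (n == 0)%R%:R.
    rewrite fourierE cmeanZ ?cmean_expz ?oppr_eq0//.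
    by apply: trig_Lp => //; exact: trig_expz.
  rewrite hE; have [n0|n0|->] := ltgtP n 0; rewrite ?mulr0 ?mulr1//; [exact: h0|exact: hle].
have e2 := J_ae beta1 hc.
have e3 : aeT_eq (fun=> fourier h 0) (fun=> - fourier h 0).
  have e4 : aeT_eq (J h) (fun t => - (chi t)^-1 * fourier h 0).
    apply: aeT_eqS2 hJ hc => t t1 -> ->; rewrite dchi// z1; ring.
  apply: aeT_eqS2 e2 e4 => t t1 -> ; rewrite /Jalpha => e.
  have c0 := chi_neq0 beta1 t1; apply: (mulfI (x := (chi t)^-1)); first by rewrite invr_eq0.
  by rewrite e; ring.
have f0 : fourier h 0 = 0.
  have := aeT_eq_cst e3 => /eqP; rewrite -subr_eq0 opprK -mulr2n mulrn_eq0 /=.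
  by move/eqP.
by apply: aeT_eqS hc => t _ ->.
Qed.

End Eigen.

(** The adjoint of the projection: [g] is [k] stripped of its positive frequencies, obtained by
    projecting the conjugate of [k]. It turns a functional on projected functions into one on
    unprojected products. *)
Lemma projection_pairing p q k : 1 < p -> p^-1 + q^-1 = 1 -> inLp q k ->
  exists g, [/\ inLp q g, spec_le g 0 & forall v h, inLp p v -> inLp p h ->
    (forall n : int, fourier h n = (0 <= n)%R%:R * fourier v n) ->
    cmean (fun t => k t * h t) = cmean (fun t => g t * v t)].
Proof.
move=> p1 pq kq; have q1 := conj_exp_gt1 p1 pq; have q0 : 0 <= q by lra.
have p0 : 0 <= p by lra.
have qp : q^-1 + p^-1 = 1 by rewrite addrC.
have uq := LpJ q0 kq.
have [U [LU fU _]] := riesz_projection q1 uq.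
have L1 (f : C -> C) : inLp q f -> inLp 1 f by apply: Lp1_Lp; exact: ltW.
have L1p (f : C -> C) : inLp p f -> inLp 1 f by apply: Lp1_Lp; exact: ltW.
have Lg := LpJ q0 LU.
have sU : spec_ge U 0 by move=> n n0; rewrite fU leNgt n0 mul0r.
exists (fun t => conjc (U t)); split => //.
  by rewrite -[0]oppr0; apply: spec_leJ => //; exact: L1.
move=> v h vp hp hv.
have sg : spec_le (fun t => conjc (U t)) 0 by rewrite -[0]oppr0; apply: spec_leJ => //; exact: L1.
have sh : spec_ge h 0 by move=> n n0; rewrite hv leNgt n0 mul0r.
have shv : spec_le (fun t => h t - v t) (-1).
  move=> n; rewrite -lezD1 addNr => n0.
  by rewrite fourierB ?hv ?n0 ?mul1r ?subrr//; exact: L1p.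
have skg : spec_ge (fun t => k t - conjc (U t)) 1.
  move=> n n1; have n0 : n <= 0 by rewrite -ltzD1 add0r.
  rewrite fourierB; [|exact: L1|exact: L1].
  rewrite fourierJ ?fU; last exact: L1.
  rewrite oppr_ge0 n0 mul1r fourierJ; last exact: L1.
  by rewrite opprK conjcK subrr.
apply/eqP; rewrite -subr_eq0; apply/eqP.
have m1 : cmean (fun t => (k t - conjc (U t)) * h t) = 0.
  rewrite cmean_fourier0; have := spec_geM q1 qp (LpB q0 kq Lg) hp skg sh.
  by rewrite addr0; apply.
have m2 : cmean (fun t => conjc (U t) * (h t - v t)) = 0.
  rewrite cmean_fourier0; have := spec_leM q1 qp Lg (LpB p0 hp vp) sg shv.
  by rewrite add0r; apply.
rewrite -cmeanB; [|exact: (Lp1_mul q1 qp)|exact: (Lp1_mul q1 qp)].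
rewrite (_ : cmean _ = cmean (fun t => (k t - conjc (U t)) * h t + conjc (U t) * (h t - v t))).
  rewrite cmeanD ?m1 ?m2 ?addr0//; apply: (Lp1_mul q1 qp) => //; exact: LpB.
by apply: eq_cmean => t _; ring.
Qed.

(** * The alternative between trivial kernel and dense range *)

Section Coburn.
Variables (p q : R) (beta : C) (a ai c : C -> C) (s : C).
Hypothesis p1 : 1 < p.
Hypothesis pq : p^-1 + q^-1 = 1.
Hypothesis beta1 : 1 < cmod beta.
Hypothesis aL : Linf a.
Hypothesis aV : aeT_eq (fun t => a t * ai t) (fun=> 1).
Hypothesis Bc : Bdd c.
Hypothesis ss : s * s = 1.
Local Notation al := (alpha beta).
Local Notation chi := (chi beta).
Local Notation J := (Jalpha beta).
Hypothesis cases :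
  (forall t, cmod t = 1 -> c t = 1) \/
  ((forall t, cmod t = 1 -> c t = chi t) /\ s = 1) \/
  ((forall t, cmod t = 1 -> c t = (chi t)^-1) /\ s = -1).

Let p0 : 0 <= p. Proof. by apply: ltW; apply: lt_trans p1. Qed.
Let q1 : 1 < q. Proof. exact: conj_exp_gt1 p1 pq. Qed.
Let q0 : 0 <= q. Proof. by apply: ltW; apply: lt_trans q1. Qed.
Let qp : q^-1 + p^-1 = 1. Proof. by rewrite addrC. Qed.

Lemma Linf_mul r f : 0 <= r -> inLp r f -> inLp r (fun t => a t * f t).
Proof. by move=> r0; case: aL => ma [M hM]; apply: (LpM (M := M)). Qed.

Lemma c_alpha t : cmod t = 1 -> c (al t) * c t = 1.
Proof.
move=> t1; have a1 := cmod_alpha beta1 t1; have c0 := chi_neq0 beta1 t1.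
case: cases => [h|[[h _]|[h _]]]; rewrite !h ?mulr1// chi_alpha//.
  by rewrite mulVf.
by rewrite invrK divff.
Qed.

Lemma c_neq0 t : cmod t = 1 -> c t != 0.
Proof. by move=> t1; apply/eqP => h; have := c_alpha t1; rewrite h mulr0 => /esym/eqP; rewrite oner_eq0. Qed.

Lemma c_alphaV t : cmod t = 1 -> c (al t) = (c t)^-1.
Proof. by move=> t1; apply: (mulIf (c_neq0 t1)); rewrite c_alpha// mulVf// c_neq0. Qed.

Definition symm f t : C := f t + s * (c t * J f t).

Lemma Lp_symm r f : 0 <= r -> inLp r f -> inLp r (symm f).
Proof.
by move=> r0 fr; apply: LpD => //; apply: LpZ => //; apply: BddMl => //; exact: Lp_J.
Qed.

(** The map [s * c * J] is an involution, because [c (alpha t) * c t = 1] and [s * s = 1]. It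
    therefore fixes [symm f], and this is the fixed point equation solved for the value at
    [alpha t]. *)
Lemma symm_alpha f t : cmod t = 1 -> symm f (al t) = s * chi t * (c t)^-1 * symm f t.
Proof.
move=> t1; have c0 := c_neq0 t1; have x0 := chi_neq0 beta1 t1.
rewrite /symm /Jalpha chi_alpha// alphaK// invrK c_alphaV//.
have -> : s * chi t / c t * (f t + s * (c t * ((chi t)^-1 * f (al t)))) =
   s * chi t / c t * f t + (s * s) * f (al t) by field; rewrite c0 x0.
by rewrite ss mul1r; ring.
Qed.

(** The complementary projection drops out of the Hankel operator because [P] annihilates [J f].
    Fourier coefficients are compared rather than values, since [RieszP] is determined only almost
    everywhere. *)
Lemma fourier_operator b f n : (forall t, cmod t = 1 -> b t = a t * c t) ->
  inLp p f -> spec_ge f 0 ->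
  let Af := fun t => Toeplitz p a f t + s * Hankel p beta b f t in
  inLp p Af /\ fourier Af n = (0 <= n)%R%:R * fourier (fun t => a t * symm f t) n.
Proof.
move=> bE fp f0 Af.
have LJ := Lp_J beta1 p0 fp; have sJ := spec_J_hardy beta1 p1 fp f0.
have L1 (h : C -> C) : inLp p h -> inLp 1 h by apply: Lp1_Lp; exact: ltW.
have [LP fP] := RieszP_spec p1 LJ.
have PJ0 : aeT_eq (RieszP p (J f)) (fun=> 0).
  apply: fourier_uniqueness; first exact: L1.
  move=> m; rewrite fP; have [m0|m0] := leP 0 m; last by rewrite mul0r.
  by rewrite sJ ?mulr0// -lezD1 addNr.
have LQ : inLp p (RieszQ p (J f)) by exact: LpB.
have Lb (h : C -> C) : inLp p h -> inLp p (fun t => b t * h t).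
  move=> hp; apply: (@inLp_eq R p (fun t => a t * (c t * h t))) => //.
    by move=> t t1; rewrite bE// mulrA.
  by apply: Linf_mul => //; exact: BddMl.
have [LT fT] := RieszP_spec p1 (Linf_mul p0 fp).
have [LH fH] := RieszP_spec p1 (Lb _ LQ).
split; first by apply: LpD => //; exact: LpZ.
rewrite /Af fourierD; [|exact: L1|exact/L1/LpZ].
rewrite fourierZ; last exact: L1.
rewrite fT fH.
rewrite (@fourier_ae R (fun t => b t * RieszQ p (J f) t) (fun t => b t * J f t) n); last 3 first.
- exact: Lp_meas (Lb _ LQ).
- exact: Lp_meas (Lb _ LJ).
- by apply: aeT_eqS PJ0 => t _ h; rewrite /RieszQ h subr0.
rewrite mulrCA -mulrDr -(@fourierZ R s); last exact: L1 (Lb _ LJ).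
rewrite -fourierD; [|exact: L1 (Linf_mul p0 fp)|exact: L1 (LpZ s p0 (Lb _ LJ))].
congr (_ * _); apply: eq_fourier => t t1; rewrite bE// /symm; ring.
Qed.

Lemma kernel_annihilator f g : inLp p f -> spec_ge f 0 ->
  spec_le (fun t => a t * symm f t) (-1) ->
  inLp q g -> spec_le g 0 -> ~ aeT_eq g (fun=> 0) ->
  (forall n : nat, cmean (fun t => g t * (a t * symm (fun t => t ^+ n) t)) = 0) ->
  aeT_eq f (fun=> 0).
Proof.
move=> fp f0 sX gq g0 gn0 gA.
pose psi t : C := t^-1 * (a t * g t).
have Lag : inLp q (fun t => a t * g t) by exact: Linf_mul.
have BV : Bdd (fun t : C => t^-1) by apply: Bdd_trig; exact: trigV.
have Lpsi : inLp q psi by exact: BddMl.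
have Lcpsi : inLp q (fun t => c t * psi t) by exact: BddMl.
have LJc := Lp_J beta1 q0 Lcpsi.
pose w t : C := psi t + s * J (fun t => c t * psi t) t.
have Lw : inLp q w by apply: LpD => //; exact: LpZ.
have L1 (h : C -> C) : inLp q h -> inLp 1 h by apply: Lp1_Lp; exact: ltW.
have sw : spec_ge w 0.
  (* The test function [t ^+ m] with [m = - n - 1] yields the coefficient of [w] at [n]; the shift
     by one is the factor [t^-1] in [psi]. *)
  move=> n n0; pose m := (absz n).-1.
  have nm : - n = m%:Z + 1.
    by rewrite /m -(ltz0_abs n0) -[RHS]/((m + 1)%N%:Z) addn1 prednK// absz_gt0 lt_eqF.
  have BJ : Bdd (fun t => J (fun t => t ^+ m) t).
    apply: BddM; first exact: Bdd_chiV.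
    by case: (alphaX_le beta1 m).
  have BtJ : Bdd (fun t => t * J (fun t => t ^+ m) t).
    by apply: BddM => //; apply: Bdd_trig; exact: trig_id.
  have Lt : inLp q (fun t => c t * psi t * (t * J (fun t => t ^+ m) t)) by exact: BddMr.
  rewrite fourierE -[RHS](gA m).
  rewrite (_ : cmean _ = cmean (fun t => psi t * t ^ (- n) +
      s * (J (fun t => c t * psi t) t * t ^ (- n)))); last first.
    by apply: eq_cmean => t _; rewrite /w; ring.
  have LJt := LpMzr (- n) q0 LJc.
  rewrite cmeanD; [|exact/L1/LpMzr|exact/L1/LpZ].
  rewrite cmeanZ; last exact: L1.
  rewrite (@cmean_J R _ beta1 q (fun t => c t * psi t) (fun t => t ^ (- n)) (fun t => t ^+ m) q1 Lt);
    last first.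
    by move=> t t1; rewrite nm expfzDr ?circ_neq0// expr1z -exprnP mulrC mulfK ?circ_neq0.
  rewrite -cmeanZ; last exact: L1.
  rewrite -cmeanD; [|exact/L1/LpMzr|exact/L1/LpZ].
  apply: eq_cmean => t t1; have t0 := circ_neq0 t1.
  by rewrite nm expfzDr// expr1z -exprnP /symm /psi; field.
have s0 : s != 0 by apply/eqP => h; have := ss; rewrite h mulr0 => /esym/eqP; rewrite oner_eq0.
have wJ : aeT_eq (J w) (fun t => s * (c t * w t)).
  apply: aeT_eqW => t t1.
  have x0 := chi_neq0 beta1 t1; have c0 := c_neq0 t1.
  rewrite /w /Jalpha chi_alpha// alphaK// c_alphaV// invrK.
  have -> : s * (c t * (psi t + s * ((chi t)^-1 * ((c t)^-1 * psi (al t))))) =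
     s * (c t * psi t) + (s * s) * ((chi t)^-1 * psi (al t)) by field; rewrite x0 c0.
  by rewrite ss; field.
have w0 : aeT_eq w (fun=> 0).
  apply: (eigen_zero beta1 q1 Lw sw s0 _ wJ).
  by case: cases => [h|[[h e]|[h e]]]; [left|right; left|right; right].
have psia : aeT_eq (fun t => psi (al t)) (fun t => - (s * (chi t * (c t * psi t)))).
  apply: aeT_eqS w0 => t t1; have x0 := chi_neq0 beta1 t1; have c0 := c_neq0 t1.
  rewrite /w /Jalpha c_alphaV// => h.
  have -> : psi t = - (s * ((chi t)^-1 * ((c t)^-1 * psi (al t)))).
    by apply/eqP; rewrite -addr_eq0 h.
  have -> : - (s * (chi t * (c t * - (s * ((chi t)^-1 * ((c t)^-1 * psi (al t))))))) =
     (s * s) * psi (al t) by field; rewrite x0 c0.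
  by rewrite ss mul1r.
pose X t : C := a t * symm f t.
pose Y t : C := t^-1 * g t.
have LX : inLp p X by apply: Linf_mul => //; exact: Lp_symm.
have LY : inLp q Y by exact: BddMl.
have sY : spec_le Y (-1).
  move=> n n1; rewrite (eq_fourier (g := fun t => g t * t ^ (-1))); last first.
    by move=> t _; rewrite /Y mulrC exprN1.
  by rewrite fourier_shift g0// opprK -[ltLHS](addNr 1) ltrD2r.
have LXY : inLp 1 (fun t => X t * Y t) by exact: (Lp1_mul p1 pq).
have LJX := Lp_J beta1 p0 LX; have LJY := Lp_J beta1 q0 LY.
have LJXY : inLp 1 (fun t => J X t * J Y t) by exact: (Lp1_mul p1 pq).
have sJX := spec_J_anti beta1 p1 LX sX; have sJY := spec_J_anti beta1 q1 LY sY.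
(* As [X * Y = symm f * psi], the composite of [a] with [alpha] never has to be evaluated, and the
   factors [c] in the transformation laws of [symm f] and [psi] cancel. *)
have XYE : aeT_eq (fun t => J X t * J Y t) (fun t => -1 * (X t * Y t)).
  apply: aeT_eqS psia => t t1 h; have x0 := chi_neq0 beta1 t1; have c0 := c_neq0 t1.
  have XYp r : X r * Y r = symm f r * psi r by rewrite /X /Y /psi; ring.
  rewrite /Jalpha mulrACA !XYp symm_alpha// h.
  have -> : (chi t)^-1 / chi t * (s * chi t / c t * symm f t * - (s * (chi t * (c t * psi t)))) =
     - (s * s) * (symm f t * psi t) by field; rewrite x0 c0.
  by rewrite ss.
have JXY0 (n : int) : fourier (fun t => J X t * J Y t) n = 0.
  have [n0|n0] := ltP n 0.
    by rewrite (spec_geM p1 pq LJX LJY sJX sJY)// addr0.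
  have L' : inLp 1 (fun t => -1 * (X t * Y t)) by exact: LpZ.
  rewrite (fourier_ae n (Lp_meas LJXY) (Lp_meas L') XYE) fourierZ//.
  by rewrite (spec_leM p1 pq LX LY sX sY) ?mulr0// (lt_le_trans _ n0).
have Jinv (h : C -> C) : aeT_eq (J h) (fun=> 0) -> aeT_eq h (fun=> 0).
  move=> e; have := J_ae beta1 e; apply: aeT_eqS => t t1.
  by rewrite JK// => ->; rewrite /Jalpha mulr0.
case: (spectrum_mul_eq0 p1 pq LJX LJY sJX sJY JXY0) => /Jinv e; last first.
  exfalso; apply: gn0; apply: aeT_eqS e => t t1 /eqP.
  by rewrite /Y mulf_eq0 invr_eq0 (negPf (circ_neq0 t1)) /= => /eqP.
have phi0 : aeT_eq (symm f) (fun=> 0).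
  apply: aeT_eqS2 e aV => t t1; rewrite /X => e1 e2.
  by rewrite -[LHS]mul1r -e2 mulrAC e1 mul0r.
(* Compared with the equation for [w], the weight is inverted and the sign reversed. The exceptional
   case of [eigen_zero] thus arises here for [c = chi] and there for the inverse of [chi], each time
   with the admissible factor -1. *)
apply: (@eigen_zero _ beta1 p f (fun t => (c t)^-1) (- s) p1 fp f0).
- by rewrite oppr_eq0.
- case: cases => [h|[[h e1]|[h e1]]].
  + by left => t t1; rewrite h// invr1.
  + by right; right; split; [move=> t t1; rewrite h|rewrite e1].
  + by right; left => t t1; rewrite h// invrK.
apply: aeT_eqS phi0 => t t1; have c0 := c_neq0 t1; rewrite /symm => h.
have -> : f t = - (s * (c t * J f t)) by apply/eqP; rewrite -addr_eq0 h.
have -> : - s * ((c t)^-1 * - (s * (c t * J f t))) = (s * s) * J f t by field.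
by rewrite ss mul1r.
Qed.

Lemma lpnorm_lt f (e : R) : 0 < e -> npow p f < e `^ p -> lpnorm p f < e.
Proof.
move=> e0 h; rewrite /lpnorm -/(pint p f) -/(npow p f).
have pp : 0 < p by apply: lt_trans p1.
have -> : e = (e `^ p) `^ p^-1 by rewrite -powRrM divff ?gt_eqF// powRr1// ltW.
by apply: gt0_ltr_powR; rewrite ?invr_gt0// ?nnegrE ?npow_ge0 ?powR_ge0.
Qed.

(** Without density some [g'] has positive distance from the range. The annihilator [k] of the range
    becomes [g] through [projection_pairing], and [g] is nonzero because it pairs with [g'] as [k]
    does. *)
Lemma operator_alternative b : (forall t, cmod t = 1 -> b t = a t * c t) ->
  let A := fun f : C -> C => (fun t => Toeplitz p a f t + s * Hankel p beta b f t) in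
  (forall f, Hp p f -> aeT_eq (A f) (fun _ => 0) -> aeT_eq f (fun _ => 0)) \/
  (forall g, Hp p g -> forall eps : R, 0 < eps ->
     exists f, Hp p f /\ lpnorm p (fun t => A f t - g t) < eps).
Proof.
move=> bE A.
have [dense|ndense] := pselect (forall g, Hp p g -> forall eps : R, 0 < eps ->
     exists f, Hp p f /\ lpnorm p (fun t => A f t - g t) < eps); first by right.
left => f [/LpE fp f0] Af0.
have [g' [hg' [eps [eps0 far]]]] : exists g', Hp p g' /\ exists eps : R, 0 < eps /\
    forall f, Hp p f -> ~ lpnorm p (fun t => A f t - g' t) < eps.
  apply: contrapT => H; apply: ndense => g' hg' eps eps0.
  apply: contrapT => H'; apply: H; exists g'; split => //; exists eps; split => // h hh hl.
  by apply: H'; exists h.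
case: hg' => /LpE Lg' sg'.
have L1 (h : C -> C) : inLp p h -> inLp 1 h by apply: Lp1_Lp; exact: ltW.
have L1J h : inLp p h -> inLp 1 (fun t => a t * symm h t).
  by move=> hp; apply: L1; apply: Linf_mul => //; exact: Lp_symm.
(* The range is described through Fourier coefficients: [RieszP] chooses a representative for each
   function separately, so the functions [A f] themselves need not form a linear space. *)
pose M h := inLp p h /\ exists f, [/\ inLp p f, spec_ge f 0 &
  forall n : int, fourier h n = (0 <= n)%R%:R * fourier (fun t => a t * symm f t) n].
have symmD f1 f2 t : symm (fun t => f1 t + f2 t) t = symm f1 t + symm f2 t.
  by rewrite /symm /Jalpha; ring.
have symmZ z f1 t : symm (fun t => z * f1 t) t = z * symm f1 t.
  by rewrite /symm /Jalpha; ring.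
have M0 : M (fun=> 0).
  have fc (n : int) : fourier (fun=> 0 : C) n = 0.
    rewrite fourierE -[RHS](cmean_cst (0 : C)); apply: eq_cmean => t _; exact: mul0r.
  split; first exact: Lp_cst.
  exists (fun=> 0); split; [exact: Lp_cst|by move=> n _|move=> n].
  rewrite fc (eq_fourier (g := fun=> 0)) ?fc ?mulr0// => t _.
  by rewrite /symm /Jalpha !(mulr0, addr0).
have MD m m' : M m -> M m' -> M (fun t => m t + m' t).
  move=> [Lm [f1 [Lf1 s1 e1]]] [Lm' [f2 [Lf2 s2 e2]]]; split; first exact: LpD.
  exists (fun t => f1 t + f2 t); split; first exact: LpD.
    by move=> n n0; rewrite fourierD ?s1 ?s2 ?addr0//; exact: L1.
  move=> n; rewrite fourierD; [|exact: L1|exact: L1].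
  rewrite e1 e2 -mulrDr -fourierD; [|exact: L1J|exact: L1J].
  congr (_ * _); apply: eq_fourier => t _.
  by rewrite (symmD f1 f2) -mulrDr.
have MZ z m : M m -> M (fun t => z * m t).
  move=> [Lm [f1 [Lf1 s1 e1]]]; split; first exact: LpZ.
  exists (fun t => z * f1 t); split; first exact: LpZ.
    by apply: spec_geZ => //; exact: L1.
  move=> n; rewrite fourierZ; last exact: L1.
  rewrite e1 mulrCA -(@fourierZ R z); last exact: L1J.
  congr (_ * _); apply: eq_fourier => t _.
  by rewrite (symmZ z f1); exact: mulrCA.
have ep0 : 0 < eps `^ p by rewrite powR_gt0.
have farM m : M m -> eps `^ p <= npow p (fun t => g' t - m t).
  move=> [Lm [f1 [Lf1 s1 e1]]]; rewrite leNgt; apply/negP => hlt.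
  have [LA _] := fourier_operator 0 bE Lf1 s1.
  apply: (far f1); first by split => //; exact/LpE.
  apply: (lpnorm_lt eps0); apply: le_lt_trans hlt; rewrite npow_distC.
  have mA : aeT_eq m (A f1).
    apply: fourier_inj_ae; [exact: L1|exact: L1|] => n.
    by rewrite e1; have [_ ->] := fourier_operator n bE Lf1 s1.
  rewrite (@npow_ae R p _ (fun t => g' t - m t)) //; try exact: LpB.
  by apply: aeT_eqS mA => t _ ->.
have [k [kq km kg']] := annihilator p1 pq (fun m (Mm : M m) => Mm.1) M0 MD MZ Lg' ep0 farM.
have [g [Lg sg gpair]] := projection_pairing p1 pq kq.
apply: (@kernel_annihilator f g) => //.
- move=> n; rewrite -lezD1 addNr => n0.
  have [LA e] := fourier_operator n bE fp f0.
  move: e; rewrite n0 mul1r => <-.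
  rewrite (@fourier_ae R _ (fun=> 0) n (Lp_meas LA) (meas_cst 0) Af0).
  rewrite fourierE -[RHS](cmean_cst (0 : C)); apply: eq_cmean => t _; exact: mul0r.
- move=> g0; move/eqP: kg'; apply.
  rewrite (gpair g' g' Lg' Lg'); last first.
    by move=> n; have [n0|n0] := leP 0 n; rewrite ?mul1r// mul0r sg'.
  rewrite -[RHS](cmean_cst (0 : C)); apply: cmean_ae.
  + by apply: measM; [exact: Lp_meas Lg|exact: Lp_meas Lg'].
  + exact: meas_cst.
  + by apply: aeT_eqS g0 => t _ ->; rewrite mul0r.
move=> n.
have Ln : inLp p (fun t => t ^+ n).
  by apply: trig_Lp => //; apply: trigX; exact: trig_id.
have sn : spec_ge (fun t => t ^+ n) 0.
  by apply: (@spec_geW R _ n%:Z) => //; exact: (@spec_ge_expz R n%:Z).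
have Lv : inLp p (fun t => a t * symm (fun t => t ^+ n) t).
  by apply: Linf_mul => //; exact: Lp_symm.
have [h [Lh fh _]] := riesz_projection p1 Lv.
rewrite -(gpair _ h Lv Lh fh); apply: km; split => //.
by exists (fun t => t ^+ n).
Qed.

End Coburn.

End KernelRange.

Local Close Scope classical_set_scope.

(* A = T(a) + s * H_alpha(b) with (b, s) one of the four combinations.
   min{dim ker A, dim coker A} = 0 means: ker A = {0} in H^p, or the range
   of A is dense in H^p. *)
Theorem theorem8p1 (R : realType) (p : R) (beta : R[i]) (a b : R[i] -> R[i]) (s : R[i]) :
  1 < p -> 1 < cmod beta -> GLinf a ->
  ((b = (fun t => a t * (chi beta t)^-1) /\ s = -1) \/
   (b = (fun t => a t * chi beta t) /\ s = 1) \/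
   (b = a /\ s = 1) \/
   (b = a /\ s = -1)) ->
  let A := fun f : R[i] -> R[i] =>
    (fun t => Toeplitz p a f t + s * Hankel p beta b f t) in
  (forall f, Hp p f -> aeT_eq (A f) (fun _ => 0) -> aeT_eq f (fun _ => 0)) \/
  (forall g, Hp p g -> forall eps : R, 0 < eps ->
     exists f, Hp p f /\ lpnorm p (fun t => A f t - g t) < eps).
Proof.
move=> p1 beta1 [aL [ai [_ aV]]] cases.
have pq := conj_expE p1.
have B1 : Bdd (fun=> 1 : R[i]) by apply: Bdd_trig; exact: trig_cst.
case: cases => [[-> ->]|[[-> ->]|[[-> ->]|[-> ->]]]].
- apply: (operator_alternative p1 pq beta1 aL aV (Bdd_chiV beta1)) => //.
  + by rewrite mulrNN mulr1.
  + by right; right.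
- apply: (operator_alternative p1 pq beta1 aL aV (Bdd_chi beta1)) => //.
  + by rewrite mulr1.
  + by right; left.
- apply: (operator_alternative p1 pq beta1 aL aV B1).
  + by rewrite mulr1.
  + by left.
  + by move=> t _; rewrite mulr1.
- apply: (operator_alternative p1 pq beta1 aL aV B1).
  + by rewrite mulrNN mulr1.
  + by left.
  + by move=> t _; rewrite mulr1.
Qed.
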